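(* Let $\mathcal{H}$ be a Galois homogeneous foliation of degree $d\geq3$ on $\mathbb{P}^2_{\mathbb{C}}$. Denote by $\mathrm{Gal}(\underline{\mathcal{G}}_{\mathcal{H}})$ the Galois group of the (ramified) covering $\underline{\mathcal{G}}_{\mathcal{H}}:\mathbb{P}^1_{\mathbb{C}}\to\mathbb{P}^1_{\mathbb{C}}$. The following dichotomy holds. - If $\mathrm{Gal}(\underline{\mathcal{G}}_{\mathcal{H}})$ is cyclic, then the $d$-web $\mathrm{Leg}\,\mathcal{H}$ is flat if and only if $\mathcal{H}$ is linearly conjugate to one of the two foliations $\mathcal{H}_1^d$ and $\mathcal{H}_2^d$ defined respectively by the $1$-forms $$\omega_1^{\,d}=y^d\,\mathrm{d}x-x^d\,\mathrm{d}y\qquad\text{and}\qquad \omega_2^{\,d}=x^d\,\mathrm{d}x-y^d\,\mathrm{d}y.$$ - If $\mathrm{Gal}(\underline{\mathcal{G}}_{\mathcal{H}})$ is non-cyclic, then the $d$-web $\mathrm{Leg}\,\mathcal{H}$ is flat.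
   Context: $\mathbb{C}[x,y]_d$ denotes the space of homogeneous polynomials of degree $d$. A homogeneous foliation $\mathcal{H}$ of degree $d$ on $\mathbb{P}^2_{\mathbb{C}}$ is one given, in suitable affine coordinates $(x,y)$, by a $1$-form $\omega=A(x,y)\,\mathrm{d}x+B(x,y)\,\mathrm{d}y$ with $A,B\in\mathbb{C}[x,y]_d$, $\gcd(A,B)=1$. Linear conjugation means conjugation by a linear change of the affine coordinates $(x,y)$. The associated rational map (of degree $d$) is $$\underline{\mathcal{G}}_{\mathcal{H}}:\mathbb{P}^1_{\mathbb{C}}\to\mathbb{P}^1_{\mathbb{C}},\qquad \underline{\mathcal{G}}_{\mathcal{H}}([y:x])=[-A(x,y):B(x,y)].$$ **Galois foliations.** A foliation $\mathcal{F}$ of degree $d$ on $\mathbb{P}^2_{\mathbb{C}}$ is Galois if there is a Zariski open subset $U$ of $\mathbb{P}^2_{\mathbb{C}}$ such that the Gauss map $\mathcal{G}_{\mathcal{F}}:\mathbb{P}^2_{\mathbb{C}}\dashrightarrow\check{\mathbb{P}}^2_{\mathbb{C}}$, sending a regular point $m$ to the tangent line at $m$ to the leaf of $\mathcal{F}$ through $m$, induces a Galois covering from $U$ onto $\mathcal{G}_{\mathcal{F}}(U)$, necessarily of degree $d$. (It is known that a homogeneous $\mathcal{H}$ is Galois if and only if $\underline{\mathcal{G}}_{\mathcal{H}}$ is a ramified Galois covering, i.e. the group $\mathrm{Gal}(\underline{\mathcal{G}}_{\mathcal{H}})$ of $\gamma\in\mathrm{Aut}(\mathbb{P}^1_{\mathbb{C}})$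 with $\underline{\mathcal{G}}_{\mathcal{H}}\circ\gamma=\underline{\mathcal{G}}_{\mathcal{H}}$ has order $d$.) **Legendre transform.** $\mathrm{Leg}\,\mathcal{H}$ is the $d$-web on the dual projective plane $\check{\mathbb{P}}^2_{\mathbb{C}}$ whose leaves are the tangent lines to the leaves of $\mathcal{H}$. In the affine chart $(p,q)$ of $\check{\mathbb{P}}^2_{\mathbb{C}}$ corresponding to the line $\{y=px-q\}$, it is given by the implicit differential equation $A(x,px-q)+pB(x,px-q)=0$ with $x=\frac{\mathrm{d}q}{\mathrm{d}p}$. **Flatness.** A $d$-web $\mathcal{W}$ on a complex surface is given locally by a $d$-symmetric $1$-form with isolated zeros (up to nowhere vanishing holomorphic factors) which at generic points is a product of $d$ pairwise linearly independent $1$-forms; its discriminant $\Delta(\mathcal{W})$ is the divisor where the discriminant of this form vanishes. For $d\ge 3$, in local coordinates $(u,v)$ near a point outside $\Delta(\mathcal{W})$, $\mathcal{W}$ is a superposition of $d$ pairwise transverse foliations defined by non-vanishing $1$-forms $\omega_1,\dots,\omega_d$; define $\delta_{ij}$ by $\omega_i\wedge\omega_j=\delta_{ij}\,\mathrm{d}u\wedge\mathrm{d}v$, let $\eta_{rst}$ ($r<s<t$) be the unique meromorphic $1$-form with $\mathrm{d}(\delta_{st}\omega_r)=\eta_{rst}\wedge\delta_{st}\omega_r$, $\mathrm{d}(\delta_{tr}\omega_s)=\eta_{rst}\wedge\delta_{tr}\omega_s$, $\mathrm{d}(\delta_{rs}\omega_t)=\eta_{rst}\wedge\delta_{rs}\omega_t$,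 and set $\eta(\mathcal{W})=\sum_{r<s<t}\eta_{rst}$, which is well defined up to adding $\mathrm{d}g/g$ with $g$ nowhere vanishing holomorphic. The curvature $K(\mathcal{W})=\mathrm{d}\,\eta(\mathcal{W})$ does not depend on choices and extends to a global meromorphic $2$-form with poles along $\Delta(\mathcal{W})$. The web $\mathcal{W}$ is flat if $K(\mathcal{W})\equiv 0$. *)

(* Defs.v *)
From HB Require Import structures.
From mathcomp Require Import all_boot all_order all_algebra.
From mathcomp Require Import all_classical all_reals all_analysis.
From mathcomp Require Import complex.
(* The notations of mpoly clash with those of MathComp-Analysis:
   [mpoly n K] is K[x_0, ..., x_(n-1)], [mpolyX K (mnm1 i)] is the variable
   x_i, and [ishomog1 d mdeg] is homogeneity of degree d. *)
From mathcomp Require Import -(notations) mpoly.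

Set Implicit Arguments.
Unset Strict Implicit.
Unset Printing Implicit Defensive.

Import Order.TTheory GRing.Theory Num.Theory numFieldNormedType.Exports.

Local Open Scope classical_set_scope.
Local Open Scope ring_scope.

(* The field of complex numbers, as a numClosedFieldType so that it inherits
   the topology and the normed space structures of MathComp-Analysis;
   [differentiable] and ['D_v] are then complex derivatives. *)
Definition Cplx (R : realType) : numClosedFieldType := R[i]%C.

Section HomogeneousFoliations.
Variable K : numClosedFieldType.

Definition ev n (P : mpoly n K) (v : 'rV[K]_n) : K := meval (v 0) P.

Definition vec2 (a b : K) : 'rV[K]_2 := \row_i [:: a; b]`_i.
Definition vec3 (a b c : K) : 'rV[K]_3 := \row_i [:: a; b; c]`_i.

(* The polynomial 1-form A dx + B dy on the affine plane is the pair (A, B);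
   x is the variable 0 and y the variable 1. *)
Definition pform := (mpoly 2 K * mpoly 2 K)%type.

Definition coprime_mpoly n (A B : mpoly n K) : Prop :=
  forall D A' B' : mpoly n K, A = D * A' -> B = D * B' ->
    exists2 c : K, c != 0 & D = mpolyC n c.

Definition homogeneous_foliation (d : nat) (w : pform) : Prop :=
  [/\ w.1 \is ishomog1 d mdeg, w.2 \is ishomog1 d mdeg
    & coprime_mpoly w.1 w.2].

Definition linear_subst (M : 'M[K]_2) : 2.-tuple (mpoly 2 K) :=
  [tuple \sum_i M i j *: mpolyX K (mnm1 i) | j < 2].

(* Pull-back of A dx + B dy by the linear map v |-> v *m M. *)
Definition pullback (M : 'M[K]_2) (w : pform) : pform :=
  let A := comp_mpoly (linear_subst M) w.1 in
  let B := comp_mpoly (linear_subst M) w.2 in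
  (M 0 0 *: A + M 0 1 *: B, M 1 0 *: A + M 1 1 *: B).

(* Two homogeneous 1-forms of the same degree with coprime coefficients define
   the same foliation iff they differ by a nonzero constant factor. *)
Definition linearly_conjugate (w w' : pform) : Prop :=
  exists2 M : 'M[K]_2, M \in unitmx &
  exists2 c : K, c != 0 & pullback M w = (c *: w'.1, c *: w'.2).

Definition omega1 (d : nat) : pform :=
  (mpolyX K (mnm1 1) ^+ d, - mpolyX K (mnm1 0) ^+ d).
Definition omega2 (d : nat) : pform :=
  (mpolyX K (mnm1 0) ^+ d, - mpolyX K (mnm1 1) ^+ d).

(* Equality of points of a projective space, given by nonzero vectors of
   homogeneous coordinates. *)
Definition proj_eq n (u v : 'rV[K]_n) : Prop :=
  exists2 c : K, c != 0 & u = c *: v.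

(* The rational map [y : x] |-> [- A(x, y) : B(x, y)] of the projective line;
   mind the order of the coordinates. *)
Definition gaussP1 (w : pform) (u : 'rV[K]_2) : 'rV[K]_2 :=
  let y := u 0 0 in let x := u 0 1 in
  vec2 (- ev w.1 (vec2 x y)) (ev w.2 (vec2 x y)).

(* Gal of the map above, as a set of invertible matrices: an automorphism of
   the projective line is such a matrix up to a nonzero scalar. *)
Definition Gal (w : pform) : set 'M[K]_2 :=
  [set M | M \in unitmx /\
     forall u : 'rV[K]_2, u != 0 ->
       proj_eq (gaussP1 w (u *m M)) (gaussP1 w u)].

Definition Gal_cyclic (w : pform) : Prop :=
  exists2 g, Gal w g &
    forall h, Gal w h -> exists n : int, exists2 c : K, c != 0 & h = c *: g ^ n.

(* The Gauss map of the foliation of the projective plane. The tangent line at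
   (x, y) is A X + B Y - (x A + y B) = 0; putting x = X/Z, y = Y/Z and clearing
   denominators gives the formula below. The singular points of the foliation
   are those where the three coordinates vanish. *)
Definition gaussP2 (w : pform) (m : 'rV[K]_3) : 'rV[K]_3 :=
  let X := m 0 0 in let Y := m 0 1 in let Z := m 0 2 in
  let A := ev w.1 (vec2 X Y) in let B := ev w.2 (vec2 X Y) in
  vec3 (Z * A) (Z * B) (- (X * A + Y * B)).

(* Zariski open subsets of the projective plane, as cones of nonzero vectors. *)
Definition zariski_open (U : set 'rV[K]_3) : Prop :=
  exists2 S : set (mpoly 3 K),
    (forall f, S f -> exists e, f \is ishomog1 e mdeg) &
    U = [set m | m != 0 /\ exists2 f, S f & ev f m != 0].

Definition apply3 (T : 'I_3 -> mpoly 3 K) (m : 'rV[K]_3) : 'rV[K]_3 :=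
  \row_i ev (T i) m.

(* A regular map from a Zariski open subset of the projective plane to the
   plane is globally given by three homogeneous polynomials of the same degree
   without common zero on it, the coordinate ring being factorial; U below
   does not contain the vector 0. *)
Definition regular_self_map (U : set 'rV[K]_3) (T : 'I_3 -> mpoly 3 K) : Prop :=
  (exists e, forall i, T i \is ishomog1 e mdeg) /\
  (forall m, U m -> U (apply3 T m)).

Definition automorphism (U : set 'rV[K]_3) (T : 'I_3 -> mpoly 3 K) : Prop :=
  regular_self_map U T /\
  exists2 T', regular_self_map U T' &
    forall m, U m -> proj_eq (apply3 T' (apply3 T m)) m /\
                     proj_eq (apply3 T (apply3 T' m)) m.

Definition deck_transformation (w : pform) (U : set 'rV[K]_3)
    (T : 'I_3 -> mpoly 3 K) : Prop :=
  automorphism U T /\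
  forall m, U m -> proj_eq (gaussP2 w (apply3 T m)) (gaussP2 w m).

(* The Gauss map is a finite covering from U onto its image: locally on the
   target there are finitely many continuous sections with values in U, each
   point of U lying on exactly one of them. *)
Definition gauss_covering (w : pform) (U : set 'rV[K]_3) : Prop :=
  forall m0, U m0 ->
  exists N : set 'rV[K]_3, exists k, exists s : 'I_k -> 'rV[K]_3 -> 'rV[K]_3,
    [/\ open N /\ N (gaussP2 w m0),
        forall i, {within N, continuous (s i)},
        forall i l, N l -> U (s i l) /\ proj_eq (gaussP2 w (s i l)) l
      & forall m, U m -> N (gaussP2 w m) ->
          exists! i, proj_eq m (s i (gaussP2 w m))].

(* Galois coverings of algebraic varieties: finite coverings whose group of
   deck transformations is transitive on the fibres. *)
Definition galois_foliation (w : pform) : Prop :=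
  exists U : set 'rV[K]_3,
    [/\ zariski_open U /\ U !=set0,
        forall m, U m -> gaussP2 w m != 0,
        gauss_covering w U
      & forall m m', U m -> U m' -> proj_eq (gaussP2 w m) (gaussP2 w m') ->
          exists2 T, deck_transformation w U T & proj_eq (apply3 T m) m'].

End HomogeneousFoliations.

Section Webs.
Variable K : numClosedFieldType.
Implicit Types U : set 'rV[K]_2.

(* A 1-form a du + b dv on (a subset of) the plane with coordinates (u, v) is
   the function z |-> (a z, b z). *)
Definition form1 := 'rV[K]_2 -> 'rV[K]_2.

Definition holomorphic_form U (a : form1) : Prop :=
  forall z, U z -> differentiable a z.

Definition contract (a v : 'rV[K]_2) : K := \sum_i a 0 i * v 0 i.

(* Coefficients of du /\ dv in a /\ b and in the exterior derivative of a. *)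
Definition wedge (a b : 'rV[K]_2) : K := a 0 0 * b 0 1 - a 0 1 * b 0 0.
Definition ext_deriv (a : form1) (z : 'rV[K]_2) : K :=
  'D_('e_0) (fun t => a t 0 1) z - 'D_('e_1) (fun t => a t 0 0) z.

(* A d-symmetric 1-form, as a homogeneous polynomial function of degree d of
   the tangent vector at each point. *)
Definition symform := 'rV[K]_2 -> 'rV[K]_2 -> K.

(* On the open set U the web W is the superposition of the d pairwise
   transverse foliations defined by the 1-forms a i; every point outside the
   discriminant of W has such a neighbourhood, and no point of the
   discriminant does. *)
Definition local_foliations (d : nat) (W : symform) U (a : 'I_d -> form1)
    : Prop :=
  [/\ open U,
      forall i, holomorphic_form U (a i),
      forall i z, U z -> a i z != 0,
      forall i j z, U z -> i != j -> wedge (a i z) (a j z) != 0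
    & forall z, U z -> exists2 c : K, c != 0 &
        forall v, W z v = c * \prod_i contract (a i z) v].

Definition delta (a b : form1) (z : 'rV[K]_2) : K := wedge (a z) (b z).

Definition eta_equation U (a b c h : form1) : Prop :=
  forall z, U z ->
    ext_deriv (fun t => delta b c t *: a t) z
    = wedge (h z) (delta b c z *: a z).

Definition is_eta U (ar as_ at_ h : form1) : Prop :=
  [/\ holomorphic_form U h,
      eta_equation U ar as_ at_ h,
      eta_equation U as_ at_ ar h
    & eta_equation U at_ ar as_ h].

(* Vanishing of the curvature d (\sum_(r < s < t) eta_rst) at all points
   outside the discriminant. *)
Definition flat_web (d : nat) (W : symform) : Prop :=
  forall U (a : 'I_d -> form1) (eta : 'I_d -> 'I_d -> 'I_d -> form1),
    local_foliations W U a ->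
    (forall r s t : 'I_d, (r < s < t)%N ->
       is_eta U (a r) (a s) (a t) (eta r s t)) ->
    forall z, U z ->
      ext_deriv (fun x =>
        \sum_(r < d) \sum_(s < d | (r < s)%N) \sum_(t < d | (s < t)%N)
          eta r s t x) z = 0.

(* The Legendre transform, in the coordinates (p, q) of the dual plane:
   multiplying A(x, p x - q) + p B(x, p x - q), where x = dq/dp and A, B are
   homogeneous of degree d, by dp^d gives the d-symmetric form
   A(dq, p dq - q dp) + p B(dq, p dq - q dp). *)
Definition Leg (w : pform K) : symform := fun z v =>
  let p := z 0 0 in let q := z 0 1 in let dp := v 0 0 in let dq := v 0 1 in
  let l := vec2 dq (p * dq - q * dp) in
  ev w.1 l + p * ev w.2 l.

End Webs.

(* Main.v *)
From HB Require Import structures.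
From mathcomp Require Import all_boot all_order all_algebra.
From mathcomp Require Import all_classical all_reals all_analysis.
From mathcomp Require Import complex ring cyclic separable cyclotomic.
From mathcomp Require Import -(notations) mpoly.
Require Import Defs.

(** Why the theorem holds.

    Let (p, q) be the coordinates of the dual plane. At a point with q nonzero, the leaves
    of the Legendre transform correspond to the d zeros (x : y) of the binary form
    A + p B, the zero (x, y) giving the form q x dp + (y - p x) dq. The zeros depend on p
    only; in a linear chart of the plane, with t = y / x, the zero t_i moves with the
    velocity w_i = - b (t_i) / (a' (t_i) + p b' (t_i)), where a and b dehomogenise A and B.
    For three zeros r < s < t let E_rst be the quadratic form that interpolates the three
    velocities. An explicit computation of the form eta_rst ([eta_identity]), with the fact
    that dg / g is closed ([young]), shows that d eta_rst has the coefficient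
    - D_p (E_rst (1, p)) / q ([local_curvature]). So the web is flat if and only if the
    value at (1, p) of the sum Q_p of all E_rst is locally constant in p
    ([curvature_in_chart]).

    The form Q_p is natural: it is given in homogeneous coordinates by Lagrange's formula
    ([total_form], [total_form_chart]), and a linear map h permuting the zeros and
    preserving A and B up to a common factor satisfies Q_p (v h) = det h Q_p (v)
    ([total_form_equivariant]). The Galois group consists of such maps. Its elements have
    finite order, and a group of this kind that preserves a nonzero quadratic form up to
    determinants is cyclic ([invariant_form_cyclic]). Hence Q_p = 0 for a noncyclic group,
    and the web is flat ([flat_noncyclic]).

    Suppose now that the group is cyclic. The foliation being Galois, deck transformations
    act transitively on the fibres of the Gauss map of the plane. Restricted to a rational
    curve that meets these fibres in d points, they become rational functions preserving
    the map a / b, and for degree reasons these are homographies ([deck_symmetry]). So the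
    cyclic group acts transitively on a generic fibre ([galois_generic_fibre]), a generator
    has order at least d, and in an eigenbasis of determinant 1 both A and B are
    combinations of x ^ d and y ^ d ([cyclic_fermat]). There A + p B = l0 x ^ d + l1 y ^ d
    with l0 and l1 affine in p, all velocities are kappa (p) t_i with kappa a constant
    multiple of 1 / (l0 l1), and E_rst = kappa x y. If (n0, n1) are the coordinates of
    (1, p) in the eigenbasis, flatness thus means that n0 n1 / (l0 l1) is constant
    ([fermat_flat], [fermat_flat_proportional]). By unique factorisation l0 and l1 are then
    proportional to n0 and n1 in one of the two orders, and these two cases are, after a
    rescaling of one coordinate, the two model foliations ([proportional_conjugate]).
    Conversely the models satisfy the condition ([conjugate_flat]). *)

Set Implicit Arguments.
Unset Strict Implicit.
Unset Printing Implicit Defensive.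

Import Order.TTheory GRing.Theory Num.Theory numFieldNormedType.Exports.

Local Open Scope classical_set_scope.
Local Open Scope ring_scope.

(** * First-order jets and quadratic interpolation *)

Section Jets.
Variable K : numClosedFieldType.
Implicit Types z : 'rV[K]_2.

(** Differentiability together with the values of both partial derivatives: the
    rules below then compute derivatives by unification. *)
Definition jet (f : 'rV[K]_2 -> K) z (d0 d1 : K) : Prop :=
  [/\ differentiable f z, 'D_('e_0) f z = d0 & 'D_('e_1) f z = d1].

Lemma jet_eq f z d0 d1 d0' d1' :
  jet f z d0' d1' -> d0' = d0 -> d1' = d1 -> jet f z d0 d1.
Proof. by move=> ? <- <-. Qed.

Lemma jet_diff (f : 'rV[K]_2 -> K) z : differentiable f z -> jet f z ('D_('e_0) f z) ('D_('e_1) f z).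
Proof. by []. Qed.

Lemma jet_cst c z : jet (fun=> c) z 0 0.
Proof. split; [exact: differentiable_cst | exact: derive_cst | exact: derive_cst]. Qed.

Lemma jet_coord i z : jet (fun t => t 0 i) z ((i == 0)%:R) ((i == 1)%:R).
Proof.
have H := differentiable_coord z 0 i.
have L v : 'D_v (fun t : 'rV[K]_2 => t 0 i : K) z = v 0 i.
  rewrite deriveE //.
  have @f : {linear 'rV[K]_2 -> K}.
    by exists (fun N : 'rV[K]_2 => N 0 i); do 2![eexists]; do ?[constructor];
       rewrite ?mxE// => ? *; rewrite ?mxE//; move=> ?; rewrite !mxE.
  by rewrite (_ : (fun t : 'rV[K]_2 => t 0 i) = f) // diff_lin //; exact: coord_continuous.
split=> //; by rewrite L mxE /=.
Qed.

Lemma jetD f g z f0 f1 g0 g1 : jet f z f0 f1 -> jet g z g0 g1 ->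
  jet (fun t => f t + g t) z (f0 + g0) (f1 + g1).
Proof.
move=> [df <- <-] [dg <- <-]; split.
- exact: differentiableD.
- by rewrite -deriveD //; exact: diff_derivable.
- by rewrite -deriveD //; exact: diff_derivable.
Qed.

Lemma jetN f z f0 f1 : jet f z f0 f1 -> jet (fun t => - f t) z (- f0) (- f1).
Proof.
move=> [df <- <-]; split.
- exact: differentiableN.
- by rewrite -deriveN //; exact: diff_derivable.
- by rewrite -deriveN //; exact: diff_derivable.
Qed.

Lemma jetB f g z f0 f1 g0 g1 : jet f z f0 f1 -> jet g z g0 g1 ->
  jet (fun t => f t - g t) z (f0 - g0) (f1 - g1).
Proof. by move=> jf /jetN; exact: jetD. Qed.

Lemma jetM f g z f0 f1 g0 g1 : jet f z f0 f1 -> jet g z g0 g1 ->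
  jet (fun t => f t * g t) z (f0 * g z + f z * g0) (f1 * g z + f z * g1).
Proof.
move=> [df <- <-] [dg <- <-]; split.
- exact: differentiableM.
- rewrite (@deriveM _ _ f g); try exact: diff_derivable.
  by rewrite addrC /GRing.scale /= [_ * g z]mulrC.
- rewrite (@deriveM _ _ f g); try exact: diff_derivable.
  by rewrite addrC /GRing.scale /= [_ * g z]mulrC.
Qed.

Lemma jetV f z f0 f1 : jet f z f0 f1 -> f z != 0 ->
  jet (fun t => (f t)^-1) z (- f0 / f z ^+ 2) (- f1 / f z ^+ 2).
Proof.
move=> [df <- <-] nz; split.
- exact: differentiableV.
- rewrite (@deriveV _ _ f) //; last exact: diff_derivable.
  by rewrite /GRing.scale /= mulNr mulrC mulNr -exprVn.
- rewrite (@deriveV _ _ f) //; last exact: diff_derivable.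
  by rewrite /GRing.scale /= mulNr mulrC mulNr -exprVn.
Qed.

Lemma jet_horner (P : {poly K}) f z f0 f1 : jet f z f0 f1 ->
  jet (fun t => P.[f t]) z (P^`().[f z] * f0) (P^`().[f z] * f1).
Proof.
move=> jf; elim/poly_ind: P => [|P c IH].
  have -> : (fun t => (0 : {poly K}).[f t]) = fun=> 0.
    by apply/funext => t; rewrite horner0.
  by apply: jet_eq (jet_cst 0 z) _ _; rewrite deriv0 horner0 mul0r.
have -> : (fun t => (P * 'X + c%:P).[f t]) = (fun t => P.[f t] * f t + c).
  by apply/funext => t; rewrite hornerMXaddC.
apply: jet_eq (jetD (jetM IH jf) (jet_cst c z)) _ _;
 rewrite derivMXaddC hornerD hornerM hornerX addr0; ring.
Qed.

Lemma derive_eq_on_open (f g : 'rV[K]_2 -> K) z v (U : set 'rV[K]_2) : open U -> U z ->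
  (forall t, U t -> f t = g t) -> 'D_v f z = 'D_v g z.
Proof.
move=> oU Uz fg; apply: near_eq_derive; near=> t; apply: fg; near: t.
exact: open_nbhs_nbhs.
Unshelve. all: by end_near. Qed.

Lemma row_norm_le (v : 'rV[K]_2) (c : K) : 0 <= c ->
  `|v 0 0| <= c -> `|v 0 1| <= c -> `|v| <= c.
Proof.
move=> c0 h0 h1; suff: mx_norm v <= c by [].
have [H|/mx_norm_neq0 [[i j] /= H]] := eqVneq (mx_norm v) 0; rewrite H //.
rewrite ord1; clear H; case: j => [[|[|//]] p] /=.
- by rewrite (_ : Ordinal p = 0) //; exact/val_inj.
- by rewrite (_ : Ordinal p = 1) //; exact/val_inj.
Qed.

(** Lagrange interpolation in homogeneous form: [interp t1 t2 t3 w1 w2 w3 1 y] is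
    the polynomial of degree at most 2 in y with value wi at ti, and [interp0],
    [interp1], [interp2] are its coefficients. *)
Definition interp0 (t1 t2 t3 w1 w2 w3 : K) :=
  w1 * (t2 * t3) / ((t1 - t2) * (t1 - t3)) + w2 * (t3 * t1) / ((t2 - t3) * (t2 - t1))
  + w3 * (t1 * t2) / ((t3 - t1) * (t3 - t2)).
Definition interp1 (t1 t2 t3 w1 w2 w3 : K) :=
  - (w1 * (t2 + t3) / ((t1 - t2) * (t1 - t3)) + w2 * (t3 + t1) / ((t2 - t3) * (t2 - t1))
  + w3 * (t1 + t2) / ((t3 - t1) * (t3 - t2))).
Definition interp2 (t1 t2 t3 w1 w2 w3 : K) :=
  w1 / ((t1 - t2) * (t1 - t3)) + w2 / ((t2 - t3) * (t2 - t1))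
  + w3 / ((t3 - t1) * (t3 - t2)).

Definition interp (t1 t2 t3 w1 w2 w3 x y : K) :=
  interp0 t1 t2 t3 w1 w2 w3 * x ^+ 2 + interp1 t1 t2 t3 w1 w2 w3 * x * y
  + interp2 t1 t2 t3 w1 w2 w3 * y ^+ 2.

Lemma interp_node (t1 t2 t3 w1 w2 w3 : K) : t1 != t2 -> t1 != t3 -> t2 != t3 ->
  interp t1 t2 t3 w1 w2 w3 1 t1 = w1.
Proof.
move=> h12 h13 h23; rewrite /interp /interp0 /interp1 /interp2; field.
by rewrite !subr_eq0 ![t3 == _]eq_sym ![t2 == t1]eq_sym h12 h13 h23.
Qed.

Lemma interp0_cycle (t1 t2 t3 w1 w2 w3 : K) :
  interp0 t2 t3 t1 w2 w3 w1 = interp0 t1 t2 t3 w1 w2 w3.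
Proof. by rewrite /interp0 addrC addrA. Qed.
Lemma interp1_cycle (t1 t2 t3 w1 w2 w3 : K) :
  interp1 t2 t3 t1 w2 w3 w1 = interp1 t1 t2 t3 w1 w2 w3.
Proof. by rewrite /interp1; congr (- _); rewrite addrC addrA. Qed.
Lemma interp2_cycle (t1 t2 t3 w1 w2 w3 : K) :
  interp2 t2 t3 t1 w2 w3 w1 = interp2 t1 t2 t3 w1 w2 w3.
Proof. by rewrite /interp2 addrC addrA. Qed.
Lemma interp_cycle (t1 t2 t3 w1 w2 w3 x y : K) :
  interp t2 t3 t1 w2 w3 w1 x y = interp t1 t2 t3 w1 w2 w3 x y.
Proof. by rewrite /interp interp0_cycle interp1_cycle interp2_cycle. Qed.

End Jets.

(** * Equality of mixed complex derivatives *)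

Section Young.
Variable R : realType.
Local Notation C := (Cplx R).

Definition ofR (x : R) : C := x%:C%C.
Local Notation "x %:K" := (ofR x) (at level 1, left associativity, format "x %:K").

Lemma ofR_lt (x y : R) : (x%:K < y%:K) = (x < y). Proof. exact: ltcR. Qed.
Lemma ofR_le (x y : R) : (x%:K <= y%:K) = (x <= y). Proof. exact: lecR. Qed.
Lemma ofR0 : ofR 0 = 0. Proof. by []. Qed.
Lemma ofRD (x y : R) : (x + y)%:K = x%:K + y%:K. Proof. exact: rmorphD. Qed.
Lemma ofRM (x y : R) : (x * y)%:K = x%:K * y%:K. Proof. exact: rmorphM. Qed.
Lemma ofR_sq (x : R) : x%:K ^+ 2 = (x ^+ 2)%:K.
Proof. by rewrite !expr2 ofRM. Qed.
Lemma ofR_norm (x : R) : `|x%:K| = `|x|%:K.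
Proof. by rewrite normc_def /= expr0n addr0 sqrtr_sqr. Qed.
Lemma ofR_Re (x : C) : 0 < x -> (complex.Re x)%:K = x.
Proof. by move=> x0; apply: RRe_real; rewrite gtr0_real. Qed.
Lemma le_Re (x : C) : `|complex.Re x|%:K <= `|x|. Proof. exact: normc_ge_Re. Qed.

Lemma derive_Re (f : C -> C) (x : R) (l : C) :
  is_derive x%:K 1 f l ->
  is_derive x 1 (fun s : R => complex.Re (f s%:K)) (complex.Re l).
Proof.
move=> [df fl].
have H : h^-1 *: (f (h *: 1 + x%:K) - f x%:K) @[h --> 0^'] --> (l : C).
  by rewrite -fl.
have H2 : h^-1 *: (complex.Re (f ((h *: (1:R) + x)%:K)) - complex.Re (f x%:K))
            @[h --> (0 : R)^'] --> complex.Re l.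
  apply/cvgrPdist_lt => e e0.
  have e0' : (0 : C) < e%:K by rewrite ofR_lt.
  move/cvgrPdist_lt in H.
  have {}e0' := H _ e0'.
  have toC : h%:K @[h --> (0 : R)^'] --> (0 : C)^'.
    move=> P /= [r r0 rP].
    have rR : r = (complex.Re r)%:K by rewrite ofR_Re.
    exists (complex.Re r) => /=; first by rewrite -ofR_lt -rR.
    move=> h /= hr h0; apply: rP => /=; last first.
      by apply: contra h0 => /eqP [->].
    rewrite rR /ball_ /= sub0r normrN ofR_norm ofR_lt.
    by move: hr; rewrite sub0r normrN.
  near=> h; have : `|l - h%:K^-1 *: (f (h%:K *: 1 + x%:K) - f x%:K)| < e%:K.
    near: h; exact: toC e0'.
  rewrite -ofR_lt; apply: le_lt_trans.
  have -> : h%:K *: 1 + x%:K = ((h *: (1:R) + x)%:K).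
    by rewrite /GRing.scale /= !mulr1 ofRD.
  set k := h%:K^-1; set F1 := f _; set F2 := f x%:K.
  apply: le_trans (le_Re _); rewrite ofR_le.
  have -> : k = (h^-1)%:K by rewrite /k /ofR fmorphV.
  case: F1 F2 (l) => [a1 b1] [a2 b2] [l1 l2] /=.
  by rewrite mul0r subr0.
split; first by apply/cvg_ex; exists (complex.Re l).
exact: cvg_lim H2.
Unshelve. all: by end_near. Qed.

Lemma mvt_Re (f df : C -> C) (h e : R) : 0 < h ->
  (forall s : R, 0 <= s <= h -> is_derive s%:K 1 f (df s%:K)) ->
  (forall s : R, 0 <= s <= h -> `|df s%:K| <= e%:K) ->
  `|complex.Re (f h%:K) - complex.Re (f 0)| <= e * h.
Proof.
move=> h0 fd fe.
pose g (s : R) := complex.Re (f s%:K).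
have gd (s : R) : 0 <= s <= h -> is_derive s 1 g (complex.Re (df s%:K)).
  by move=> sh; apply: derive_Re; exact: fd.
have [||c] := @MVT R g (fun s => complex.Re (df s%:K)) 0 h h0.
- by move=> s /[!in_itv] /= /andP[s0 sh]; apply: gd; rewrite !ltW.
- apply: derivable_within_continuous => s /[!in_itv] /= sh.
  by have [] := gd s sh.
- rewrite in_itv /= subr0 => /andP[c0 ch] ->.
  rewrite normrM (gtr0_norm h0); apply: ler_wpM2r; first exact: ltW.
  by rewrite -ofR_le; apply: le_trans (le_Re _) (fe _ _); rewrite !ltW.
Qed.

(** The real mean value theorem bounds the real parts of w and of - i w, where w is
    the quantity to estimate; adding the two bounds gives the factor 2. *)
Lemma mean_value_inequality (f df : C -> C) (h e : R) (k : C) : 0 < h ->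
  (forall s : R, 0 <= s <= h -> is_derive s%:K 1 f (df s%:K)) ->
  (forall s : R, 0 <= s <= h -> `|df s%:K - k| <= e%:K) ->
  `|f h%:K - f 0 - k * h%:K| <= (e * h *+ 2)%:K.
Proof.
move=> h0 fd fe.
pose g (u : C) (s : C) := u * (f s - k * s).
have gd (u : C) (s : R) : 0 <= s <= h ->
    is_derive s%:K 1 (g u) (u * (df s%:K - k)).
  move=> /fd H.
  have H2 : is_derive s%:K (1 : C) ((u *: (f - (k *: id))) : C -> C) (u *: (df s%:K - k *: 1)).
    exact: is_deriveZ.
  by move: H2; rewrite /GRing.scale /= mulr1.
have ge (u : C) : `|u| = 1 -> `|complex.Re (g u h%:K) - complex.Re (g u 0)| <= e * h.
  move=> u1; apply: (@mvt_Re (g u) (fun s => u * (df s - k))) => // s sh.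
  by rewrite normrM u1 mul1r; exact: fe.
set w := _ - _ - _.
have wE u : u * w = g u h%:K - g u 0.
  by rewrite /w /g mulr0 subr0 !mulrBr; ring.
have w1 := ge 1 (normr1 _).
have w2 : `|complex.Re (g (- 'i%C) h%:K) - complex.Re (g (- 'i%C) 0)| <= e * h.
  by apply: ge; rewrite normrN normc_def /= expr0n expr1n add0r sqrtr1.
have R1 : `|complex.Re w| <= e * h.
  by move: w1; rewrite -raddfB -wE mul1r.
have R2 : `|complex.Im w| <= e * h.
  by move: w2; rewrite -raddfB -wE mulNr raddfN /= normrN mulrC ReiNIm normrN.
rewrite [w]complexE; apply: le_trans (ler_normD _ _) _.
rewrite normrM normc_def [`|'i%C|]normc_def normc_def /= expr0n /= expr1n !addr0 add0r sqrtr1.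
rewrite !sqrtr_sqr mul1r mulr2n ofRD.
by apply: lerD; rewrite ofR_le.
Qed.

Lemma derive_line (g : 'rV[C]_2 -> C) (z v : 'rV[C]_2) (s : C) :
  differentiable g (z + s *: v) ->
  is_derive s 1 (fun t : C => g (z + t *: v)) ('D_v g (z + s *: v)).
Proof.
have E : (fun h : C => h^-1 *: ((fun t : C => g (z + t *: v)) (h *: 1 + s) - g (z + s *: v)))
    = (fun h : C => h^-1 *: (g (h *: v + (z + s *: v)) - g (z + s *: v))).
  by apply/funext => h; rewrite [h *: 1]mulr1 scalerDl addrCA.
move=> dg; apply: DeriveDef; last by rewrite /derive /= E.
by have := @diff_derivable _ _ _ g _ v dg; rewrite /derivable /= E.
Qed.

Lemma diff_expansion (g : 'rV[C]_2 -> C) (z : 'rV[C]_2) (e : C) : 0 < e ->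
  differentiable g z ->
  \forall v \near (0 : 'rV[C]_2),
    `|g (v + z) - g z - (v 0 0 * 'D_('e_0) g z + v 0 1 * 'D_('e_1) g z)| <= e * `|v|.
Proof.
move=> e0 dg; have H := diff_locally dg.
near=> v.
have -> : v 0 0 * 'D_('e_0) g z + v 0 1 * 'D_('e_1) g z = 'd g z v.
  rewrite [in RHS](row_sum_delta v) !big_ord_recl big_ord0 addr0 linearD !linearZ /=.
  rewrite !deriveE //; congr (_ * _ + v 0 _ * 'd g z (delta_mx 0 _)); exact/val_inj.
have -> : g (v + z) = g z + 'd g z v + ([o_ (0 : 'rV[C]_2) id of (g \o shift z) - (cst (g z) + 'd g z)]
  : _ -> _) v.
  by have := congr1 (@^~ v) H.
have cancel (a b c : C) : a + b + c - a - b = c by ring.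
rewrite cancel.
by near: v; apply: littleoP.
Unshelve. all: by end_near. Qed.

(** The second difference of g over a square with sides in the directions u and w is
    the increment, along u, of the difference of two values of g; its derivative is
    close to r b by hypothesis. *)
Lemma mixed_difference (g : 'rV[C]_2 -> C) (z u w : 'rV[C]_2) (r e : R) (b : C) :
  0 < r ->
  (forall s : R, 0 <= s <= r ->
     [/\ differentiable g (z + r%:K *: w + s%:K *: u),
         differentiable g (z + s%:K *: u)
       & `|'D_u g (z + r%:K *: w + s%:K *: u) - 'D_u g (z + s%:K *: u)
           - r%:K * b| <= (e * r)%:K]) ->
  `|g (z + r%:K *: w + r%:K *: u) - g (z + r%:K *: u) - g (z + r%:K *: w) + g z
     - r%:K ^+ 2 * b| <= (e * r ^+ 2 *+ 2)%:K.
Proof.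
move=> r0 H.
pose f (s : C) := g (z + r%:K *: w + s *: u) - g (z + s *: u).
pose df (s : C) := 'D_u g (z + r%:K *: w + s *: u) - 'D_u g (z + s *: u).
have fd (s : R) : 0 <= s <= r -> is_derive s%:K 1 f (df s%:K).
  move=> /H[d1 d2 _].
  have D1 := derive_line d1; have D2 := derive_line d2.
  exact: (@is_deriveB _ _ _ _ _ _ _ _ _ D1 D2).
have fe (s : R) : 0 <= s <= r -> `|df s%:K - r%:K * b| <= (e * r)%:K.
  by case/H.
have := mean_value_inequality r0 fd fe.
rewrite /f !scale0r !addr0.
set x1 := g _; set x2 := g _; set x3 := g _; set x4 := g _ => h.
rewrite (_ : x1 - x2 - x3 + x4 - r%:K ^+ 2 * b = x1 - x2 - (x3 - x4) - r%:K * b * r%:K); last by ring.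
by rewrite expr2 mulrA.
Qed.

Lemma square_bound (G1 G2 G3 G4 b c : C) (r e : R) : 0 < r ->
  `|G1 - G2 - G3 + G4 - r%:K ^+ 2 * b| <= ((e + e) * r ^+ 2 *+ 2)%:K ->
  `|G1 - G3 - G2 + G4 - r%:K ^+ 2 * c| <= ((e + e) * r ^+ 2 *+ 2)%:K ->
  `|b - c| <= (8%:R * e)%:K.
Proof.
move=> r0; have := ofR_sq r; have : 0 < r%:K ^+ 2 by rewrite exprn_gt0 // -ofR0 ofR_lt.
move: (r%:K ^+ 2) => rr r2 rrE Hb Hc.
rewrite -(ler_pM2l r2) -[X in X * `| _ |](gtr0_norm r2) -normrM.
have -> : rr * (b - c) = (G1 - G3 - G2 + G4 - rr * c) - (G1 - G2 - G3 + G4 - rr * b) by ring.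
apply: le_trans (ler_normB _ _) _.
apply: le_trans (lerD Hc Hb) _.
rewrite rrE -ofRD -!ofRM ofR_le.
by rewrite le_eqVlt; apply/orP; left; apply/eqP; ring.
Qed.

(** Both mixed derivatives approximate the same second difference of g over a small
    square, computed in the two possible orders. The first derivatives are only
    assumed differentiable at z, so the estimates use their first-order expansions
    at z rather than the continuity of second derivatives. *)
Lemma young (U : set 'rV[C]_2) (g g0 g1 : 'rV[C]_2 -> C) (z : 'rV[C]_2) :
  open U -> U z -> (forall t, U t -> jet g t (g0 t) (g1 t)) ->
  differentiable g0 z -> differentiable g1 z ->
  'D_('e_1) g0 z = 'D_('e_0) g1 z.
Proof.
move=> oU Uz jg d0 d1; apply/eqP; rewrite -subr_eq0 -normr_eq0.
apply/eqP/le_anti; rewrite normr_ge0 andbT.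
apply/ler_addgt0Pl => e' e'0; rewrite addr0.
set b := 'D_('e_1) g0 z; set c := 'D_('e_0) g1 z.
(* 8 is the constant produced by [square_bound]. *)
have [e e0 ->] : exists2 e : R, 0 < e & e' = (8%:R * e)%:K.
  exists (complex.Re e' / 8%:R); last first.
    by rewrite mulrC divfK ?pnatr_eq0 // ofR_Re.
  by rewrite divr_gt0 ?ltr0n // -ofR_lt ofR_Re.
have e0' : (0 : C) < e%:K by rewrite ofR_lt.
pose good (v : 'rV[C]_2) := [/\ U (v + z),
   `|g0 (v + z) - g0 z - (v 0 0 * 'D_('e_0) g0 z + v 0 1 * b)| <= e%:K * `|v|
   & `|g1 (v + z) - g1 z - (v 0 0 * c + v 0 1 * 'D_('e_1) g1 z)| <= e%:K * `|v|].
have [r r0 rP] : exists2 r : R, 0 < r & forall v : 'rV[C]_2, `|v| <= r%:K -> good v.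
  have N0 := diff_expansion e0' d0; have N1 := diff_expansion e0' d1.
  have NU : \forall v \near (0 : 'rV[C]_2), U (v + z).
    have : nbhs z U by exact: open_nbhs_nbhs.
    by move/nbhs0P; apply: filterS => v; rewrite addrC.
  have N : \forall v \near (0 : 'rV[C]_2), good v.
    apply: filterS (filterI NU (filterI N0 N1)) => v [A1 [A2 A3]].
    split; [exact: A1 | exact: A2 | exact: A3].
  move/nbhs_norm0P: N => [r /= r0 rN].
  have rR : r = (complex.Re r)%:K by rewrite ofR_Re.
  have r0' : 0 < complex.Re r by rewrite -ofR_lt -rR.
  exists (complex.Re r / 2%:R); first by rewrite divr_gt0.
  move=> v vr; apply: rN => /=; apply: le_lt_trans vr _.
  by rewrite rR ofR_lt /= ltr_pdivrMr // ltr_pMr // ltr1n.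
have rC : (0 : C) <= r%:K by rewrite -[0]/(ofR 0) ofR_le ltW.
have sC (s : R) : 0 <= s <= r -> `|s%:K| <= r%:K.
  by move=> /andP[s0 sr]; rewrite ofR_norm ofR_le ger0_norm.
have c0 (s t : R) : (t%:K *: 'e_1 + s%:K *: 'e_0 : 'rV[C]_2) 0 0 = s%:K.
  by rewrite !mxE /= mulr0 mulr1 add0r.
have c1 (s t : R) : (t%:K *: 'e_1 + s%:K *: 'e_0 : 'rV[C]_2) 0 1 = t%:K.
  by rewrite !mxE /= mulr0 mulr1 addr0.
have scale_le (v : 'rV[C]_2) (x : C) : `|v| <= r%:K -> x <= e%:K * `|v| -> x <= (e * r)%:K.
  by move=> vr h; apply: le_trans h _; rewrite ofRM ler_wpM2l // ltW.
have near_good (w : 'rV[C]_2) (s t : R) : 0 <= s <= r -> 0 <= t <= r ->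
   w = t%:K *: 'e_1 + s%:K *: 'e_0 + z ->
   [/\ U w, `|g0 w - (g0 z + s%:K * 'D_('e_0) g0 z + t%:K * b)| <= (e * r)%:K
     & `|g1 w - (g1 z + s%:K * c + t%:K * 'D_('e_1) g1 z)| <= (e * r)%:K].
  move=> sr tr ->.
  have := c0 s t; have := c1 s t.
  move: (t%:K *: 'e_1 + s%:K *: 'e_0 : 'rV[C]_2) => v vt vs.
  have L : `|v| <= r%:K by apply: row_norm_le; rewrite ?vt ?vs; [exact: rC | exact: sC | exact: sC].
  case: (rP v L); rewrite vt vs => U1 /(scale_le _ _ L) H0 /(scale_le _ _ L) H1.
  split; first exact: U1.
    by rewrite -addrA opprD addrA; exact: H0.
  by rewrite -addrA opprD addrA; exact: H1.
have rr : 0 <= r <= r by rewrite lexx ltW.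
have zr : (0 : R) <= 0 <= r by rewrite lexx ltW.
have E : (e + e) * r ^+ 2 *+ 2 = (4%:R * e) * r ^+ 2 by rewrite -mulr_natr; ring.
have diff_le (x y m m' k : C) : `|x - m| <= (e * r)%:K -> `|y - m'| <= (e * r)%:K ->
    m - m' = k -> `|x - y - k| <= ((e + e) * r)%:K.
  move=> h1 h2 <-; rewrite mulrDl ofRD.
  have -> : x - y - (m - m') = x - m - (y - m') by ring.
  by apply: le_trans (ler_normB _ _) _; apply: lerD.
have cancel1 (x y v : C) : x + y - (x + ofR 0 * v) = y.
  by rewrite ofR0 mul0r addr0 addrC addKr.
have cancel2 (x y u v : C) : x + y + v - (x + ofR 0 * u + v) = y.
  by rewrite ofR0 mul0r addr0; ring.
have rot3 (x y v : 'rV[C]_2) : x + y + v = y + v + x by rewrite -addrA addrC.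
have rev3 (x y v : 'rV[C]_2) : x + y + v = v + y + x by rewrite -addrA addrC [y + v]addrC.
have drop0 (x y v : 'rV[C]_2) : x + y = (ofR 0) *: v + y + x.
  by rewrite ofR0 scale0r add0r addrC.
have drop0' (x y v : 'rV[C]_2) : x + y = y + (ofR 0) *: v + x.
  by rewrite ofR0 scale0r addr0 addrC.
have Hb : `|g (z + r%:K *: 'e_1 + r%:K *: 'e_0) - g (z + r%:K *: 'e_0)
    - g (z + r%:K *: 'e_1) + g z - r%:K ^+ 2 * b| <= ((e + e) * r ^+ 2 *+ 2)%:K.
  apply: mixed_difference; first exact: r0.
  move=> s sr.
  have Z1 : z + r%:K *: 'e_1 + s%:K *: 'e_0 = r%:K *: 'e_1 + s%:K *: 'e_0 + z.
    exact: rot3.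
  have Z2 : z + s%:K *: 'e_0 = (ofR 0) *: 'e_1 + s%:K *: 'e_0 + z.
    exact: drop0.
  have [U1 h1 _] := near_good _ s r sr rr Z1.
  have [U2 h2 _] := near_good _ s 0 sr zr Z2.
  have [D1 E1 _] := jg _ U1; have [D2 E2 _] := jg _ U2.
  split; [exact: D1 | exact: D2 | rewrite E1 E2].
  apply: (diff_le _ _ _ _ _ h1 h2).
  exact: cancel1.
have Hc : `|g (z + r%:K *: 'e_0 + r%:K *: 'e_1) - g (z + r%:K *: 'e_1)
    - g (z + r%:K *: 'e_0) + g z - r%:K ^+ 2 * c| <= ((e + e) * r ^+ 2 *+ 2)%:K.
  apply: mixed_difference; first exact: r0.
  move=> s sr.
  have Z1 : z + r%:K *: 'e_0 + s%:K *: 'e_1 = s%:K *: 'e_1 + r%:K *: 'e_0 + z.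
    exact: rev3.
  have Z2 : z + s%:K *: 'e_1 = s%:K *: 'e_1 + (ofR 0) *: 'e_0 + z.
    exact: drop0'.
  have [U1 _ h1] := near_good _ r s rr sr Z1.
  have [U2 _ h2] := near_good _ 0 s zr sr Z2.
  have [D1 _ E1] := jg _ U1; have [D2 _ E2] := jg _ U2.
  split; [exact: D1 | exact: D2 | rewrite E1 E2].
  apply: (diff_le _ _ _ _ _ h1 h2).
  exact: cancel2.
have E3 : z + r%:K *: 'e_0 + r%:K *: 'e_1 = z + r%:K *: 'e_1 + r%:K *: 'e_0.
  exact: addrAC.
rewrite E3 in Hc.
exact: (square_bound r0 Hb Hc).
Qed.

End Young.

(** * The curvature contributed by three roots, in a chart *)

(** The one fact about complex derivatives that depends on the concrete field:
    everything else is carried out over an abstract closed field with this property,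
    which [young] establishes for the complex numbers. *)
Definition symmetric_derivatives (K : numClosedFieldType) : Prop :=
  forall (U : set 'rV[K]_2) (g g0 g1 : 'rV[K]_2 -> K) (z : 'rV[K]_2),
    open U -> U z -> (forall t, U t -> jet g t (g0 t) (g1 t)) ->
    differentiable g0 z -> differentiable g1 z ->
    'D_('e_1) g0 z = 'D_('e_0) g1 z.

Section Vec2.
Variable K : numClosedFieldType.

Lemma vec20 (a b : K) : vec2 a b 0 0 = a. Proof. by rewrite mxE. Qed.
Lemma vec21 (a b : K) : vec2 a b 0 1 = b. Proof. by rewrite mxE. Qed.
Lemma vec2_eta (u : 'rV[K]_2) : u = vec2 (u 0 0) (u 0 1).
Proof.
by apply/rowP => -[[|[|//]] p]; rewrite mxE /=; congr (u 0 _); exact/val_inj.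
Qed.
Lemma row2P (u v : 'rV[K]_2) : u 0 0 = v 0 0 -> u 0 1 = v 0 1 -> u = v.
Proof. by move=> h0 h1; rewrite [u]vec2_eta [v]vec2_eta h0 h1. Qed.

Lemma differentiable_vec2 (f g : 'rV[K]_2 -> K) z :
  differentiable f z -> differentiable g z ->
  differentiable (fun t => vec2 (f t) (g t)) z.
Proof.
move=> df dg.
have -> : (fun t => vec2 (f t) (g t)) = (fun t => f t *: ('e_0 : 'rV[K]_2) + g t *: ('e_1 : 'rV[K]_2)).
  by apply/funext => t; apply: row2P; rewrite !mxE /= !(mulr1, mulr0, add0r, addr0).
by apply: differentiableD; apply: differentiableZl.
Qed.

Lemma differentiable_entry (h : 'rV[K]_2 -> 'rV[K]_2) z i :
  differentiable h z -> differentiable (fun t => h t 0 i) z.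
Proof.
move=> dh; apply: (@differentiable_comp _ _ _ _ h (fun t : 'rV[K]_2 => t 0 i)) => //.
exact: differentiable_coord.
Qed.

End Vec2.

Section Basic.
Variable K : numClosedFieldType.
Implicit Types z : 'rV[K]_2.

(** The zeros of A + p B, and all that is built from them, depend on the coordinate
    p = z 0 0 only; this is the first-order trace of that fact at a point. *)
Definition basic (f : 'rV[K]_2 -> K) z := exists d, jet f z d 0.

Lemma basic_jet (f : 'rV[K]_2 -> K) z : basic f z -> jet f z ('D_('e_0) f z) 0.
Proof. by case=> d [df _ d1]. Qed.
Lemma basic_cst c z : basic (fun=> c) z.
Proof. by exists 0; exact: jet_cst. Qed.
Lemma basic_coord z : basic (fun t => t 0 0) z.
Proof. by exists 1; exact: (jet_coord 0 z). Qed.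
Lemma basicD (f g : 'rV[K]_2 -> K) z : basic f z -> basic g z -> basic (fun t => f t + g t) z.
Proof. by move=> [d jf] [e jg]; exists (d + e); apply: jet_eq (jetD jf jg) _ _; rewrite ?addr0. Qed.
Lemma basicN (f : 'rV[K]_2 -> K) z : basic f z -> basic (fun t => - f t) z.
Proof. by move=> [d jf]; exists (- d); apply: jet_eq (jetN jf) _ _; rewrite ?oppr0. Qed.
Lemma basicM (f g : 'rV[K]_2 -> K) z : basic f z -> basic g z -> basic (fun t => f t * g t) z.
Proof.
by move=> [d jf] [e jg]; eexists; apply: jet_eq (jetM jf jg) _ _; rewrite ?(mul0r, mulr0, addr0).
Qed.
Lemma basicX (f : 'rV[K]_2 -> K) n z : basic f z -> basic (fun t => f t ^+ n) z.
Proof.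
move=> bf; elim: n => [|n IH]; first exact: basic_cst.
have -> : (fun t => f t ^+ n.+1) = (fun t => f t * f t ^+ n) by apply/funext => t; rewrite exprS.
exact: basicM.
Qed.
Lemma basicV (f : 'rV[K]_2 -> K) z : basic f z -> f z != 0 -> basic (fun t => (f t)^-1) z.
Proof.
by move=> [d jf] nz; eexists; apply: jet_eq (jetV jf nz) _ _; rewrite ?(oppr0, mul0r).
Qed.
Lemma basic_horner (P : {poly K}) (f : 'rV[K]_2 -> K) z : basic f z -> basic (fun t => P.[f t]) z.
Proof. by move=> [d jf]; eexists; apply: jet_eq (jet_horner P jf) _ _; rewrite ?mulr0. Qed.

End Basic.

(** The equations of [is_eta] without differentiability: the explicit solution given
    below contains first derivatives of functions that are only known to be
    differentiable once. *)
Definition is_eta_at (K : numClosedFieldType) (U : set 'rV[K]_2) (a1 a2 a3 h : form1 K) :=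
  [/\ eta_equation U a1 a2 a3 h, eta_equation U a2 a3 a1 h & eta_equation U a3 a1 a2 h].

Section LocalAnalysis.
Variable K : numClosedFieldType.
Variables (U : set 'rV[K]_2) (k00 k01 k10 k11 : K).
Hypothesis oU : open U.
Hypothesis det1 : k00 * k11 - k10 * k01 = 1.
Hypothesis U_q : forall z, U z -> z 0 1 != 0.

Let n0 (z : 'rV[K]_2) := k00 + k01 * z 0 0.
Let n1 (z : 'rV[K]_2) := k10 + k11 * z 0 0.

(** The form q x dp + (y - p x) dq attached to a zero (x, y) of A + p B, written in
    linear coordinates of determinant 1 on the plane, where the zero is x (1, t) and
    the vector (1, p) is (k00 + k01 p, k10 + k11 p). *)
Definition model_form (x t : K) (z : 'rV[K]_2) : 'rV[K]_2 :=
  x *: vec2 (- (z 0 1 * (k01 * t - k11))) ((k00 + k01 * z 0 0) * t - (k10 + k11 * z 0 0)).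

(** The quadratic form interpolating the velocities wi of three roots ti, at the
    vector (1, p) of the plane. *)
Definition interp_line (t1 t2 t3 w1 w2 w3 : 'rV[K]_2 -> K) (z : 'rV[K]_2) :=
  interp (t1 z) (t2 z) (t3 z) (w1 z) (w2 z) (w3 z)
         (k00 + k01 * z 0 0) (k10 + k11 * z 0 0).

Definition theta_dp (t1 t2 t3 w1 w2 w3 : 'rV[K]_2 -> K) (z : 'rV[K]_2) :=
  let c0 := interp0 (t1 z) (t2 z) (t3 z) (w1 z) (w2 z) (w3 z) in
  let c1 := interp1 (t1 z) (t2 z) (t3 z) (w1 z) (w2 z) (w3 z) in
  let c2 := interp2 (t1 z) (t2 z) (t3 z) (w1 z) (w2 z) (w3 z) in
  2%:R * c1 + c2 * (t1 z + t2 z + t3 z + (k10 + k11 * z 0 0) * k11)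
  + k01 * (c0 * (k00 + k01 * z 0 0) + c1 * (k10 + k11 * z 0 0)).

(** The part of the form eta of three foliations that does not depend on the
    normalisation of their defining forms. *)
Definition theta (t1 t2 t3 w1 w2 w3 : 'rV[K]_2 -> K) (z : 'rV[K]_2) : 'rV[K]_2 :=
  vec2 (theta_dp t1 t2 t3 w1 w2 w3 z) ((3%:R - interp_line t1 t2 t3 w1 w2 w3 z) / z 0 1).

(** Everything is explicit in the first jets of the fi and ti. Writing each velocity
    as the value at ti of the interpolating quadratic polynomial turns the claim
    into a polynomial identity modulo [det1]. *)
Lemma eta_identity (a1 a2 a3 : form1 K) (f1 f2 f3 t1 t2 t3 w1 w2 w3 : 'rV[K]_2 -> K) z :
  U z ->
  (forall z, U z -> a1 z = model_form (f1 z) (t1 z) z) ->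
  (forall z, U z -> a2 z = model_form (f2 z) (t2 z) z) ->
  (forall z, U z -> a3 z = model_form (f3 z) (t3 z) z) ->
  differentiable f1 z -> differentiable f2 z -> differentiable f3 z ->
  f1 z != 0 -> f2 z != 0 -> f3 z != 0 ->
  jet t1 z (w1 z) 0 -> jet t2 z (w2 z) 0 -> jet t3 z (w3 z) 0 ->
  t1 z != t2 z -> t1 z != t3 z -> t2 z != t3 z ->
  let g := fun z => f1 z * f2 z * f3 z in
  ext_deriv (fun t => delta a2 a3 t *: a1 t) z =
  wedge (theta t1 t2 t3 w1 w2 w3 z + (g z)^-1 *: vec2 ('D_('e_0) g z) ('D_('e_1) g z))
        (delta a2 a3 z *: a1 z).
Proof.
move=> Uz A1 A2 A3 df1 df2 df3 nf1 nf2 nf3 jt1 jt2 jt3 n12 n13 n23 g.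
have jg : jet g z ('D_('e_0) g z) ('D_('e_1) g z).
  apply: jet_diff.
  by case: (jetM (jetM (jet_diff df1) (jet_diff df2)) (jet_diff df3)).
have dE t : U t -> delta a2 a3 t = f2 t * f3 t * t 0 1 * (t3 t - t2 t).
  move=> Ut; rewrite /delta /wedge A2 // A3 // !mxE /=.
  transitivity (f2 t * f3 t * t 0 1 * (t3 t - t2 t) * (k00 * k11 - k10 * k01)); first by ring.
  by rewrite det1 mulr1.
rewrite /ext_deriv.
have jq := jet_coord 1 z; have jp := jet_coord 0 z; rewrite /= in jq jp.
have jn0 := jetD (jet_cst k00 z) (jetM (jet_cst k01 z) jp).
have jn1 := jetD (jet_cst k10 z) (jetM (jet_cst k11 z) jp).
have jd := jetB jt3 jt2.
have j1 := jetM (jetM (jetM jg jq) jd) (jetB (jetM jn0 jt1) jn1).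
have j0 := jetM (jetM (jetM jg (jetM jq jq)) jd) (jetN (jetB (jetM (jet_cst k01 z) jt1) (jet_cst k11 z))).
have [_ D1 _] := j1; have [_ _ D0] := j0.
have H1 t : U t -> (delta a2 a3 t *: a1 t) 0 1 =
    g t * t 0 1 * (t3 t - t2 t) * ((k00 + k01 * t 0 0) * t1 t - (k10 + k11 * t 0 0)).
  by move=> Ut; rewrite dE // A1 // !mxE /= /g; ring.
have H0 t : U t -> (delta a2 a3 t *: a1 t) 0 0 =
    g t * (t 0 1 * t 0 1) * (t3 t - t2 t) * - (k01 * t1 t - k11).
  by move=> Ut; rewrite dE // A1 // !mxE /= /g; ring.
rewrite (derive_eq_on_open _ oU Uz H1) (derive_eq_on_open _ oU Uz H0) D0 D1.
rewrite /wedge H0 // H1 // !mxE /= /theta_dp /interp_line /interp.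
have gz : g z != 0 by rewrite /g !mulf_neq0.
have qz := U_q Uz.
have n21 : t2 z != t1 z by rewrite eq_sym; exact: n12.
have n31 : t3 z != t1 z by rewrite eq_sym; exact: n13.
have n32 : t3 z != t2 z by rewrite eq_sym; exact: n23.
have W1 := interp_node (w1 z) (w2 z) (w3 z) n12 n13 n23.
have W2 : interp (t1 z) (t2 z) (t3 z) (w1 z) (w2 z) (w3 z) 1 (t2 z) = w2 z.
  by rewrite -interp_cycle; exact: interp_node.
have W3 : interp (t1 z) (t2 z) (t3 z) (w1 z) (w2 z) (w3 z) 1 (t3 z) = w3 z.
  by rewrite -2!interp_cycle; exact: interp_node.
rewrite /interp in W1 W2 W3.
move: W1 W2 W3 gz qz.
move: (interp0 _ _ _ _ _ _) (interp1 _ _ _ _ _ _) (interp2 _ _ _ _ _ _) => c0 c1 c2.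
move: (w1 z) (w2 z) (w3 z) => W1 W2 W3 <- <- <-.
move: (g z) ('D_('e_0) g z) ('D_('e_1) g z) (t1 z) (t2 z) (t3 z) (z 0 0) (z 0 1).
move=> G G0 G1 T1 T2 T3 p q gz qz.
apply/eqP; rewrite -subr_eq0; apply/eqP.
transitivity (G * q * (T3 - T2) * (c0 * (k00 + k01 * p) + c1 * (k10 + k11 * p)
   + c2 * (k10 + k11 * p) * T1) * (1 - (k00 * k11 - k10 * k01))).
  by field; rewrite gz qz.
by rewrite det1 subrr mulr0.
Qed.

Variables (t1 t2 t3 w1 w2 w3 : 'rV[K]_2 -> K).
Hypothesis jt1 : forall z, U z -> jet t1 z (w1 z) 0.
Hypothesis jt2 : forall z, U z -> jet t2 z (w2 z) 0.
Hypothesis jt3 : forall z, U z -> jet t3 z (w3 z) 0.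
Hypothesis bw1 : forall z, U z -> basic w1 z.
Hypothesis bw2 : forall z, U z -> basic w2 z.
Hypothesis bw3 : forall z, U z -> basic w3 z.
Hypothesis n12 : forall z, U z -> t1 z != t2 z.
Hypothesis n13 : forall z, U z -> t1 z != t3 z.
Hypothesis n23 : forall z, U z -> t2 z != t3 z.

Let bt1 z : U z -> basic t1 z. Proof. by move=> /jt1; exists (w1 z). Qed.
Let bt2 z : U z -> basic t2 z. Proof. by move=> /jt2; exists (w2 z). Qed.
Let bt3 z : U z -> basic t3 z. Proof. by move=> /jt3; exists (w3 z). Qed.

Lemma basic_interp z : U z ->
  [/\ basic (fun z => interp0 (t1 z) (t2 z) (t3 z) (w1 z) (w2 z) (w3 z)) z,
      basic (fun z => interp1 (t1 z) (t2 z) (t3 z) (w1 z) (w2 z) (w3 z)) z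
    & basic (fun z => interp2 (t1 z) (t2 z) (t3 z) (w1 z) (w2 z) (w3 z)) z].
Proof.
move=> Uz; have [b1 b2 b3] := And3 (bt1 Uz) (bt2 Uz) (bt3 Uz).
have [v1 v2 v3] := And3 (bw1 Uz) (bw2 Uz) (bw3 Uz).
have d (f g : 'rV[K]_2 -> K) : basic f z -> basic g z -> basic (fun t => f t - g t) z.
  by move=> bf bg; apply: basicD bf (basicN bg).
have n (f g : 'rV[K]_2 -> K) : f z != g z -> f z - g z != 0 by rewrite subr_eq0.
have m12 := n12 Uz; have m13 := n13 Uz; have m23 := n23 Uz.
have m21 : t2 z != t1 z by rewrite eq_sym.
have m31 : t3 z != t1 z by rewrite eq_sym.
have m32 : t3 z != t2 z by rewrite eq_sym.
have i1 : basic (fun z => ((t1 z - t2 z) * (t1 z - t3 z))^-1) z.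
  by apply: basicV; [apply: basicM; exact: d | rewrite mulf_neq0 ?n].
have i2 : basic (fun z => ((t2 z - t3 z) * (t2 z - t1 z))^-1) z.
  by apply: basicV; [apply: basicM; exact: d | rewrite mulf_neq0 ?n].
have i3 : basic (fun z => ((t3 z - t1 z) * (t3 z - t2 z))^-1) z.
  by apply: basicV; [apply: basicM; exact: d | rewrite mulf_neq0 ?n].
split.
- by do 2?apply: basicD; apply: basicM => //; apply: basicM => //; apply: basicM.
- by apply: basicN; do 2?apply: basicD; apply: basicM => //; apply: basicM => //; apply: basicD.
- by do 2?apply: basicD; apply: basicM.
Qed.

Let bn0 z : basic (fun z => k00 + k01 * z 0 0) z.
Proof. by apply: basicD (basic_cst _ _) _; apply: basicM (basic_cst _ _) (basic_coord _). Qed.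
Let bn1 z : basic (fun z => k10 + k11 * z 0 0) z.
Proof. by apply: basicD (basic_cst _ _) _; apply: basicM (basic_cst _ _) (basic_coord _). Qed.

Lemma basic_interp_line z : U z -> basic (interp_line t1 t2 t3 w1 w2 w3) z.
Proof.
move=> Uz; have [b0 b1 b2] := basic_interp Uz.
apply: basicD; first apply: basicD.
- by apply: basicM b0 (basicX _ _).
- by apply: basicM (bn1 z); apply: basicM b1 (bn0 z).
- by apply: basicM b2 (basicX _ _).
Qed.

Lemma basic_theta_dp z : U z -> basic (theta_dp t1 t2 t3 w1 w2 w3) z.
Proof.
move=> Uz; have [b0 b1 b2] := basic_interp Uz.
have [e1 e2 e3] := And3 (bt1 Uz) (bt2 Uz) (bt3 Uz).
apply: basicD; first apply: basicD.
- by apply: basicM (basic_cst _ _) b1.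
- apply: basicM b2 _; apply: basicD; last exact: basicM (bn1 z) (basic_cst _ _).
  by apply: basicD e3; apply: basicD.
- apply: basicM (basic_cst _ _) _; apply: basicD; first exact: basicM b0 (bn0 z).
  exact: basicM b1 (bn1 z).
Qed.

Let J z : U z -> jet (fun z => theta t1 t2 t3 w1 w2 w3 z 0 1) z
  (- 'D_('e_0) (interp_line t1 t2 t3 w1 w2 w3) z / z 0 1)
  (- (3%:R - interp_line t1 t2 t3 w1 w2 w3 z) / z 0 1 ^+ 2).
Proof.
move=> Uz; have jE := basic_jet (basic_interp_line Uz).
have H := jetM (jetB (jet_cst 3%:R z) jE) (jetV (jet_coord 1 z) (U_q Uz)).
have -> : (fun z => theta t1 t2 t3 w1 w2 w3 z 0 1) = (fun t => (3%:R - interp_line t1 t2 t3 w1 w2 w3 t)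
  * (t 0 1)^-1).
  by apply/funext => t; rewrite vec21.
by apply: jet_eq H _ _; rewrite /=; ring.
Qed.

Lemma differentiable_theta z : U z -> differentiable (theta t1 t2 t3 w1 w2 w3) z.
Proof.
move=> Uz; apply: differentiable_vec2.
  by case: (basic_theta_dp Uz) => ? [].
have [H _ _] := J Uz.
rewrite (_ : (fun t => _) = (fun z => theta t1 t2 t3 w1 w2 w3 z 0 1)) //.
by apply/funext => t; rewrite vec21.
Qed.

(** The dp-component of theta is independent of q, so only the dq-component
    contributes. *)
Lemma ext_deriv_theta z : U z -> ext_deriv (theta t1 t2 t3 w1 w2 w3) z =
  - 'D_('e_0) (interp_line t1 t2 t3 w1 w2 w3) z / z 0 1.
Proof.
move=> Uz; rewrite /ext_deriv; have [_ -> _] := J Uz.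
have -> : (fun t => theta t1 t2 t3 w1 w2 w3 t 0 0) = theta_dp t1 t2 t3 w1 w2 w3.
  by apply/funext => t; rewrite vec20.
by have [_ _ ->] := basic_jet (basic_theta_dp Uz); rewrite subr0.
Qed.

Variables (a1 a2 a3 : form1 K) (f1 f2 f3 : 'rV[K]_2 -> K).
Hypothesis A1 : forall z, U z -> a1 z = model_form (f1 z) (t1 z) z.
Hypothesis A2 : forall z, U z -> a2 z = model_form (f2 z) (t2 z) z.
Hypothesis A3 : forall z, U z -> a3 z = model_form (f3 z) (t3 z) z.
Hypothesis df1 : forall z, U z -> differentiable f1 z.
Hypothesis df2 : forall z, U z -> differentiable f2 z.
Hypothesis df3 : forall z, U z -> differentiable f3 z.
Hypothesis nf1 : forall z, U z -> f1 z != 0.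
Hypothesis nf2 : forall z, U z -> f2 z != 0.
Hypothesis nf3 : forall z, U z -> f3 z != 0.

Let g z := f1 z * f2 z * f3 z.
Let dlog z := (g z)^-1 *: vec2 ('D_('e_0) g z) ('D_('e_1) g z).

Lemma theta_cycle (u1 u2 u3 v1 v2 v3 : 'rV[K]_2 -> K) z :
  theta u2 u3 u1 v2 v3 v1 z = theta u1 u2 u3 v1 v2 v3 z.
Proof.
rewrite /theta /theta_dp /interp_line interp_cycle interp0_cycle interp1_cycle interp2_cycle.
by rewrite [u2 z + u3 z + _]addrC [u1 z + (_ + _)]addrA.
Qed.

(** Both theta and g are invariant under cyclic permutation, so that [eta_identity]
    gives all three equations. *)
Lemma eta_theta : is_eta_at U a1 a2 a3 (fun z => theta t1 t2 t3 w1 w2 w3 z + dlog z).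
Proof.
have E (b1 b2 b3 : form1 K) (h1 h2 h3 u1 u2 u3 v1 v2 v3 : 'rV[K]_2 -> K) :
  (forall z, U z -> b1 z = model_form (h1 z) (u1 z) z) ->
  (forall z, U z -> b2 z = model_form (h2 z) (u2 z) z) ->
  (forall z, U z -> b3 z = model_form (h3 z) (u3 z) z) ->
  (forall z, U z -> differentiable h1 z) -> (forall z, U z -> differentiable h2 z) ->
  (forall z, U z -> differentiable h3 z) ->
  (forall z, U z -> h1 z != 0) -> (forall z, U z -> h2 z != 0) -> (forall z, U z -> h3 z != 0) ->
  (forall z, U z -> jet u1 z (v1 z) 0) -> (forall z, U z -> jet u2 z (v2 z) 0) ->
  (forall z, U z -> jet u3 z (v3 z) 0) ->
  (forall z, U z -> u1 z != u2 z) -> (forall z, U z -> u1 z != u3 z) ->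
  (forall z, U z -> u2 z != u3 z) ->
  (forall z, h1 z * h2 z * h3 z = g z) ->
  (forall z, theta u1 u2 u3 v1 v2 v3 z = theta t1 t2 t3 w1 w2 w3 z) ->
  eta_equation U b1 b2 b3 (fun z => theta t1 t2 t3 w1 w2 w3 z + dlog z).
  move=> B1 B2 B3 dh1 dh2 dh3 nh1 nh2 nh3 ju1 ju2 ju3 m12 m13 m23 gE thE z Uz.
  have := eta_identity Uz B1 B2 B3 (dh1 z Uz) (dh2 z Uz) (dh3 z Uz) (nh1 z Uz) (nh2 z Uz)
    (nh3 z Uz) (ju1 z Uz) (ju2 z Uz) (ju3 z Uz) (m12 z Uz) (m13 z Uz) (m23 z Uz).
  have -> : (fun z => h1 z * h2 z * h3 z) = g by apply/funext.
  by rewrite thE.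
have n21 z : U z -> t2 z != t1 z by move=> Uz; rewrite eq_sym n12.
have n31 z : U z -> t3 z != t1 z by move=> Uz; rewrite eq_sym n13.
have n32 z : U z -> t3 z != t2 z by move=> Uz; rewrite eq_sym n23.
split.
- exact: (E _ _ _ _ _ _ _ _ _ _ _ _ A1 A2 A3 df1 df2 df3 nf1 nf2 nf3 jt1 jt2 jt3 n12 n13 n23).
- apply: (E _ _ _ _ _ _ _ _ _ _ _ _ A2 A3 A1 df2 df3 df1 nf2 nf3 nf1 jt2 jt3 jt1 n23 n21 n31).
    by move=> z; rewrite /g mulrC mulrA.
  by move=> z; exact: theta_cycle.
- apply: (E _ _ _ _ _ _ _ _ _ _ _ _ A3 A1 A2 df3 df1 df2 nf3 nf1 nf2 jt3 jt1 jt2 n31 n32 n12).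
    by move=> z; rewrite /g -mulrA mulrC.
  by move=> z; rewrite -2!theta_cycle.
Qed.

Lemma wedge_model x t y s z : wedge (model_form x t z) (model_form y s z) = x * y * z 0 1 * (s - t).
Proof.
rewrite /wedge !mxE /=.
transitivity (x * y * z 0 1 * (s - t) * (k00 * k11 - k10 * k01)); first by ring.
by rewrite det1 mulr1.
Qed.

Lemma wedge_inj (u v b c : 'rV[K]_2) : wedge b c != 0 ->
  wedge u b = wedge v b -> wedge u c = wedge v c -> u = v.
Proof.
move=> nz hb hc; have D0 : wedge (u - v) b = 0 by move: hb => /eqP; rewrite -subr_eq0 => /eqP <-;
  rewrite /wedge !mxE; ring.
have D1 : wedge (u - v) c = 0 by move: hc => /eqP; rewrite -subr_eq0 => /eqP <-; rewrite /wedge !mxE; ring.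
apply/eqP; rewrite -subr_eq0; apply/eqP; move: (u - v) D0 D1 => x D0 D1.
apply: row2P; rewrite mxE; apply: (mulIf nz); rewrite mul0r.
- transitivity (wedge x c * b 0 0 - wedge x b * c 0 0); first by rewrite /wedge; ring.
  by rewrite D0 D1 !mul0r subrr.
- transitivity (wedge x c * b 0 1 - wedge x b * c 0 1); first by rewrite /wedge; ring.
  by rewrite D0 D1 !mul0r subrr.
Qed.

Lemma eta_unique (h h' : form1 K) :
  is_eta_at U a1 a2 a3 h -> is_eta_at U a1 a2 a3 h' -> forall z, U z -> h z = h' z.
Proof.
move=> [e1 e2 _] [e1' e2' _] z Uz.
have q0 := U_q Uz.
apply: (@wedge_inj _ _ (delta a2 a3 z *: a1 z) (delta a3 a1 z *: a2 z)).
- have -> : wedge (delta a2 a3 z *: a1 z) (delta a3 a1 z *: a2 z) =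
     wedge (a2 z) (a3 z) * wedge (a3 z) (a1 z) * wedge (a1 z) (a2 z).
    by rewrite /delta /wedge !mxE; ring.
  have [m1 m2 m3] := And3 (nf1 Uz) (nf2 Uz) (nf3 Uz).
  have m12 := n12 Uz; have m13 := n13 Uz; have m23 := n23 Uz.
  rewrite A1 // A2 // A3 // !wedge_model.
  rewrite ?mulf_neq0 // subr_eq0 //; by rewrite eq_sym.
- by rewrite -e1 // -e1'.
- by rewrite -e2 // -e2'.
Qed.

(** The form h differs from theta by dg / g, where g = f1 f2 f3, and this is closed
    because the mixed derivatives of g agree: the first derivatives of g are
    differentiable at z since h and theta are. *)
Lemma local_curvature (h : form1 K) : symmetric_derivatives K ->
  is_eta U a1 a2 a3 h -> forall z, U z ->
  ext_deriv h z = - 'D_('e_0) (interp_line t1 t2 t3 w1 w2 w3) z / z 0 1.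
Proof.
move=> sym [dh h1 h2 h3] z Uz.
have hE := @eta_unique h _ (And3 h1 h2 h3) eta_theta.
pose k i := fun t : 'rV[K]_2 => h t 0 i - theta t1 t2 t3 w1 w2 w3 t 0 i.
have dk i : differentiable (k i) z.
  by apply: differentiableB; apply: differentiable_entry; [exact: dh | exact: differentiable_theta].
have jg t : U t -> jet g t ('D_('e_0) g t) ('D_('e_1) g t).
  move=> Ut; apply: jet_diff.
  by case: (jetM (jetM (jet_diff (df1 Ut)) (jet_diff (df2 Ut))) (jet_diff (df3 Ut))).
have gz t : U t -> g t != 0 by move=> Ut; rewrite /g !mulf_neq0 ?nf1 ?nf2 ?nf3.
have vec_cancel (u v : 'rV[K]_2) c i : (u + c *: v) 0 i - u 0 i = c * v 0 i.
  by rewrite !mxE addrC addKr.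
(* The first derivatives of g are g k0 and g k1, with k = h - theta differentiable. *)
have jgk t : U t -> jet g t (g t * k 0 t) (g t * k 1 t).
  move=> Ut; apply: jet_eq (jg t Ut) _ _.
    by rewrite /k hE // /dlog vec_cancel vec20 mulVKf ?gz.
  by rewrite /k hE // /dlog vec_cancel vec21 mulVKf ?gz.
have [dg g0 g1] := jgk z Uz.
have J0 := jetM (jgk z Uz) (jet_diff (dk 0)).
have J1 := jetM (jgk z Uz) (jet_diff (dk 1)).
have [D0 _ E0] := J0; have [D1 E1 _] := J1.
have := sym U g _ _ z oU Uz jgk D0 D1; rewrite E0 E1.
rewrite [g z * k 1 z * k 0 z]mulrAC => /addrI/(mulfI (gz z Uz)) kk.
rewrite -ext_deriv_theta //.
have dth i : differentiable (fun t => theta t1 t2 t3 w1 w2 w3 t 0 i) z.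
  exact: differentiable_entry (differentiable_theta Uz).
have hk i : (fun t => h t 0 i) = (fun t => k i t + theta t1 t2 t3 w1 w2 w3 t 0 i).
  by apply/funext => t; rewrite /k subrK.
rewrite /ext_deriv !hk.
have [_ -> _] := jetD (jet_diff (dk 1)) (jet_diff (dth 1)).
have [_ _ ->] := jetD (jet_diff (dk 0)) (jet_diff (dth 0)).
by rewrite kk opprD addrACA subrr add0r.
Qed.

End LocalAnalysis.

(** * Binary forms *)

Section PolyHelpers.
Variable K : numClosedFieldType.

Lemma poly_ext (p q : {poly K}) : (forall t, p.[t] = q.[t]) -> p = q.
Proof.
move=> H; apply/eqP; rewrite -subr_eq0; apply: contraT => /closed_nonrootP [t].
by rewrite rootE hornerD hornerN H subrr eqxx.
Qed.

End PolyHelpers.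

Section BinaryForms.
Variable K : numClosedFieldType.
Local Notation mX i := (mpolyX K (mnm1 i)).
Implicit Types (P Q A B : mpoly 2 K).

Definition dehomog P : {poly K} := mmap (@polyC K) (fun i : 'I_2 => if i == 0 then 1 else 'X) P.

Lemma dehomogE P t : (dehomog P).[t] = ev P (vec2 1 t).
Proof.
rewrite /dehomog /ev /mmap /meval /mmap horner_sum; apply: eq_bigr => m _.
rewrite hornerM hornerC; congr (_ * _); rewrite /mmap1 horner_prod.
apply: eq_bigr => i _; rewrite horner_exp mxE; congr (_ ^+ _).
by case: i => [[|[|//]] p] //=; rewrite ?hornerC ?hornerX.
Qed.

Definition mono (d k : nat) : multinom 2 := mnm_add (mnm_muln (mnm1 0) (d - k)) (mnm_muln (mnm1 1) k).

Lemma mono0 d k : mono d k 0 = (d - k)%N.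
Proof. by rewrite mnmDE !mulmnE !mnm1E /= mul1n mul0n addn0. Qed.
Lemma mono1 d k : mono d k 1 = k.
Proof. by rewrite mnmDE !mulmnE !mnm1E /= mul1n mul0n. Qed.

Lemma ord2P (P : 'I_2 -> Prop) : P 0 -> P 1 -> forall i, P i.
Proof.
move=> P0 P1 [[|[|//]] p].
- by rewrite (_ : Ordinal p = 0) //; exact/val_inj.
- by rewrite (_ : Ordinal p = 1) //; exact/val_inj.
Qed.

Lemma mdeg2 (m : multinom 2) : mdeg m = (m 0%R + m 1%R)%N.
Proof. by rewrite mdegE big_ord_recl big_ord1; congr (m _ + m _)%N; exact/val_inj. Qed.

Lemma monoP d (m : multinom 2) : mdeg m = d -> m = mono d (m 1).
Proof.
by rewrite mdeg2 => md; apply/mnmP; apply: ord2P; rewrite ?mono0 ?mono1 // -md addnK.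
Qed.

Lemma homog_coef d P m : P \is ishomog1 d mdeg -> mdeg m != d -> mcoeff m P = 0.
Proof. exact: dhomog_nemf_coeff. Qed.

Definition mform (d : nat) (c : nat -> K) : mpoly 2 K :=
  \sum_(k < d.+1) c k *: (mX 0 ^+ (d - k) * mX 1 ^+ k).

Lemma mform_mono d c : mform d c = \sum_(k < d.+1) c k *: mpolyX K (mono d k).
Proof.
apply: eq_bigr => k _; congr (_ *: _).
rewrite [RHS]mpolyXE_id big_ord_recl big_ord1.
have -> : lift ord0 ord0 = 1 :> 'I_2 by exact/val_inj.
by have -> : ord0 = 0 :> 'I_2 by []; rewrite mono0 mono1.
Qed.

Lemma mform_homog d c : mform d c \is ishomog1 d mdeg.
Proof.
rewrite mform_mono; apply: rpred_sum => k _; apply: dhomogZ; rewrite dhomogX.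
by apply/eqP; apply: etrans (mdeg2 _) _; rewrite mono0 mono1 subnK // -ltnS.
Qed.

Lemma homog_mform d P : P \is ishomog1 d mdeg ->
  P = mform d (fun k => mcoeff (mono d k) P).
Proof.
move=> hP; rewrite mform_mono; apply/mpolyP => m.
rewrite raddf_sum /=; under eq_bigr do rewrite mcoeffZ mcoeffX.
have [md|md] := eqVneq (mdeg m) d; last first.
  rewrite (homog_coef hP md) big1 // => k _.
  case: eqP => [E|]; last by rewrite mulr0.
  by rewrite E (homog_coef hP md) mul0r.
have lt : (m 1%R < d.+1)%N by rewrite ltnS -md mdeg2 leq_addl.
rewrite (bigD1 (Ordinal lt)) //= -monoP // eqxx mulr1 big1 ?addr0 // => k kl.
case: eqP => [E|]; last by rewrite mulr0.
by case/eqP: kl; apply/val_inj => /=; rewrite -E mono1.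
Qed.

Lemma ev_mform d c x y : ev (mform d c) (vec2 x y) = \sum_(k < d.+1) c k * (x ^+ (d - k) * y ^+ k).
Proof.
rewrite /ev /mform raddf_sum; apply: eq_bigr => k _ /=.
by rewrite mevalZ mevalM !rmorphXn /= !mevalXU !mxE.
Qed.

Lemma dehomog_mform d c : dehomog (mform d c) = \poly_(k < d.+1) c k.
Proof.
apply: poly_ext => t; rewrite dehomogE ev_mform horner_poly.
by apply: eq_bigr => k _; rewrite expr1n mul1r.
Qed.

Lemma size_dehomog d P : P \is ishomog1 d mdeg -> (size (dehomog P) <= d.+1)%N.
Proof. by move=> /homog_mform ->; rewrite dehomog_mform size_poly. Qed.

Lemma dehomog_inj d P Q : P \is ishomog1 d mdeg -> Q \is ishomog1 d mdeg ->
  dehomog P = dehomog Q -> P = Q.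
Proof.
move=> /homog_mform hP /homog_mform hQ; rewrite hP hQ !dehomog_mform => E.
apply: eq_bigr => k _; congr (_ *: _).
by have := congr1 (fun p : {poly K} => p`_k) E; rewrite !coef_poly ltn_ord.
Qed.

Lemma homog_ext d P Q : P \is ishomog1 d mdeg -> Q \is ishomog1 d mdeg ->
  (forall v, ev P v = ev Q v) -> P = Q.
Proof. by move=> hP hQ H; apply: (dehomog_inj hP hQ); apply: poly_ext => t; rewrite !dehomogE. Qed.

Lemma ev_scale n e (f : mpoly n K) c v : f \is ishomog1 e mdeg -> ev f (c *: v) = c ^+ e * ev f v.
Proof.
move=> /dhomogP hf; rewrite /ev !mevalE mulr_sumr; apply: eq_big_seq => m /hf mE.
rewrite mulrCA; congr (_ * _); under eq_bigr do rewrite mxE exprMn.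
by rewrite big_split /= prodrXr -mE; congr (_ ^+ _ * _); exact: (esym (mdegE m)).
Qed.

Lemma ev01 d P : P \is ishomog1 d mdeg -> ev P (vec2 0 1) = (dehomog P)`_d.
Proof.
move=> /homog_mform ->; rewrite ev_mform dehomog_mform coef_poly ltnSn.
rewrite big_ord_recr /= subnn expr0 expr1n !mulr1 big1 ?add0r // => k _.
by rewrite expr0n subn_eq0 leqNgt ltn_ord mul0r mulr0.
Qed.

Lemma ev_dehomog d P x y : P \is ishomog1 d mdeg -> x != 0 ->
  ev P (vec2 x y) = x ^+ d * (dehomog P).[y / x].
Proof.
move=> hP x0; rewrite dehomogE -(ev_scale _ _ hP); congr (ev P _).
by apply: row2P; rewrite !mxE /= ?mulr1 // mulrC divfK.
Qed.

Definition change (M : 'M[K]_2) P : mpoly 2 K := comp_mpoly (linear_subst M) P.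

Lemma ev_lin (M : 'M[K]_2) v j : ev (tnth (linear_subst M) j) v = (v *m M) 0 j.
Proof.
rewrite tnth_mktuple /ev raddf_sum mxE; apply: eq_bigr => i _ /=.
by rewrite mevalZ mevalXU mulrC.
Qed.

Lemma ev_change M P v : ev (change M P) v = ev P (v *m M).
Proof.
rewrite /ev /change comp_mpoly_meval; apply: meval_eq => j.
exact: ev_lin.
Qed.

Lemma change_homog d M P : P \is ishomog1 d mdeg -> change M P \is ishomog1 d mdeg.
Proof.
move=> /homog_mform ->; rewrite /change /mform raddf_sum.
apply: rpred_sum => k _ /=; rewrite comp_mpolyZ; apply: dhomogZ.
have lin j : tnth (linear_subst M) j \is ishomog1 1 mdeg.
  rewrite tnth_mktuple; apply: rpred_sum => i _; apply: dhomogZ; rewrite dhomogX.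
  by apply/eqP; exact: mdeg1.
rewrite rmorphM !rmorphXn /= !comp_mpolyXU -!tnth_nth.
have := dhomogM (dhomogMn (d - k) (lin 0)) (dhomogMn k (lin 1)).
by rewrite !mul1n subnK // -ltnS.
Qed.

End BinaryForms.

(** * Areas, linear factors and common zeros *)

Section Foliation.
Variable K : numClosedFieldType.
Implicit Types (u v : 'rV[K]_2) (M : 'M[K]_2).

Lemma det_2 M : \det M = M 0 0 * M 1 1 - M 0 1 * M 1 0.
Proof.
rewrite (expand_det_row _ ord0) !big_ord_recl big_ord0 addr0 /cofactor !det_mx11 !mxE /=.
have -> : lift ord0 ord0 = 1 :> 'I_2 by exact/val_inj.
have -> : lift 1 ord0 = 0 :> 'I_2 by exact/val_inj.
by rewrite expr0 mul1r expr1 mulN1r mulrN; congr (M _ _ * _ - M _ _ * _); exact/val_inj.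
Qed.

Lemma mul_row2 u M j : (u *m M) 0 j = u 0 0 * M 0 j + u 0 1 * M 1 j.
Proof.
rewrite mxE !big_ord_recl big_ord0 addr0.
by have -> : lift ord0 ord0 = 1 :> 'I_2 by exact/val_inj.
Qed.

Lemma wedge_mul u v M : wedge (u *m M) (v *m M) = \det M * wedge u v.
Proof.
by rewrite /wedge det_2 !mul_row2; ring.
Qed.

Lemma wedgeZl c u v : wedge (c *: u) v = c * wedge u v.
Proof. by rewrite /wedge !mxE; ring. Qed.
Lemma wedgeZr c u v : wedge u (c *: v) = c * wedge u v.
Proof. by rewrite /wedge !mxE; ring. Qed.
Lemma wedgexx u : wedge u u = 0. Proof. by rewrite /wedge; ring. Qed.
Lemma wedgeC u v : wedge u v = - wedge v u. Proof. by rewrite /wedge; ring. Qed.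

Lemma row2_neq0 u : (u != 0) = (u 0 0 != 0) || (u 0 1 != 0).
Proof.
apply/idP/idP; last first.
  by apply: contraTneq => ->; rewrite !mxE eqxx.
apply: contraNT; rewrite negb_or !negbK => /andP[/eqP h0 /eqP h1].
by apply/eqP/row2P; rewrite ?h0 ?h1 mxE.
Qed.

Lemma wedge_eq0 u v : u != 0 -> wedge u v = 0 -> exists c, v = c *: u.
Proof.
rewrite row2_neq0 /wedge => /orP[] nz /eqP; rewrite subr_eq0 => /eqP E.
- exists (v 0 0 / u 0 0); apply: row2P; rewrite mxE; first by rewrite divfK.
  by rewrite mulrAC [v 0 0 * _]mulrC -E mulrAC mulfV // mul1r.
- exists (v 0 1 / u 0 1); apply: row2P; rewrite mxE; last by rewrite divfK.
  by rewrite mulrAC [v 0 1 * _]mulrC E mulrAC mulfV // mul1r.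
Qed.

Lemma mulmx_neq0 u M : M \in unitmx -> u != 0 -> u *m M != 0.
Proof. by move=> uM; apply: contra => /eqP H; rewrite -(mulmxK uM u) H mul0mx. Qed.

Definition no_common_zero (A B : mpoly 2 K) :=
  forall v, v != 0 -> ev A v = 0 -> ev B v = 0 -> False.

(** The linear factor is the form v |-> wedge v u, see [ev_linear]. *)
Lemma linear_factor d (A : mpoly 2 K) u : A \is ishomog1 d.+1 mdeg -> u != 0 -> ev A u = 0 ->
  exists c, A = mform 1 (nth 0 [:: u 0 1; - u 0 0]) * mform d c.
Proof.
move=> hA u0 Au; set D := mform _ _.
have hD : D \is ishomog1 1 mdeg := mform_homog _ _.
suff [c uc] : exists c, dehomog A = dehomog D * \poly_(k < d.+1) c k.
  exists c; apply: (dehomog_inj hA).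
    by have := dhomogM hD (mform_homog d c); rewrite add1n.
  by rewrite /dehomog rmorphM /= -!/(dehomog _) uc dehomog_mform.
have uD : dehomog D = (u 0 1)%:P - (u 0 0) *: 'X.
  apply: poly_ext => t; rewrite dehomogE ev_mform big_ord_recl big_ord1 !hornerE /=.
  by rewrite !(mulr1, mul1r, subn0, subnn, expr0, expr1, expr1n) mulNr.
(* A zero at infinity shows in the degree of the dehomogenised form. *)
have [x0|x0] := eqVneq (u 0 0) 0.
  have y0 : u 0 1 != 0 by move: u0; rewrite row2_neq0 x0 eqxx.
  exists (fun k => (dehomog A)`_k / u 0 1); rewrite uD x0 scale0r subr0.
  have ud : (dehomog A)`_d.+1 = 0.
    have uE : u = u 0 1 *: vec2 0 1.
      by apply: row2P; rewrite mxE ?vec20 ?vec21 ?mulr0 ?mulr1.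
    move/eqP: Au; rewrite uE (ev_scale _ _ hA) (ev01 hA) mulf_eq0 expf_eq0 (negPf y0) andbF.
    by move/eqP.
  apply/polyP => i; rewrite coefCM coef_poly.
  case: ltnP => [_|]; first by rewrite mulrC divfK.
  rewrite leq_eqVlt => /orP[/eqP <-|id]; first by rewrite ud mulr0.
  by rewrite mulr0 nth_default // (leq_trans (size_dehomog hA)).
have : root (dehomog A) (u 0 1 / u 0 0).
  rewrite rootE; apply/eqP/(mulfI (expf_neq0 d.+1 x0)).
  by rewrite mulr0 -(ev_dehomog _ hA x0) -vec2_eta Au.
move=> /factor_theorem [q qE]; exists (fun k => - (q`_k) / u 0 0).
have -> : \poly_(k < d.+1) (- q`_k / u 0 0) = - (u 0 0)^-1 *: q.
  apply/polyP => i; rewrite coef_poly coefZ; case: ltnP => [_|di]; first by rewrite mulrC mulrN mulNr.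
  have [->|q0] := eqVneq q 0; first by rewrite coef0 mulr0.
  rewrite nth_default ?mulr0 //; apply: leq_trans di.
  have := size_dehomog hA; rewrite qE size_mul ?polyXsubC_eq0 // size_XsubC addn2 /= ltnS.
  by [].
rewrite qE uD; apply: poly_ext => t; rewrite !hornerE /=; field.
exact: x0.
Qed.

Lemma ev_linear u v : ev (mform 1 (nth 0 [:: u 0 1; - u 0 0])) v = wedge v u.
Proof.
rewrite [v]vec2_eta ev_mform big_ord_recl big_ord1 /wedge !mxE /=.
rewrite !(mulr1, mul1r, subn0, subnn, expr0, expr1); ring.
Qed.

Lemma evM (A B : mpoly 2 K) v : ev (A * B) v = ev A v * ev B v.
Proof. exact: mevalM. Qed.

Definition nonparallel u v := wedge u v != 0.

Lemma form_too_many_zeros d (A : mpoly 2 K) (s : seq 'rV[K]_2) : A \is ishomog1 d mdeg ->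
  (d < size s)%N -> pairwise nonparallel s -> all (fun v => v != 0) s ->
  (forall v, v \in s -> ev A v = 0) -> forall v, ev A v = 0.
Proof.
elim: d A s => [|d IH] A [|u s] hA //= ds /andP[us ps] /andP[u0 s0] zs v.
  have := zs u (mem_head _ _); rewrite (homog_mform hA) [u]vec2_eta [v]vec2_eta !ev_mform.
  by rewrite !big_ord1 subn0 !expr0.
have [c EA] := linear_factor hA u0 (zs u (mem_head _ _)).
have zs' : forall v', v' \in s -> ev (mform d c) v' = 0; last first.
  by rewrite EA evM (IH _ s (mform_homog d c) ds ps s0 zs') mulr0.
move=> v' v's; have := zs v'; rewrite inE v's orbT => /(_ isT) /eqP.
rewrite EA evM mulf_eq0 ev_linear wedgeC oppr_eq0.
by move/allP: us => /(_ _ v's) /negPf -> /eqP.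
Qed.

(** A common zero yields a common linear factor, which is not constant. *)
Lemma coprime_no_common_zero d (A B : mpoly 2 K) : (0 < d)%N ->
  A \is ishomog1 d mdeg -> B \is ishomog1 d mdeg -> coprime_mpoly A B -> no_common_zero A B.
Proof.
case: d => // d _ hA hB cop v v0 Av Bv.
have [A' EA] := linear_factor hA v0 Av; have [B' EB] := linear_factor hB v0 Bv.
have [c c0 Dc] := cop _ _ _ EA EB.
move: (ev_linear v v); rewrite Dc /ev mevalC wedgexx => c00.
by rewrite c00 eqxx in c0.
Qed.

End Foliation.

(** * The total interpolation form of a configuration of zeros *)

Section Configuration.
Variable K : numClosedFieldType.
Implicit Types (u v : 'rV[K]_2) (h : 'M[K]_2).
Variables (d : nat) (F B : 'rV[K]_2 -> K) (P : 'I_d -> 'rV[K]_2) (c : K).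
Hypothesis c0 : c != 0.
Hypothesis FE : forall v, F v = c * \prod_j wedge (P j) v.
Hypothesis Bhom : forall m v, B (m *: v) = m ^+ d * B v.
Hypothesis Pind : forall i j, i != j -> wedge (P i) (P j) != 0.

(** When p moves, the zero [P i] of F = A + p B moves with velocity - B / F'; this
    is that quotient in homogeneous coordinates. *)
Definition velocity (i : 'I_d) := - B (P i) / (c * \prod_(j | j != i) wedge (P j) (P i)).
Definition lagrange (r s : 'I_d) v := wedge (P s) v / wedge (P s) (P r).
(** By [triple_sum], twice the sum over all triples of zeros of the quadratic form
    that interpolates the velocities of the three zeros. *)
Definition total_form v :=
  \sum_r velocity r * ((\sum_s lagrange r s v) ^+ 2 - \sum_s lagrange r s v ^+ 2).

Variables (h : 'M[K]_2) (k : K) (sg : 'I_d -> 'I_d) (m : 'I_d -> K).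
Hypothesis h0 : \det h != 0.
Hypothesis k0 : k != 0.
Hypothesis Fh : forall v, F (v *m h) = k * F v.
Hypothesis Bh : forall v, B (v *m h) = k * B v.
Hypothesis Ph : forall i, P i *m h = m i *: P (sg i).
Hypothesis m0 : forall i, m i != 0.
Hypothesis sg_inj : injective sg.
Hypothesis Fnz : exists v, F v != 0.

(** Both sides compare F (v *m h) with F v, on one side through the scalar k, on the
    other through the linear factors, which h permutes. *)
Lemma prod_scale : k * \prod_i m i = \det h ^+ d.
Proof.
have [v Fv] := Fnz; apply: (mulIf Fv).
have E : \prod_j wedge (P j) (v *m h) * \prod_i m i = \det h ^+ d * \prod_j wedge (P j) v.
  rewrite [X in X * _](reindex_inj sg_inj) -big_split /=.
  rewrite -[X in _ ^+ X](card_ord d) -prodr_const -big_split /=; apply: eq_bigr => i _.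
  by rewrite mulrC -wedgeZl -Ph wedge_mul.
by rewrite mulrAC -Fh !FE -mulrA E mulrCA.
Qed.

Lemma lagrange_equivariant r s v : lagrange (sg r) (sg s) (v *m h) = m r * lagrange r s v.
Proof.
rewrite /lagrange.
have E1 : wedge (P (sg s)) (v *m h) = \det h * wedge (P s) v / m s.
  by rewrite -wedge_mul Ph wedgeZl mulrC mulKf.
have E2 : wedge (P (sg s)) (P (sg r)) = \det h * wedge (P s) (P r) / (m s * m r).
  by rewrite -wedge_mul !Ph wedgeZl wedgeZr mulrA mulrC mulKf // mulf_neq0.
rewrite E1 E2; have [->|rs] := eqVneq s r.
  by rewrite wedgexx mulr0 mul0r invr0 !mulr0.
by field; rewrite !m0 h0 Pind.
Qed.

Lemma velocity_equivariant r : velocity (sg r) = \det h * velocity r / m r ^+ 2.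
Proof.
rewrite /velocity (reindex_inj sg_inj) /=.
under eq_bigl => s do rewrite (inj_eq sg_inj).
have E2 s : wedge (P (sg s)) (P (sg r)) = \det h * wedge (P s) (P r) / (m s * m r).
  by rewrite -wedge_mul !Ph wedgeZl wedgeZr mulrA mulrC mulKf // mulf_neq0.
under eq_bigr => s _ do rewrite E2.
have BE : B (P (sg r)) = k * B (P r) / m r ^+ d.
  by rewrite -Bh Ph Bhom mulrC mulKf // expf_neq0.
rewrite BE; move: prod_scale; rewrite (bigD1 r) //=.
set W := \prod_(s | s != r) wedge (P s) (P r).
set Mr := \prod_(s | s != r) m s => E.
have W0 : W != 0 by apply/prodf_neq0 => s sr; exact: Pind.
have M0 : Mr != 0 by apply/prodf_neq0 => s sr; exact: m0.
have card : #|[pred s : 'I_d | s != r]| = d.-1.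
  by have := cardC1 r; rewrite card_ord => <-; apply: eq_card => s; rewrite !inE.
have -> : \prod_(s | s != r) (\det h * wedge (P s) (P r) / (m s * m r)) = \det h ^+ d.-1 * W / (Mr * m
  r ^+ d.-1).
  rewrite big_split /= big_split /= prodr_const card -/W; congr (_ * _ * _).
  by rewrite prodfV big_split /= prodr_const card.
have d0 : (0 < d)%N by apply: leq_ltn_trans (ltn_ord r).
move: E; rewrite -(prednK d0) !exprS; set D := \det h ^+ _; set R := m r ^+ _ => E.
have D0 : D != 0 by rewrite expf_neq0.
have R0 : R != 0 by rewrite expf_neq0.
have -> : D = k * (m r * Mr) / \det h by rewrite E mulrC mulKf.
by field; rewrite !m0 h0 c0 W0 M0 R0 k0.
Qed.

(** The form does not depend on the choice of homogeneous coordinates of the zeros,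
    so the scalars m i cancel; the weight det h is the one with which velocities
    transform. *)
Lemma total_form_equivariant v : total_form (v *m h) = \det h * total_form v.
Proof.
rewrite /total_form (reindex_inj sg_inj) /= mulr_sumr; apply: eq_bigr => r _.
rewrite velocity_equivariant (reindex_inj sg_inj) /=.
rewrite [\sum_s lagrange _ s _ ^+ 2](reindex_inj sg_inj) /=.
under eq_bigr do rewrite lagrange_equivariant.
under [X in _ - X]eq_bigr do rewrite lagrange_equivariant exprMn.
rewrite -!mulr_sumr exprMn -mulrBr.
by field; rewrite m0.
Qed.

End Configuration.

Section TripleSums.
Variables (K : numClosedFieldType) (d : nat).

Lemma pair_sum (x : 'I_d -> K) :
  (\sum_(s < d) \sum_(t < d | (s < t)%N) x s * x t) *+ 2 = (\sum_s x s) ^+ 2 - \sum_s x s ^+ 2.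
Proof.
have split3 (s : 'I_d) : \sum_t x s * x t = \sum_(t < d | (s < t)%N) x s * x t
    + x s ^+ 2 + \sum_(t < d | (t < s)%N) x s * x t.
  rewrite (bigID (fun t : 'I_d => (s < t)%N)) /= -addrA; congr (_ + _).
  rewrite (bigD1 s) ?ltnn //=; congr (_ + _); apply: eq_bigl => t.
  by rewrite -leqNgt ltn_neqAle andbC.
rewrite expr2 mulr_suml; under [X in _ = X - _]eq_bigr do rewrite mulr_sumr split3.
rewrite !big_split /= addrAC addrK mulr2n; congr (_ + _).
rewrite (exchange_big_dep predT) //=; apply: eq_bigr => s _; apply: eq_bigr => t _.
by rewrite mulrC.
Qed.

(** Each triple contributes one term for each of its members; collecting the terms
    of a given member r leaves the sum over the pairs of the other indices. *)
Lemma triple_sum (V : 'I_d -> K) (x : 'I_d -> 'I_d -> K) : (forall r, x r r = 0) ->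
  (\sum_(r < d) \sum_(s < d | (r < s)%N) \sum_(t < d | (s < t)%N)
    (V r * (x r s * x r t) + V s * (x s t * x s r) + V t * (x t r * x t s))) *+ 2
  = \sum_r V r * ((\sum_s x r s) ^+ 2 - \sum_s x r s ^+ 2).
Proof.
move=> x0; pose T a b e := V a * (x a b * x a e).
(* Indicators replace the conditions on the indices, so that sums can be exchanged. *)
pose G (a b e : 'I_d) : K := ((a < b) && (b < e))%N%:R.
have -> : \sum_(r < d) \sum_(s < d | (r < s)%N) \sum_(t < d | (s < t)%N)
    (V r * (x r s * x r t) + V s * (x s t * x s r) + V t * (x t r * x t s))
   = \sum_r \sum_s \sum_t G r s t * (T r s t + T s t r + T t r s).
  apply: eq_bigr => r _; rewrite big_mkcond; apply: eq_bigr => s _.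
  rewrite /G; case: ifP => rs; last by rewrite big1 // => t _; rewrite mul0r.
  rewrite big_mkcond; apply: eq_bigr => t _.
  by case: ifP => st; rewrite ?mul1r ?mul0r.
have -> : \sum_r \sum_s \sum_t G r s t * (T r s t + T s t r + T t r s) =
    \sum_r \sum_s \sum_t (G r s t + G s r t + G s t r) * T r s t.
  transitivity (\sum_r \sum_s \sum_t G r s t * T r s t + \sum_r \sum_s \sum_t G s r t * T r s t
     + \sum_r \sum_s \sum_t G s t r * T r s t); last first.
    rewrite -!big_split /=; apply: eq_bigr => r _; rewrite -!big_split /=; apply: eq_bigr => s _.
    by rewrite -!big_split /=; apply: eq_bigr => t _; rewrite !mulrDl.
  transitivity (\sum_r \sum_s \sum_t G r s t * T r s t + \sum_r \sum_s \sum_t G r s t * T s t r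
     + \sum_r \sum_s \sum_t G r s t * T t r s).
    rewrite -!big_split /=; apply: eq_bigr => r _; rewrite -!big_split /=; apply: eq_bigr => s _.
    by rewrite -!big_split /=; apply: eq_bigr => t _; rewrite !mulrDr.
  congr (_ + _ + _).
    rewrite exchange_big /=; apply: eq_bigr => s _; apply: eq_bigr => r _.
    by apply: eq_bigr => t _; rewrite /T [x s t * _]mulrC.
  rewrite (eq_bigr (fun r => \sum_t \sum_s G r s t * T t r s)); last by move=> r _; rewrite exchange_big.
  by rewrite exchange_big.
rewrite -sumrMnl; apply: eq_bigr => r _; rewrite -pair_sum mulrnAr; congr (_ *+ 2).
rewrite mulr_sumr; apply: eq_bigr => s _; rewrite mulr_sumr [RHS]big_mkcond; apply: eq_bigr => t _.
rewrite /G /T; case: ltngtP => [rs|sr|/val_inj rs]; case: (ltngtP s t) => [st|ts|/val_inj st];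
  rewrite ?andbF ?andbT ?andbb /= ?add0r ?mul0r ?addr0 ?mul1r //.
- by rewrite ltnNge (ltnW (ltn_trans rs st)) addr0 mul1r.
- case: ltngtP => [rt|tr|/val_inj rt]; rewrite ?addr0 ?add0r ?mul1r //.
  by rewrite rt x0 !mulr0.
- by rewrite ltnNge (ltnW (ltn_trans ts sr)) mul0r.
- by rewrite -st ltnNge (ltnW sr) mul0r.
- by rewrite rs x0 mul0r !mulr0.

Qed.

End TripleSums.

Section Quadratic.
Variable K : numClosedFieldType.
Implicit Types (u v : 'rV[K]_2).

Definition linear_form (L : 'rV[K]_2 -> K) := exists a b, forall v, L v = a * v 0 0 + b * v 0 1.
Definition quadratic_form (Q : 'rV[K]_2 -> K) :=
  exists q0 q1 q2, forall v, Q v = q0 * v 0 0 ^+ 2 + q1 * (v 0 0 * v 0 1) + q2 * v 0 1 ^+ 2.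

Lemma linear_formD L L' : linear_form L -> linear_form L' -> linear_form (fun v => L v + L' v).
Proof.
by move=> [a [b H]] [a' [b' H']]; exists (a + a'), (b + b') => v; rewrite H H'; ring.
Qed.
Lemma linear_form_sum (I : Type) (r : seq I) (L : I -> 'rV[K]_2 -> K) :
  (forall i, linear_form (L i)) -> linear_form (fun v => \sum_(i <- r) L i v).
Proof.
move=> H; elim: r => [|i r IH].
  by exists 0, 0 => v; rewrite big_nil !mul0r addr0.
have [a [b E]] := linear_formD (H i) IH.
by exists a, b => v; rewrite big_cons E.
Qed.
Lemma quadratic_form_sqr L : linear_form L -> quadratic_form (fun v => L v ^+ 2).
Proof.
by move=> [a [b H]]; exists (a ^+ 2), (2%:R * a * b), (b ^+ 2) => v; rewrite H; ring.
Qed.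
Lemma quadratic_formD Q Q' : quadratic_form Q -> quadratic_form Q' -> quadratic_form (fun v => Q v + Q' v).
Proof.
by move=> [a [b [e H]]] [a' [b' [e' H']]]; exists (a + a'), (b + b'), (e + e') => v; rewrite H H'; ring.
Qed.
Lemma quadratic_formZ a Q : quadratic_form Q -> quadratic_form (fun v => a * Q v).
Proof.
by move=> [q0 [q1 [q2 H]]]; exists (a * q0), (a * q1), (a * q2) => v; rewrite H; ring.
Qed.
Lemma quadratic_form_sum (I : Type) (r : seq I) (Q : I -> 'rV[K]_2 -> K) :
  (forall i, quadratic_form (Q i)) -> quadratic_form (fun v => \sum_(i <- r) Q i v).
Proof.
move=> H; elim: r => [|i r IH].
  by exists 0, 0, 0 => v; rewrite big_nil !mul0r !addr0.
have [a [b [e E]]] := quadratic_formD (H i) IH.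
by exists a, b, e => v; rewrite big_cons E.
Qed.

Lemma total_form_quadratic d B (P : 'I_d -> 'rV[K]_2) c : quadratic_form (total_form B P c).
Proof.
have L r s : linear_form (lagrange P r s).
  exists (- P s 0 1 / wedge (P s) (P r)), (P s 0 0 / wedge (P s) (P r)) => v.
  by rewrite /lagrange; move: (wedge _ _)^-1 => i; rewrite /wedge; ring.
apply: quadratic_form_sum => r; apply: quadratic_formZ.
have := quadratic_formD (quadratic_form_sqr (linear_form_sum (index_enum _) (L r)))
  (quadratic_formZ (-1) (quadratic_form_sum (index_enum _) (fun s => quadratic_form_sqr (L r s)))).
by move=> [q0 [q1 [q2 E]]]; exists q0, q1, q2 => v; rewrite -E mulN1r.
Qed.

Lemma quadratic_form_basis Q u v : quadratic_form Q -> wedge u v != 0 -> Q u = 0 -> Q v = 0 ->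
  exists b, forall x y, Q (x *: u + y *: v) = b * (x * y).
Proof.
move=> [q0 [q1 [q2 E]]] uv; rewrite !E => Eu Ev.
exists (2%:R * q0 * u 0 0 * v 0 0 + q1 * (u 0 0 * v 0 1 + u 0 1 * v 0 0) + 2%:R * q2 * u 0 1 * v 0 1) => x y.
rewrite E !mxE.
transitivity (x ^+ 2 * (q0 * u 0 0 ^+ 2 + q1 * (u 0 0 * u 0 1) + q2 * u 0 1 ^+ 2) +
   y ^+ 2 * (q0 * v 0 0 ^+ 2 + q1 * (v 0 0 * v 0 1) + q2 * v 0 1 ^+ 2) +
   (2%:R * q0 * u 0 0 * v 0 0 + q1 * (u 0 0 * v 0 1 + u 0 1 * v 0 0) + 2%:R * q2 * u 0 1 * v 0 1) * (x
     * y)); first by ring.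
by rewrite Eu Ev !mulr0 !add0r.
Qed.

Lemma basis_decomp (e1 e2 v : 'rV[K]_2) : wedge e1 e2 != 0 ->
  v = (wedge v e2 / wedge e1 e2) *: e1 + (wedge e1 v / wedge e1 e2) *: e2.
Proof.
move=> nz; apply: row2P; rewrite !mxE; apply: (mulIf nz);
  rewrite mulrDl ![_ / _ * _ * wedge _ _]mulrAC !divfK // /wedge; ring.
Qed.

End Quadratic.

(** * Finite groups of matrices preserving a quadratic form up to determinants *)

Section Cyclic.
Variable K : numClosedFieldType.
Implicit Types (u v : 'rV[K]_2) (M g h : 'M[K]_2).

Lemma primitive_root_exists n : (0 < n)%N -> exists z : K, n.-primitive_root z.
Proof.
move=> n0; have [r Dp] := closed_field_poly_normal ('X^n - 1 : {poly K}).
rewrite (monicP _) ?monicXnsubC // scale1r in Dp.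
have rn1 : all n.-unity_root r by apply/allP => z; rewrite -root_prod_XsubC -Dp.
have sz : (n < (size r).+1)%N by rewrite -(size_prod_XsubC r id) -Dp size_XnsubC.
have [|z zr prim] := hasP (has_prim_root n0 rn1 _ sz); last by exists z.
by rewrite -separable_prod_XsubC -Dp separable_Xn_sub_1 // pnatr_eq0 -lt0n.
Qed.

Lemma row_basis_eq (e1 e2 : 'rV[K]_2) M M' : wedge e1 e2 != 0 ->
  e1 *m M = e1 *m M' -> e2 *m M = e2 *m M' -> M = M'.
Proof.
move=> nz h1 h2; apply/row_matrixP => i; rewrite !rowE.
by rewrite (basis_decomp (delta_mx 0 i : 'rV[K]_2) nz) !mulmxDl -!scalemxAl h1 h2.
Qed.

Lemma quadratic_form_zero (Q : 'rV[K]_2 -> K) : quadratic_form Q -> exists2 u, u != 0 & Q u = 0.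
Proof.
move=> [q0 [q1 [q2 E]]]; have [q00|q00] := eqVneq q0 0.
  exists (vec2 1 0); first by rewrite row2_neq0 vec20 oner_eq0.
  by rewrite E vec20 vec21 q00; ring.
pose p : {poly K} := q0 *: 'X^2 + q1 *: 'X + q2%:P.
have [t /eqP tp] : exists t, root p t.
  apply/closed_rootP; rewrite /p -addrA size_polyDl; first by rewrite size_scale // size_polyXn.
  rewrite size_scale // size_polyXn; apply: leq_ltn_trans (size_polyD _ _) _.
  rewrite gtn_max (leq_ltn_trans (size_scale_leq _ _)) ?size_polyX //.
  by rewrite (leq_ltn_trans (size_polyC_leq1 _)).
exists (vec2 t 1); first by rewrite row2_neq0 vec21 oner_eq0 orbT.
by rewrite E vec20 vec21 -tp /p !hornerE /=; ring.
Qed.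

Lemma exists_independent u : u != 0 -> exists v, wedge u v != 0.
Proof.
rewrite row2_neq0 => /orP[]nz.
  by exists (vec2 0 1); rewrite /wedge vec20 vec21 mulr0 subr0 mulr1.
by exists (vec2 1 0); rewrite /wedge vec20 vec21 mulr0 sub0r mulr1 oppr_eq0.
Qed.

Lemma eigen_exp (e : 'rV[K]_2) x M n : e *m M = x *: e -> e *m M ^+ n = x ^+ n *: e.
Proof.
move=> E; elim: n => [|n IH]; first by rewrite !expr0 scale1r mulmx1.
by rewrite exprSr mulmxA IH -scalemxAl E scalerA exprSr.
Qed.

(** The off-diagonal coefficient of the j-th power of the block is j a ^ (j - 1) k,
    which in characteristic zero vanishes only with k. *)
Lemma jordan_block_infinite_order (e1 e2 : 'rV[K]_2) M a k c j : wedge e1 e2 != 0 -> a != 0 ->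
  e1 *m M = a *: e1 -> e2 *m M = k *: e1 + a *: e2 -> (0 < j)%N -> e2 *m M ^+ j = c *: e2 -> k = 0.
Proof.
move=> nz a0 Ea En j0.
have -> : e2 *m M ^+ j = (j%:R * a ^+ j.-1 * k) *: e1 + a ^+ j *: e2.
  elim: j {j0} => [|i IH]; first by rewrite !expr0 mulmx1 !mul0r scale0r add0r scale1r.
  rewrite exprSr mulmxA IH mulmxDl -!scalemxAl Ea En scalerDr !scalerA addrA -scalerDl.
  rewrite exprSr /=; congr (_ *: _ + _).
  case: i {IH} => [|i]; first by rewrite /= !expr0; ring.
  by rewrite /= exprSr -[i.+2]addn1 natrD; ring.
move=> Ec; have := congr1 (fun v => wedge v e2) Ec; rewrite /= wedgeZl wedgexx mulr0.
have -> : wedge ((j%:R * a ^+ j.-1 * k) *: e1 + a ^+ j *: e2) e2 = j%:R * a ^+ j.-1 * k * wedge e1 e2.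
  by rewrite /wedge !mxE; ring.
move/eqP; rewrite !mulf_eq0 (negPf nz) orbF pnatr_eq0.
by rewrite expf_eq0 (negPf a0) andbF orbF eqn0Ngt j0 /= => /eqP.
Qed.

Section Group.
Variables (G : set 'M[K]_2) (N : nat).
Hypothesis G_unit : forall M, G M -> M \in unitmx.
Hypothesis G1 : G 1%:M.
Hypothesis GM : forall M M', G M -> G M' -> G (M *m M').
Hypothesis GV : forall M, G M -> G (invmx M).
Hypothesis G_finite : forall M u, G M -> u != 0 ->
  exists j, [/\ (0 < j)%N, (j %| N)%N & exists c, u *m M ^+ j = c *: u].
Hypothesis N0 : (0 < N)%N.

Lemma group_expz M (n : int) : G M -> G (M ^ n).
Proof.
have GX M' n' : G M' -> G (M' ^+ n').
  move=> gM; elim: n' => [|n' IH]; first by rewrite expr0.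
  by rewrite exprS; exact: GM.
by case: n => n gM; [exact: GX | apply: GV; exact: GX].
Qed.

(** Up to scalars, a matrix diagonal in the given basis is the ratio of its
    eigenvalues, which [G_finite] makes an N-th root of unity; and a group of roots
    of unity is cyclic, generated by the smallest power z ^ k0 that occurs. *)
Lemma diagonal_group_cyclic (e1 e2 : 'rV[K]_2) : wedge e1 e2 != 0 ->
  (forall M, G M -> exists a b, e1 *m M = a *: e1 /\ e2 *m M = b *: e2) ->
  exists2 g, G g & forall h, G h -> exists n : int, exists2 c : K, c != 0 & h = c *: g ^ n.
Proof.
move=> nz diag.
have [z zp] := primitive_root_exists N0.
have e1n0 : e1 != 0 by apply: contraNneq nz => ->; rewrite /wedge !mxE !mul0r subrr.
have e2n0 : e2 != 0 by apply: contraNneq nz => ->; rewrite /wedge !mxE !mulr0 subrr.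
have diag' M : G M -> exists a, exists2 k : nat, a != 0 &
   e1 *m M = a *: e1 /\ e2 *m M = (a * z ^+ k) *: e2.
  move=> GMM; have [a [b [Ea Eb]]] := diag M GMM.
  have Mu := G_unit GMM.
  have a0 : a != 0 by apply: contraNneq (mulmx_neq0 Mu e1n0) => a0; rewrite Ea a0 scale0r.
  have e12 : e1 + e2 != 0.
    by apply: contraNneq nz => H; have -> : e2 = - e1; [apply/eqP;
      rewrite -addr_eq0 addrC H | rewrite -scaleN1r wedgeZr wedgexx mulr0].
  have [j [j0 jN [c Ec]]] := G_finite GMM e12.
  move: Ec; rewrite mulmxDl (eigen_exp _ Ea) (eigen_exp _ Eb) scalerDr => Ec.
  have E1 : a ^+ j = c.
    have := congr1 (fun v => wedge v e2) Ec; rewrite /= => H.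
    apply: (mulIf nz); move: H; rewrite /wedge !mxE => H.
    by transitivity ((a ^+ j * e1 0 0 + b ^+ j * e2 0 0) * e2 0 1 - (a ^+ j * e1 0 1 + b ^+ j * e2 0 1)
      * e2 0 0); [ring | rewrite H; ring].
  have E2 : b ^+ j = c.
    have := congr1 (fun v => wedge e1 v) Ec; rewrite /= => H.
    apply: (mulIf nz); move: H; rewrite /wedge !mxE => H.
    by transitivity (e1 0 0 * (a ^+ j * e1 0 1 + b ^+ j * e2 0 1) - e1 0 1 * (a ^+ j * e1 0 0 + b ^+ j
      * e2 0 0)); [ring | rewrite H; ring].
  have ba : (b / a) ^+ N = 1.
    case/dvdnP: jN => q ->; rewrite mulnC exprM expr_div_n E1 E2 divff ?expr1n //.
    by rewrite -E1 expf_neq0.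
  have [[k kN] /= Ek] := prim_rootP zp ba.
  by exists a, k => //; split=> //; rewrite Eb -Ek mulrC divfK.
(* exponents k such that z ^ k is the eigenvalue ratio of a member of the group *)
pose good k := (0 < k)%N && `[< exists2 g, G g & exists2 a,
  a != 0 & e1 *m g = a *: e1 /\ e2 *m g = (a * z ^+ k) *: e2 >].
have ex : exists k, good k.
  exists N; rewrite /good N0 /=; apply/asboolP; exists 1%:M => //; exists 1; first exact: oner_neq0.
  by rewrite !mulmx1 (prim_expr_order zp) mul1r !scale1r.
case: (ex_minnP ex) => k0 /andP[k00 /asboolP [g Gg [a a0 [Ea Eb]]]] kmin.
exists g => // h Gh; have [a' [k a'0 [Ea' Eb']]] := diag' h Gh.
pose q := (k %/ k0)%N; pose r := (k %% k0)%N.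
have kE : k = (q * k0 + r)%N := divn_eq k k0.
have z0 : z != 0.
  apply/eqP => z0; have /eqP := prim_expr_order zp.
  by rewrite z0 expr0n gtn_eqF // eq_sym oner_eq0.
have pwV (e : 'rV[K]_2) x : x != 0 -> e *m g ^+ q = x *: e -> e *m invmx (g ^+ q) = x^-1 *: e.
  move=> x0 E; apply: (scalerI x0); rewrite scalerA mulfV // scale1r scalemxAl -E mulmxK //.
  by apply: G_unit; exact: (group_expz (Posz q) Gg).
have Gr : G (h *m invmx (g ^+ q)) by apply: GM => //; apply: GV; exact: (group_expz (Posz q) Gg).
have aq : a ^+ q != 0 by rewrite expf_neq0.
have Fa : e1 *m (h *m invmx (g ^+ q)) = (a' / a ^+ q) *: e1.
  by rewrite mulmxA Ea' -scalemxAl (pwV _ _ aq (eigen_exp q Ea)) scalerA.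
have Fb : e2 *m (h *m invmx (g ^+ q)) = (a' / a ^+ q * z ^+ r) *: e2.
  have Eq : e2 *m g ^+ q = (a ^+ q * z ^+ (q * k0)) *: e2.
    by rewrite (eigen_exp _ Eb) exprMn mulnC exprM.
  have abq : a ^+ q * z ^+ (q * k0) != 0 by rewrite mulf_neq0 ?expf_neq0.
  rewrite mulmxA Eb' -scalemxAl (pwV _ _ abq Eq) scalerA kE exprD.
  by congr (_ *: _); field; rewrite aq expf_neq0.
have r0 : r = 0%N.
  apply/eqP; apply: contraT; rewrite -lt0n => rpos.
  have : (k0 <= r)%N.
    apply: kmin; rewrite /good rpos; apply/asboolP; exists (h *m invmx (g ^+ q)) => //.
    by exists (a' / a ^+ q); rewrite ?mulf_neq0 ?invr_eq0.
  by rewrite leqNgt ltn_mod k00.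
exists (Posz q), (a' / a ^+ q); first by rewrite mulf_neq0 ?invr_eq0.
have gq : g ^+ q \in unitmx by apply: G_unit; exact: (group_expz (Posz q) Gg).
rewrite -[LHS](mulmxKV gq).
transitivity (((a' / a ^+ q) *: 1%:M) *m g ^+ q); last by rewrite -scalemxAl mul1mx.
congr (_ *m _).
apply: (row_basis_eq nz); first by rewrite Fa -scalemxAr mulmx1.
by rewrite Fb r0 mulr1 -scalemxAr mulmx1.
Qed.

(** The group permutes the zero lines of Q. If there are two, they cannot be
    exchanged, because the sign of the determinant would then be wrong, so the group
    is diagonal in a basis of zeros. If there is only a double line, the invariance
    forces equal eigenvalues and finiteness excludes Jordan blocks, so the group
    consists of scalars. *)
Lemma invariant_form_cyclic (Q : 'rV[K]_2 -> K) : quadratic_form Q ->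
  (forall M u, G M -> Q (u *m M) = \det M * Q u) -> (exists u, Q u != 0) ->
  exists2 g, G g & forall h, G h -> exists n : int, exists2 c : K, c != 0 & h = c *: g ^ n.
Proof.
move=> qQ inv [u0 Qu0]; have [e1 e10 Qe1] := quadratic_form_zero qQ.
have QZ c u : Q (c *: u) = c ^+ 2 * Q u.
  by move: qQ => [q0 [q1 [q2 E]]]; rewrite !E !mxE; ring.
have [[e2 [nz Qe2]]|none] := pselect (exists e2, wedge e1 e2 != 0 /\ Q e2 = 0).
  have e2n0 : e2 != 0 by apply: contraNneq nz => ->; rewrite /wedge !mxE !mulr0 subrr.
  have [b bE] := quadratic_form_basis qQ nz Qe1 Qe2.
  have b0 : b != 0.
    by apply: contraNneq Qu0 => b0; rewrite (basis_decomp u0 nz) bE b0 mul0r.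
  have zero_line u : Q u = 0 -> (exists a, u = a *: e1) \/ (exists a, u = a *: e2).
    rewrite (basis_decomp u nz).
    move: (_ / _) (_ / _) => x y; rewrite bE => /eqP; rewrite !mulf_eq0 (negPf b0) /=.
    move=> /orP[|] /eqP->; rewrite scale0r ?add0r ?addr0; [right|left]; by eexists.
  apply: (diagonal_group_cyclic nz) => M GMM.
  have Mu := G_unit GMM.
  have z1 : Q (e1 *m M) = 0 by rewrite inv // Qe1 mulr0.
  have z2 : Q (e2 *m M) = 0 by rewrite inv // Qe2 mulr0.
  have wM : wedge (e1 *m M) (e2 *m M) = \det M * wedge e1 e2 := wedge_mul _ _ _.
  have dM : \det M != 0 by rewrite -unitfE -unitmxE.
  have QM := inv M (e1 + e2) GMM.
  have Q12 : Q (e1 + e2) = b by rewrite -[e1]scale1r -[e2]scale1r bE !mulr1.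
  have wn : wedge (e1 *m M) (e2 *m M) != 0 by rewrite wM mulf_neq0.
  case: (zero_line _ z1) => -[a Ea]; case: (zero_line _ z2) => -[a' Ea'].
  - by move: wn; rewrite Ea Ea' wedgeZl wedgeZr wedgexx !mulr0 eqxx.
  - by exists a, a'.
  - exfalso; move: QM; rewrite mulmxDl Ea Ea' addrC bE Q12 => QM.
    move: wM; rewrite Ea Ea' wedgeZl wedgeZr [wedge e2 e1]wedgeC => wM.
    have dE : \det M = - (a * a').
      by apply: (mulIf nz); rewrite -wM; ring.
    have aa : a * a' = 0.
      have : b * (2%:R * (a * a')) = 0.
        transitivity (b * (a' * a) - - (a * a') * b); first by ring.
        by rewrite -dE -QM subrr.
      by move/eqP; rewrite !mulf_eq0 (negPf b0) pnatr_eq0 /= -mulf_eq0 => /eqP.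
    by rewrite dE aa oppr0 eqxx in dM.
  - by move: wn; rewrite Ea Ea' wedgeZl wedgeZr wedgexx !mulr0 eqxx.
(* Q has a double zero: the group consists of scalar matrices. *)
have [e2 nz] := exists_independent e10.
have Qe2 : Q e2 != 0 by apply/eqP => Qe2; apply: none; exists e2.
have zero_line u : Q u = 0 -> exists a, u = a *: e1.
  move=> Qu; apply: wedge_eq0 => //; apply: contrapT => /eqP H; apply: none; by exists u.
apply: (diagonal_group_cyclic nz) => M GMM.
have Mu := G_unit GMM.
have [a Ea] : exists a, e1 *m M = a *: e1 by apply: zero_line; rewrite inv // Qe1 mulr0.
have e2n0 : e2 != 0 by apply: contraNneq nz => ->; rewrite /wedge !mxE !mulr0 subrr.
have [k [n En]] : exists k n, e2 *m M = k *: e1 + n *: e2.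
  by do 2!eexists; exact: basis_decomp nz.
have dM : \det M = a * n.
  apply: (mulIf nz); rewrite -wedge_mul Ea En wedgeZl; rewrite /wedge !mxE; ring.
have dM0 : \det M != 0 by rewrite -unitfE -unitmxE.
have [b bE] : exists b, forall x y, Q (x *: e1 + y *: e2) = b * (x * y) + Q e2 * y ^+ 2.
  have [q0 [q1 [q2 E]]] := qQ.
  exists (2%:R * q0 * e1 0 0 * e2 0 0 + q1 * (e1 0 0 * e2 0 1 + e1 0 1 * e2 0 0) + 2%:R * q2 * e1 0 1 *
    e2 0 1) => x y.
  apply/eqP; rewrite -subr_eq0; apply/eqP.
  by transitivity (x ^+ 2 * Q e1); [rewrite !E !mxE; ring | rewrite Qe1 mulr0].
have b0 : b = 0.
  apply/eqP; apply: contrapT => /negP nb; apply: none.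
  exists (- Q e2 *: e1 + b *: e2); split; last by rewrite bE; ring.
  have -> : wedge e1 (- Q e2 *: e1 + b *: e2) = b * wedge e1 e2 by rewrite /wedge !mxE; ring.
  by rewrite mulf_neq0.
have na : n = a.
  have := inv M e2 GMM; rewrite En bE b0 mul0r add0r dM [RHS]mulrC => /(mulfI Qe2).
  have n0 : n != 0 by apply: contraNneq dM0 => n0; rewrite dM n0 mulr0.
  by rewrite expr2 => /(mulIf n0).
have k0 : k = 0.
  have [j [j0 _ [c Ec]]] := G_finite GMM e2n0.
  have a0 : a != 0 by apply: contraNneq dM0 => a0; rewrite dM a0 mul0r.
  by move: En; rewrite na => En; exact: (jordan_block_infinite_order nz a0 Ea En j0 Ec).
by exists a, a; split=> //; rewrite En k0 scale0r add0r na.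
Qed.

End Group.
End Cyclic.

(** * The Galois group as a group of matrices *)

Section GaloisGroup.
Variables (K : numClosedFieldType) (d : nat) (w : pform K).
Implicit Types (u v : 'rV[K]_2) (M : 'M[K]_2).
Hypothesis d0 : (0 < d)%N.
Hypothesis hA : w.1 \is ishomog1 d mdeg.
Hypothesis hB : w.2 \is ishomog1 d mdeg.
Hypothesis nz : no_common_zero w.1 w.2.

Lemma form_has_zero (A : mpoly 2 K) : A \is ishomog1 d mdeg -> exists2 v, v != 0 & ev A v = 0.
Proof.
move=> h; have [s1|] := eqVneq (size (dehomog A)) 1%N; last first.
  move=> /closed_rootP [t /eqP rt]; exists (vec2 1 t); last by rewrite -dehomogE.
  by rewrite row2_neq0 vec20 oner_eq0.
exists (vec2 0 1); first by rewrite row2_neq0 vec21 oner_eq0 orbT.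
by rewrite (ev01 h) nth_default // s1.
Qed.

(** A linear relation between A and B would turn a zero of one of them into a common
    zero. *)
Lemma pencil_neq0 (a b : K) : (a != 0) || (b != 0) -> exists v, a * ev w.1 v + b * ev w.2 v != 0.
Proof.
move=> ab; apply: contrapT => H.
have {}H v : a * ev w.1 v + b * ev w.2 v = 0.
  by apply/eqP; apply: contrapT => /negP h; apply: H; exists v.
have [a0|a0] := eqVneq a 0.
  have b0 : b != 0 by move: ab; rewrite a0 eqxx.
  have [z z0 Az] := form_has_zero hA; apply: (nz z0 Az).
  by have /eqP := H z; rewrite a0 mul0r add0r mulf_eq0 (negPf b0) => /eqP.
have [z z0 Bz] := form_has_zero hB; apply: (nz z0 _ Bz).
by have /eqP := H z; rewrite Bz mulr0 addr0 mulf_eq0 (negPf a0) => /eqP.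
Qed.

(** The dehomogenised forms are coprime, so by Gauss's lemma the pair (al, be) is
    their multiple by a polynomial; having no root, that polynomial is constant. *)
Lemma proportional_pair (al be : {poly K}) :
  al * dehomog w.2 = be * dehomog w.1 -> (forall r, al.[r] = 0 -> be.[r] = 0 -> False) ->
  exists2 k, k != 0 & al = k *: dehomog w.1 /\ be = k *: dehomog w.2.
Proof.
move=> E nr.
have cop : coprimep (dehomog w.1) (dehomog w.2).
  apply: Pdiv.ClosedField.root_coprimep => x /eqP rx; apply/eqP => rx2.
  apply: (nz (v := vec2 1 x)); rewrite -?dehomogE //.
  by rewrite row2_neq0 vec20 oner_eq0.
have [q [q1 q2]] : exists q, al = q * dehomog w.1 /\ be = q * dehomog w.2.
  have [a0|a0] := eqVneq (dehomog w.1) 0.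
    have b0 : dehomog w.2 != 0.
      apply: contraTneq cop => b0; rewrite a0 b0 /coprimep gcdp0 size_poly0 //.
    move: E; rewrite a0 mulr0 => /eqP; rewrite mulf_eq0 (negPf b0) orbF => /eqP ->.
    have : dehomog w.2 %| be.
      move: cop; rewrite a0 coprime0p => /eqp_dvdl ->; exact: dvd1p.
    by case/dvdpP => q ->; exists q; rewrite mulr0.
  have : dehomog w.1 %| al * dehomog w.2 by rewrite E dvdp_mull.
  rewrite Gauss_dvdpl // => /dvdpP [q Eq]; exists q; split=> //.
  by apply: (mulIf a0); rewrite -E Eq mulrAC.
have s1 : size q = 1%N.
  apply/eqP; apply: contrapT => /negP /closed_rootP [r /eqP rq].
  by apply: (nr r); rewrite ?q1 ?q2 hornerM rq mul0r.
move/eqP/size_poly1P: s1 => [k k0 kq]; exists k => //.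
by rewrite q1 q2 kq !mul_polyC.
Qed.

Definition preserves (h : 'M[K]_2) := exists2 k, k != 0 &
  forall v, ev w.1 (v *m h) = k * ev w.1 v /\ ev w.2 (v *m h) = k * ev w.2 v.

(** Two proportional pairs of coprime forms of the same degree differ by a constant
    factor. *)
Lemma semi_invariant (h : 'M[K]_2) : h \in unitmx ->
  (forall v, v != 0 -> ev w.1 (v *m h) * ev w.2 v = ev w.2 (v *m h) * ev w.1 v) ->
  preserves h.
Proof.
move=> hu H.
have n1 (t : K) : vec2 1 t != 0 by rewrite row2_neq0 vec20 oner_eq0.
have [||k k0 [E1 E2]] := @proportional_pair (dehomog (change h w.1)) (dehomog (change h w.2)).
- by apply: poly_ext => t; rewrite !hornerM !dehomogE !ev_change H.
- move=> r; rewrite !dehomogE !ev_change => r1 r2.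
  exact: (nz (mulmx_neq0 hu (n1 r)) r1 r2).
exists k => // v.
have aux (A : mpoly 2 K) : A \is ishomog1 d mdeg -> dehomog (change h A) = k *: dehomog A ->
    ev A (v *m h) = k * ev A v.
  move=> hA' E; rewrite -ev_change.
  have -> : change h A = k *: A.
    apply: (dehomog_inj (change_homog _ hA')); first exact: dhomogZ.
    by rewrite E; apply: poly_ext => t; rewrite hornerZ !dehomogE /ev mevalZ.
  by rewrite /ev mevalZ.
by split; apply: aux.
Qed.

(** The map on the projective line takes homogeneous coordinates [y : x], whereas
    the forms take (x, y). *)
Definition swap : 'M[K]_2 := \matrix_(i, j) (i != j)%:R.
Lemma mul_swap u : u *m swap = vec2 (u 0 1) (u 0 0).
Proof. by apply: row2P; rewrite mul_row2 !mxE /= !(mulr0, mulr1, add0r, addr0). Qed.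
Lemma swapK : swap *m swap = 1%:M.
Proof.
apply/row_matrixP => i; rewrite !rowE mulmxA mulmx1 !mul_swap.
by apply: row2P; rewrite ?vec20 ?vec21.
Qed.
Lemma swap_unit : swap \in unitmx.
Proof. by case: (mulmx1_unit swapK). Qed.
Lemma mul_swapK u : u *m swap *m swap = u. Proof. by rewrite -mulmxA swapK mulmx1. Qed.
Definition conj_swap M := swap *m M *m swap.

Lemma mul_conj_swap u M : u *m swap *m conj_swap M = u *m M *m swap.
Proof. by rewrite /conj_swap !mulmxA mul_swapK. Qed.

Lemma gaussP1E u : gaussP1 w u = vec2 (- ev w.1 (u *m swap)) (ev w.2 (u *m swap)).
Proof. by rewrite /gaussP1 mul_swap. Qed.

Lemma Gal_semi_invariant M : Gal w M -> exists2 k, k != 0 &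
  forall u, ev w.1 (u *m M *m swap) = k * ev w.1 (u *m swap) /\
            ev w.2 (u *m M *m swap) = k * ev w.2 (u *m swap).
Proof.
move=> [Mu H]; have [||k k0 kE] := @semi_invariant (conj_swap M).
- by rewrite /conj_swap !unitmx_mul swap_unit Mu.
- move=> v v0; rewrite -[v]mul_swapK mul_conj_swap.
  have [|c c0 E] := H (v *m swap); first exact: mulmx_neq0 swap_unit v0.
  have scal (a b a' b' : K) : vec2 a b = c *: vec2 a' b' -> a = c * a' /\ b = c * b'.
    by move=> e; rewrite -{1}(vec20 a b) -{2}(vec21 a b) e !mxE.
  move: E; rewrite !gaussP1E => /scal [/eqP]; rewrite mulrN eqr_opp => /eqP -> ->.
  by rewrite mulrAC.
exists k => // u; have := kE (u *m swap); by rewrite mul_conj_swap.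
Qed.

Lemma Gal_intro M k : M \in unitmx -> k != 0 ->
  (forall u, ev w.1 (u *m M *m swap) = k * ev w.1 (u *m swap)) ->
  (forall u, ev w.2 (u *m M *m swap) = k * ev w.2 (u *m swap)) -> Gal w M.
Proof.
move=> Mu k0 H1 H2; split=> // u u0; exists k => //.
by rewrite !gaussP1E H1 H2; apply: row2P; rewrite ?vec20 ?vec21 [RHS]mxE ?vec20 ?vec21 ?mulrN.
Qed.

Lemma Gal1 : Gal w 1%:M.
Proof. by apply: (@Gal_intro _ 1); rewrite ?unitmx1 ?oner_eq0 // => u; rewrite mulmx1 mul1r. Qed.

Lemma GalM M M' : Gal w M -> Gal w M' -> Gal w (M *m M').
Proof.
move=> GM GM'; have [k k0 kE] := Gal_semi_invariant GM; have [k' k'0 kE'] := Gal_semi_invariant GM'.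
apply: (@Gal_intro _ (k' * k)); first by rewrite unitmx_mul; case: GM GM' => -> _ [-> _].
- by rewrite mulf_neq0.
- by move=> u; rewrite mulmxA (kE' _).1 (kE _).1 mulrA.
- by move=> u; rewrite mulmxA (kE' _).2 (kE _).2 mulrA.
Qed.

Lemma GalV M : Gal w M -> Gal w (invmx M).
Proof.
move=> GM; have [k k0 kE] := Gal_semi_invariant GM; case: (GM) => Mu _.
apply: (@Gal_intro _ k^-1); rewrite ?unitmx_inv ?invr_eq0 // => u; apply: (mulfI k0).
- by rewrite -(kE _).1 mulmxKV // mulrA mulfV // mul1r.
- by rewrite -(kE _).2 mulmxKV // mulrA mulfV // mul1r.
Qed.

Lemma GalX M n : Gal w M -> Gal w (M ^+ n).
Proof.
move=> gM; elim: n => [|n IH]; first by rewrite expr0; exact: Gal1.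
by rewrite exprS; exact: GalM.
Qed.

(** All iterates of u under M are zeros of the member of the pencil that vanishes at
    u. As that form has degree d, two of the first d + 1 iterates are parallel. *)
Lemma Gal_finite M u : Gal w M -> u != 0 ->
  exists j, [/\ (0 < j)%N, (j %| d`!)%N & exists c, u *m M ^+ j = c *: u].
Proof.
move=> GM u0; apply: contrapT => none.
have {}none j : (0 < j <= d)%N -> wedge u (u *m M ^+ j) != 0.
  move=> /andP[j0 jd]; apply/eqP => /(wedge_eq0 u0) [c E]; apply: none; exists j.
  by split=> //; [rewrite dvdn_fact // j0 | exists c].
have v0 : u *m swap != 0 := mulmx_neq0 swap_unit u0.
(* coefficients of the member of the pencil vanishing at u *)
pose a := ev w.2 (u *m swap); pose b := - ev w.1 (u *m swap).
have ab : (a != 0) || (b != 0).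
  rewrite -negb_and; apply/negP => /andP[/eqP a0 /eqP b0]; apply: (nz v0) => //.
  by apply/eqP; rewrite -oppr_eq0; apply/eqP.
have [x] := pencil_neq0 ab; apply/negP; rewrite negbK; apply/eqP.
pose H := a *: w.1 + b *: w.2.
have HE y : ev H y = a * ev w.1 y + b * ev w.2 y by rewrite /H /ev mevalD !mevalZ.
rewrite -HE.
have hH : H \is ishomog1 d mdeg by apply: rpredD; apply: dhomogZ.
apply: (form_too_many_zeros (s := [seq u *m M ^+ j *m swap | j <- iota 0 d.+1]) hH).
- by rewrite size_map size_iota.
- rewrite pairwise_map.
  have : pairwise ltn (iota 0 d.+1) by rewrite -(sorted_pairwise ltn_trans) iota_ltn_sorted.
  apply: (@sub_in_pairwise _ (fun j => (j <= d)%N)); last by apply/allP => j; rewrite mem_iota.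
  move=> i j id' jd' ij'.
  have ij : (i < j)%N := ij'; have jd : (j <= d)%N := jd'.
  rewrite /relpre /nonparallel /=.
  rewrite wedge_mul mulf_neq0 //; first by rewrite -unitfE -unitmxE swap_unit.
  rewrite -(subnK (ltnW ij)) exprD -[M ^+ (j - i) * _]/(_ *m _) mulmxA wedge_mul mulf_neq0 //.
    by rewrite -unitfE -unitmxE; case: (GalX i GM).
  by apply: none; rewrite subn_gt0 ij (leq_trans (leq_subr _ _)).
- apply/allP => _ /mapP[j _ ->]; apply: mulmx_neq0 swap_unit _; apply: mulmx_neq0 => //.
  by case: (GalX j GM).
- move=> _ /mapP[j _ ->]; rewrite HE.
  have [k _ kE] := Gal_semi_invariant (GalX j GM).
  by rewrite (kE _).1 (kE _).2 /a /b; ring.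
Qed.

End GaloisGroup.

(** * The total form of a fibre *)

Section NonCyclic.
Variables (K : numClosedFieldType) (d : nat) (w : pform K).
Hypothesis d1 : (1 < d)%N.
Hypothesis hA : w.1 \is ishomog1 d mdeg.
Hypothesis hB : w.2 \is ishomog1 d mdeg.
Hypothesis nz : no_common_zero w.1 w.2.

(** The Galois group permutes the zeros of A + p B, so a nonzero total form would be
    a quadratic form to which [invariant_form_cyclic] applies. *)
Lemma total_form_noncyclic (p c : K) (P : 'I_d -> 'rV[K]_2) : c != 0 ->
  (forall v, ev w.1 v + p * ev w.2 v = c * \prod_j wedge (P j) v) ->
  (forall i j, i != j -> wedge (P i) (P j) != 0) ->
  ~ Gal_cyclic w -> forall v, total_form (ev w.2) P c v = 0.
Proof.
move=> c0 FE Pind ncyc v0; apply/eqP; apply: contrapT => /negP Qv0; apply: ncyc.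
have d0 : (0 < d)%N := ltnW d1.
have P0 i : P i != 0.
  have [j ij] : exists j : 'I_d, i != j.
    have [i0|i0] := eqVneq (val i) 0%N.
      by exists (Ordinal d1); apply: contra_eqN i0 => /eqP ->.
    by exists (Ordinal d0); apply: contra i0 => /eqP ->.
  by apply: contraNneq (Pind i j ij) => ->; rewrite /wedge !mxE !mul0r subrr.
pose Q u := total_form (ev w.2) P c (u *m swap K).
apply: (@invariant_form_cyclic _ (Gal w) d`! _ _ _ _ _ _ Q).
- by move=> M [].
- exact: Gal1.
- move=> M M' GM GM'. exact: (GalM hA hB nz GM GM').
- by move=> M GM; exact: (GalV hA hB nz GM).
- by move=> M u GM u0; exact: (Gal_finite d0 hA hB nz GM u0).
- exact: fact_gt0.
- have [q0 [q1 [q2 E]]] := total_form_quadratic (ev w.2) P c.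
  by exists q2, q1, q0 => u; rewrite /Q E mul_swap vec20 vec21; ring.
- move=> M u GM; have [k k0 kE] := Gal_semi_invariant hA hB nz GM.
  have [Mu _] := GM.
  have kA v : ev w.1 (v *m conj_swap M) = k * ev w.1 v by rewrite -[v]mul_swapK mul_conj_swap (kE _).1.
  have kB v : ev w.2 (v *m conj_swap M) = k * ev w.2 v by rewrite -[v]mul_swapK mul_conj_swap (kE _).2.
  have twu : conj_swap M \in unitmx by rewrite /conj_swap !unitmx_mul swap_unit Mu.
  have root i : exists jm : 'I_d * K, jm.2 != 0 /\ P i *m conj_swap M = jm.2 *: P jm.1.
    have : \prod_j wedge (P j) (P i *m conj_swap M) = 0.
      apply: (mulfI c0); rewrite mulr0 -FE kA kB mulrCA -mulrDr FE.
      by rewrite (bigD1 i) //= wedgexx mul0r !mulr0.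
    move/eqP/prodf_eq0 => [j _ /eqP /(wedge_eq0 (P0 j)) [m E]].
    exists (j, m); split=> //=; apply: contraNneq (mulmx_neq0 twu (P0 i)) => m0.
    by rewrite E m0 scale0r.
  have [jm jmE] := choice root.
  rewrite /Q -mul_conj_swap.
  rewrite (@total_form_equivariant _ d (fun v => ev w.1 v + p * ev w.2 v) (ev w.2) P c c0 FE _ Pind
    (conj_swap M) k (fun i => (jm i).1) (fun i => (jm i).2)) //.
  + congr (_ * _); rewrite /conj_swap !det_mulmx mulrAC -det_mulmx swapK det1 mul1r //.
  + by move=> m v; exact: ev_scale.
  + by rewrite -unitfE -unitmxE.
  + by move=> v; rewrite kA kB; ring.
  + by move=> i; case: (jmE i).
  + by move=> i; case: (jmE i).
  + move=> i j E; apply/eqP; apply: contraT => ij; have := Pind i j ij.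
    have dt : \det (conj_swap M) != 0 by rewrite -unitfE -unitmxE.
    rewrite -(inj_eq (mulfI dt)) mulr0 -wedge_mul (jmE i).2 (jmE j).2 E wedgeZl wedgeZr wedgexx.
    by rewrite !mulr0 eqxx.
  + have [|v] := @pencil_neq0 K d w d0 hA hB nz 1 p; first by rewrite oner_eq0.
    by rewrite mul1r; exists v.
- by exists (v0 *m swap K); rewrite /Q mul_swapK.
Qed.

End NonCyclic.

Section Chart.
Variable K : numClosedFieldType.

Lemma interp_lagrange (t1 t2 t3 w1 w2 w3 x y : K) :
  t1 != t2 -> t1 != t3 -> t2 != t3 ->
  interp t1 t2 t3 w1 w2 w3 x y =
    w1 * ((y - t2 * x) / (t1 - t2) * ((y - t3 * x) / (t1 - t3)))
  + w2 * ((y - t3 * x) / (t2 - t3) * ((y - t1 * x) / (t2 - t1)))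
  + w3 * ((y - t1 * x) / (t3 - t1) * ((y - t2 * x) / (t3 - t2))).
Proof.
move=> h12 h13 h23; rewrite /interp /interp0 /interp1 /interp2; field.
by rewrite !subr_eq0 ![t3 == _]eq_sym ![t2 == t1]eq_sym h12 h13 h23.
Qed.

Variables (d : nat) (A B : mpoly 2 K) (M : 'M[K]_2) (p c : K) (x t : 'I_d -> K).
Hypothesis d0 : (0 < d)%N.
Hypothesis hA : A \is ishomog1 d mdeg.
Hypothesis hB : B \is ishomog1 d mdeg.
Hypothesis detM : \det M = 1.
Hypothesis c0 : c != 0.
Hypothesis x0 : forall i, x i != 0.
Hypothesis t_inj : injective t.
Let P i : 'rV[K]_2 := (x i *: vec2 1 (t i)) *m M.
Hypothesis FE : forall v, ev A v + p * ev B v = c * \prod_j wedge (P j) v.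

Let a := dehomog (change M A).
Let b := dehomog (change M B).

Lemma wedge_chart i u : wedge (P i) (u *m M) = x i * (u 0 1 - t i * u 0 0).
Proof. by rewrite /P wedge_mul detM wedgeZl /wedge vec20 vec21 !mul1r. Qed.

Lemma chart_factor : a + p *: b = (c * \prod_j x j) *: \prod_j ('X - (t j)%:P).
Proof.
apply: poly_ext => s; rewrite hornerD !hornerZ horner_prod !dehomogE !ev_change FE -mulrA; congr (_ * _).
rewrite -big_split /=; apply: eq_bigr => j _.
by rewrite wedge_chart vec20 vec21 mulr1 hornerXsubC.
Qed.

Lemma chart_root i : a.[t i] + p * b.[t i] = 0.
Proof.
rewrite -hornerZ -hornerD chart_factor hornerZ horner_prod.
by rewrite [X in _ * X](bigD1 i) //= hornerXsubC subrr mul0r mulr0.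
Qed.

Lemma chart_derivative i : a^`().[t i] + p * b^`().[t i] =
  c * \prod_j x j * \prod_(j | j != i) (t i - t j).
Proof.
rewrite -hornerZ -derivZ -hornerD -derivD chart_factor derivZ hornerZ; congr (_ * _).
rewrite (bigD1 i) //= derivM derivXsubC mul1r hornerD hornerM hornerXsubC subrr mul0r addr0.
by rewrite horner_prod; apply: eq_bigr => j _; rewrite hornerXsubC.
Qed.

Lemma chart_simple i : a^`().[t i] + p * b^`().[t i] != 0.
Proof.
rewrite chart_derivative !mulf_neq0 //; apply/prodf_neq0 => j ji //.
by rewrite subr_eq0; apply: contra ji => /eqP /t_inj ->.
Qed.

(** Derivative with respect to p of a simple root s of a + p b. *)
Definition chart_velocity (a b : {poly K}) p s := - b.[s] / (a^`().[s] + p * b^`().[s]).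

Lemma velocity_chart i : velocity (ev B) P c i = x i ^+ 2 * chart_velocity a b p (t i).
Proof.
rewrite /velocity /chart_velocity chart_derivative.
have -> : ev B (P i) = x i ^+ d * b.[t i].
  by rewrite /P -scalemxAl (ev_scale _ _ hB) dehomogE ev_change.
have card : #|[pred s : 'I_d | s != i]| = d.-1.
  by have := cardC1 i; rewrite card_ord => <-; apply: eq_card => s; rewrite !inE.
have -> : \prod_(j | j != i) wedge (P j) (P i) = \prod_(j | j != i) x j * x i ^+ d.-1 * \prod_(j | j !=
  i) (t i - t j).
  rewrite -[in X in _ * X * _]card -prodr_const -!big_split /=; apply: eq_bigr => j _.
  by rewrite wedge_chart !mxE /=; ring.
rewrite (bigD1 i (P := predT)) //=.
have X0 : \prod_(j | j != i) x j != 0 by apply/prodf_neq0.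
have T0 : \prod_(j | j != i) (t i - t j) != 0.
  by apply/prodf_neq0 => j ji; rewrite subr_eq0; apply: contra ji => /eqP /t_inj ->.
have -> : x i ^+ d = x i * x i ^+ d.-1 by rewrite -exprS prednK.
set X := x i ^+ d.-1.
have Xn : X != 0 by rewrite expf_neq0.
by field; rewrite X0 T0 Xn c0 x0.
Qed.

Lemma total_form_chart u :
  total_form (ev B) P c (u *m M) =
  (\sum_(r < d) \sum_(s < d | (r < s)%N) \sum_(e < d | (s < e)%N)
     interp (t r) (t s) (t e) (chart_velocity a b p (t r)) (chart_velocity a b p (t s))
       (chart_velocity a b p (t e)) (u 0 0) (u 0 1)) *+ 2.
Proof.
pose V i := chart_velocity a b p (t i).
pose l r s := (u 0 1 - t s * u 0 0) / (t r - t s).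
have lE r s : lagrange P r s (u *m M) = l r s / x r.
  have W : wedge (P s) (P r) = x s * (x r * (t r - t s)).
    by rewrite {2}/P wedge_chart !mxE /=; ring.
  rewrite /lagrange wedge_chart W /l; have [->|rs] := eqVneq r s.
    by rewrite subrr !mulr0 invr0 !mulr0 mul0r.
  have trs : t r - t s != 0 by rewrite subr_eq0; apply: contra rs => /eqP /t_inj ->.
  by field; rewrite !x0 trs.
rewrite /total_form -[LHS]/(\sum_r _).
transitivity (\sum_r V r * ((\sum_s l r s) ^+ 2 - \sum_s l r s ^+ 2)).
  apply: eq_bigr => r _; rewrite velocity_chart -/(V r).
  under eq_bigr do rewrite lE.
  under [X in _ - X]eq_bigr do rewrite lE exprMn.
  rewrite -!mulr_suml exprMn -mulrBl.
  by move: (_ - _) => y; field; rewrite x0.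
rewrite -triple_sum; last by move=> r; rewrite /l subrr invr0 mulr0.
congr (_ *+ 2); apply: eq_bigr => r _; apply: eq_bigr => s rs; apply: eq_bigr => e se.
have ne (i j : 'I_d) : (i < j)%N -> t i != t j.
  by move=> ij; apply/eqP => /t_inj E; rewrite E ltnn in ij.
by rewrite interp_lagrange ?ne // (ltn_trans rs se).
Qed.

End Chart.

(** * The Legendre transform in a chart *)

Section Sums.
Variable K : numClosedFieldType.

Lemma jet_sum (I : Type) (r : seq I) (Pr : pred I) (f : I -> 'rV[K]_2 -> K) z (d0 d1 : I -> K) :
  (forall i, Pr i -> jet (f i) z (d0 i) (d1 i)) ->
  jet (fun t => \sum_(i <- r | Pr i) f i t) z (\sum_(i <- r | Pr i) d0 i) (\sum_(i <- r | Pr i) d1 i).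
Proof.
move=> H; elim: r => [|i r IH].
  rewrite !big_nil (_ : (fun t => _) = fun=> 0); first exact: jet_cst.
  by apply/funext => t; rewrite big_nil.
rewrite !big_cons (_ : (fun t => _) = fun t => if Pr i then f i t + \sum_(j <- r | Pr j) f j t
   else \sum_(j <- r | Pr j) f j t); last by apply/funext => t; rewrite big_cons.
by case: ifP => // Pi; apply: jetD => //; exact: H.
Qed.

Lemma ext_deriv_sum (I : Type) (r : seq I) (Pr : pred I) (h : I -> form1 K) z :
  (forall i, Pr i -> differentiable (h i) z) ->
  ext_deriv (fun t => \sum_(i <- r | Pr i) h i t) z = \sum_(i <- r | Pr i) ext_deriv (h i) z /\
  differentiable (fun t => \sum_(i <- r | Pr i) h i t) z.
Proof.
move=> H.
have J k := @jet_sum I r Pr (fun i t => h i t 0 k) z _ _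
  (fun i Pi => jet_diff (differentiable_entry k (H i Pi))).
have E k : (fun t => (\sum_(i <- r | Pr i) h i t) 0 k) = (fun t => \sum_(i <- r | Pr i) h i t 0 k).
  by apply/funext => t; rewrite summxE.
split; first by rewrite /ext_deriv !E; have [_ -> _] := J 1; have [_ _ ->] := J 0; rewrite -sumrB.
rewrite (_ : (fun t => _) = (fun t => vec2 (\sum_(i <- r | Pr i) h i t 0 0) (\sum_(i <- r | Pr i) h i t
  0 1))).
  by apply: differentiable_vec2; [case: (J 0) | case: (J 1)].
by apply/funext => t; apply: row2P; rewrite ?vec20 ?vec21 summxE.
Qed.

Lemma scale_vec2 (x b e : K) : x *: vec2 b e = vec2 (x * b) (x * e).
Proof. by apply: row2P; rewrite !mxE. Qed.

Lemma avoid_roots d (u v : 'I_d -> K) : (forall i, (u i != 0) || (v i != 0)) ->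
  exists s, forall i, u i * s + v i != 0.
Proof.
move=> uv; have : \prod_i (u i *: 'X + (v i)%:P) != 0.
  apply/prodf_neq0 => i _; apply: contraTneq (uv i) => /polyP H.
  move: (H 0%N) (H 1%N); rewrite !coefE /= mulr0 mulr1 addr0 add0r.
  by move=> -> ->; rewrite eqxx.
move=> /closed_nonrootP [s]; rewrite rootE horner_prod => /prodf_neq0 H.
by exists s => i; have := H i isT; rewrite !hornerE.
Qed.

End Sums.

(** Obtained by differentiating the equation of the root in the directions of p and
    q. *)
Lemma implicit_root_jet (K : numClosedFieldType) (b1 b2 : {poly K}) (D : set 'rV[K]_2)
    (f : 'rV[K]_2 -> K) (z : 'rV[K]_2) :
  open D -> D z -> differentiable f z ->
  (forall t, D t -> b1.[f t] + t 0 0 * b2.[f t] = 0) ->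
  b1^`().[f z] + z 0 0 * b2^`().[f z] != 0 ->
  jet f z (chart_velocity b1 b2 (z 0 0) (f z)) 0.
Proof.
have solve0 (x B1 B2 b p : K) : 0 = B1 * x + (1 * b + p * (B2 * x)) -> x * (B1 + p * B2) = - b.
  by move=> e; apply/eqP; rewrite -subr_eq0 opprK; apply/eqP; rewrite [RHS]e; ring.
have solve1 (x B1 B2 b p : K) : 0 = B1 * x + (0 * b + p * (B2 * x)) -> (B1 + p * B2) * x = 0.
  by move=> e; rewrite [RHS]e; ring.
move=> oD Dz df eqn nz; have jt := jet_diff df.
have [_ e0 e1] := jetD (jet_horner b1 jt) (jetM (jet_coord 0 z) (jet_horner b2 jt)).
have Z k : 'D_k (fun t => b1.[f t] + t 0 0 * b2.[f t]) z = 0.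
  by rewrite (derive_eq_on_open (g := fun=> 0) _ oD Dz) //; exact: derive_cst.
rewrite Z /= in e0; rewrite Z /= in e1.
apply: (jet_eq jt).
  by rewrite /chart_velocity; apply: (mulIf nz); rewrite divfK //; exact: solve0 e0.
by apply: (mulfI nz); rewrite mulr0; exact: solve1 e1.
Qed.

Section Flatness.
Variables (K : numClosedFieldType) (d : nat) (w : pform K).
Hypothesis sym : symmetric_derivatives K.
Hypothesis d1 : (1 < d)%N.
Hypothesis hA : w.1 \is ishomog1 d mdeg.
Hypothesis hB : w.2 \is ishomog1 d mdeg.

Variables (U : set 'rV[K]_2) (a : 'I_d -> form1 K).
Hypothesis LF : local_foliations (Leg w) U a.

Lemma contract2 (u v : 'rV[K]_2) : contract u v = u 0 0 * v 0 0 + u 0 1 * v 0 1.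
Proof.
rewrite /contract !big_ord_recl big_ord0 addr0.
by have -> : lift ord0 ord0 = 1 :> 'I_2 by exact/val_inj.
Qed.

Lemma exists_neq (i : 'I_d) : exists j, i != j.
Proof.
have [i0|i0] := eqVneq (val i) 0%N.
  by exists (Ordinal d1); apply: contra_eqN i0 => /eqP ->.
by exists (Ordinal (ltnW d1)); apply: contra i0 => /eqP ->.
Qed.

(** For q = 0 the Legendre transform is a multiple of dq ^ d: it is either zero or
    has a multiple factor. *)
Lemma foliations_q_neq0 z : U z -> z 0 1 != 0.
Proof.
move=> Uz; have [_ _ an0 aw /(_ z Uz) [c c0 LE]] := LF.
apply/eqP => q0.
pose C := ev w.1 (vec2 1 (z 0 0)) + z 0 0 * ev w.2 (vec2 1 (z 0 0)).
have LC v : Leg w z v = v 0 1 ^+ d * C.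
  rewrite /Leg q0 mul0r subr0.
  have -> : vec2 (v 0 1) (z 0 0 * v 0 1) = v 0 1 *: vec2 1 (z 0 0).
    by apply: row2P; rewrite !mxE /= ?mulr1 // mulrC.
  by rewrite (ev_scale _ _ hA) (ev_scale _ _ hB) /C; ring.
(* One of the forms is a multiple of dq, so another one is not, and its kernel
   shows that the multiple C of dq ^ d is zero. *)
have [i ai0] : exists i, a i z 0 0 = 0.
  have := LE (vec2 1 0); rewrite LC vec21 expr0n gtn_eqF ?(ltnW d1) // mul0r => /esym/eqP.
  rewrite mulf_eq0 (negPf c0) => /prodf_eq0 [i _ /eqP H]; exists i.
  by move: H; rewrite contract2 vec20 vec21 mulr0 mulr1 addr0.
have [j ij] := exists_neq i.
have aj0 : a j z 0 0 != 0.
  by have := aw i j z Uz ij; apply: contraNneq => aj0; rewrite /wedge ai0 aj0 mul0r mulr0 subrr.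
have C0 : C = 0.
  have := LE (vec2 (- a j z 0 1) (a j z 0 0)); rewrite LC vec21 (bigD1 j) //=.
  rewrite contract2 vec20 vec21 => H; apply: (mulfI (expf_neq0 d aj0)).
  by rewrite H mulr0; ring.
have [i'|s sE] := @avoid_roots K d (fun i => a i z 0 0) (fun i => a i z 0 1).
  by rewrite -row2_neq0; exact: an0.
have /eqP := LE (vec2 s 1); rewrite LC C0 mulr0 eq_sym mulf_eq0 (negPf c0) => /prodf_eq0 [i' _].
by rewrite contract2 vec20 vec21 mulr1 (negPf (sE i')).
Qed.

(** The solution (x, y) of the equation a i = q x dp + (y - p x) dq between forms. *)
Definition root_vec i (z : 'rV[K]_2) : 'rV[K]_2 :=
  vec2 (a i z 0 0 / z 0 1) (a i z 0 1 + z 0 0 * (a i z 0 0 / z 0 1)).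

Lemma root_vec_differentiable i k z : U z -> differentiable (fun z => root_vec i z 0 k) z.
Proof.
move=> Uz; have [_ ah _ _ _] := LF.
have da l := jet_diff (differentiable_entry l (ah i z Uz)).
have j0 := jetM (da 0) (jetV (jet_coord 1 z) (foliations_q_neq0 Uz)).
have j1 := jetD (da 1) (jetM (jet_coord 0 z) j0).
apply: differentiable_entry; apply: differentiable_vec2; [by case: j0 | by case: j1].
Qed.

Lemma wedge_root_vec i j z : U z -> wedge (root_vec i z) (root_vec j z) = wedge (a i z) (a j z) / z 0 1.
Proof. by move=> Uz; rewrite /wedge !mxE /=; field; exact: foliations_q_neq0. Qed.

(** As q is nonzero, every vector of the plane is (dq, p dq - q dp) for some tangent
    vector. *)
Lemma root_vec_factor z : U z -> exists2 c, c != 0 & forall v,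
  ev w.1 v + z 0 0 * ev w.2 v = c * \prod_i wedge (root_vec i z) v.
Proof.
move=> Uz; have q0 := foliations_q_neq0 Uz.
have [_ _ _ _ /(_ z Uz) [c c0 LE]] := LF.
exists (c * (-1) ^+ d); first by rewrite mulf_neq0 // expf_neq0 // oppr_eq0 oner_eq0.
move=> v; have := LE (vec2 ((z 0 0 * v 0 0 - v 0 1) / z 0 1) (v 0 0)).
rewrite /Leg vec20 vec21.
have -> : vec2 (v 0 0) (z 0 0 * v 0 0 - z 0 1 * ((z 0 0 * v 0 0 - v 0 1) / z 0 1)) = v.
  by apply: row2P; rewrite ?vec20 ?vec21 // [z 0 1 * _]mulrC divfK // opprB addrC subrK.
move=> ->; rewrite -mulrA -[X in _ ^+ X](card_ord d) -prodr_const -big_split /=; congr (_ * _).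
apply: eq_bigr => i _; rewrite contract2 /wedge !mxE /=; field; exact: q0.
Qed.

Lemma root_vec_model i z (M : 'M[K]_2) : U z -> \det M = 1 ->
  let m := invmx M in let u := root_vec i z *m m in u 0 0 != 0 ->
  a i z = model_form (m 0 0) (m 1 0) (m 0 1) (m 1 1) (u 0 0) (u 0 1 / u 0 0) z.
Proof.
move=> Uz dM m u u0; have q0 := foliations_q_neq0 Uz.
have dm : m 0 0 * m 1 1 - m 0 1 * m 1 0 = 1 by rewrite -det_2 /m det_inv dM invr1.
have uE0 : u 0 0 = root_vec i z 0 0 * m 0 0 + root_vec i z 0 1 * m 1 0 := mul_row2 _ _ _.
have uE1 : u 0 1 = root_vec i z 0 0 * m 0 1 + root_vec i z 0 1 * m 1 1 := mul_row2 _ _ _.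
have X : root_vec i z 0 0 = - (m 1 0 * u 0 1 - m 1 1 * u 0 0).
  rewrite uE0 uE1 -[LHS]mulr1 -dm; ring.
have Y : root_vec i z 0 1 - z 0 0 * root_vec i z 0 0 =
   (m 0 0 + m 1 0 * z 0 0) * u 0 1 - (m 0 1 + m 1 1 * z 0 0) * u 0 0.
  rewrite uE0 uE1 -[LHS]mulr1 -dm; ring.
rewrite /model_form scale_vec2; apply: row2P; rewrite ?vec20 ?vec21.
  transitivity (z 0 1 * root_vec i z 0 0); first by rewrite /root_vec vec20 mulrC divfK.
  by rewrite X; field.
transitivity (root_vec i z 0 1 - z 0 0 * root_vec i z 0 0); first by rewrite /root_vec vec20 vec21 addrK.
by rewrite Y; field.
Qed.

Section InChart.
Variable M : 'M[K]_2.
Hypothesis detM : \det M = 1.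
Let m := invmx M.
Let b1 := dehomog (change M w.1).
Let b2 := dehomog (change M w.2).

Definition chart_scale i (z : 'rV[K]_2) := (root_vec i z *m m) 0 0.
Definition chart_pos i (z : 'rV[K]_2) := (root_vec i z *m m) 0 1 / chart_scale i z.
(** The points at which no zero is at infinity in the chart. *)
Definition chart_domain := [set z | U z /\ forall i, chart_scale i z != 0].

Lemma unitM : M \in unitmx.
Proof. by rewrite unitmxE unitfE detM oner_eq0. Qed.

Lemma root_vec_chart i z : chart_domain z ->
  root_vec i z = (chart_scale i z *: vec2 1 (chart_pos i z)) *m M.
Proof.
move=> [Uz xz]; rewrite -[LHS](mulmxKV unitM); congr (_ *m _).
by rewrite scale_vec2 /chart_pos mulr1 [_ * (_ / _)]mulrC divfK // -vec2_eta.
Qed.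

Lemma chart_coord_differentiable i k z : U z -> differentiable (fun z => (root_vec i z *m m) 0 k) z.
Proof.
move=> Uz.
have -> : (fun z => (root_vec i z *m m) 0 k) =
   (fun z => root_vec i z 0 0 * m 0 k + root_vec i z 0 1 * m 1 k).
  by apply/funext => t; rewrite mul_row2.
have j l := jet_diff (root_vec_differentiable i l Uz).
by case: (jetD (jetM (j 0) (jet_cst (m 0 k) z)) (jetM (j 1) (jet_cst (m 1 k) z))).
Qed.

Lemma chart_domain_open : open chart_domain.
Proof.
have [oU _ _ _ _] := LF.
rewrite openE => z [Uz xz]; rewrite /interior.
have N i : \forall t \near z, chart_scale i t != 0.
  have c := differentiable_continuous (chart_coord_differentiable i 0 Uz).
  exact: (cvgr_neq0 _ c (xz i)).
have NU : \forall t \near z, U t by exact: open_nbhs_nbhs.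
have NA : \forall t \near z, forall i, chart_scale i t != 0.
  exact: (@filter_forall _ _ (fun i t => chart_scale i t != 0) (nbhs z) (nbhs_filter z) N).
by apply: filterS (filterI NU NA) => t [].
Qed.

Lemma chart_pos_inj z : chart_domain z -> injective (fun i => chart_pos i z).
Proof.
move=> Dz i j E; apply/eqP; apply: contraT => ij; have [_ _ _ aw _] := LF.
have Uz := Dz.1; have := aw i j z Uz ij; have q0 := foliations_q_neq0 Uz.
rewrite -(mulIr_eq0 _ (mulIf (invr_neq0 q0))) -wedge_root_vec // !root_vec_chart // E.
by rewrite wedge_mul wedgeZl wedgeZr wedgexx !mulr0 eqxx.
Qed.

Lemma chart_root_vec_factor z : chart_domain z -> exists2 c, c != 0 & forall v,
  ev w.1 v + z 0 0 * ev w.2 v =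
    c * \prod_i wedge ((chart_scale i z *: vec2 1 (chart_pos i z)) *m M) v.
Proof.
move=> Dz; have [c c0 E] := root_vec_factor Dz.1; exists c => // v; rewrite E.
by congr (_ * _); apply: eq_bigr => i _; rewrite root_vec_chart.
Qed.

Definition chart_slope i (z : 'rV[K]_2) := chart_velocity b1 b2 (z 0 0) (chart_pos i z).

Lemma chart_pos_equation z i : chart_domain z ->
  b1.[chart_pos i z] + z 0 0 * b2.[chart_pos i z] = 0 /\
  b1^`().[chart_pos i z] + z 0 0 * b2^`().[chart_pos i z] != 0.
Proof.
move=> Dz; have [c c0 E] := chart_root_vec_factor Dz.
have inj := chart_pos_inj Dz; have x0 j : chart_scale j z != 0 by case: Dz.
split; first exact: (chart_root detM E i).
exact: (chart_simple detM c0 x0 inj E i).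
Qed.

Lemma chart_pos_jet z i : chart_domain z -> jet (chart_pos i) z (chart_slope i z) 0.
Proof.
move=> Dz; have Uz := Dz.1.
apply: (implicit_root_jet chart_domain_open Dz).
- have j0 := jet_diff (chart_coord_differentiable i 0 Uz).
  have j1 := jet_diff (chart_coord_differentiable i 1 Uz).
  by case: (jetM j1 (jetV j0 (Dz.2 i))).
- by move=> t Dt; case: (chart_pos_equation i Dt).
- by case: (chart_pos_equation i Dz).
Qed.

Lemma chart_slope_basic z i : chart_domain z -> basic (chart_slope i) z.
Proof.
move=> Dz; have [_ nz] := chart_pos_equation i Dz.
have bt : basic (chart_pos i) z by exists (chart_slope i z); exact: chart_pos_jet.
apply: basicM; first by apply: basicN; exact: basic_horner.
apply: basicV nz; apply: basicD; first exact: basic_horner.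
by apply: basicM; [exact: basic_coord | exact: basic_horner].
Qed.

Definition chart_form r s e (z : 'rV[K]_2) :=
  interp (chart_pos r z) (chart_pos s z) (chart_pos e z)
    (chart_slope r z) (chart_slope s z) (chart_slope e z)
    (m 0 0 + m 1 0 * z 0 0) (m 0 1 + m 1 1 * z 0 0).

(** Sum of [local_curvature] over the triples. *)
Lemma curvature_in_chart (eta : 'I_d -> 'I_d -> 'I_d -> form1 K) z :
  (forall r s t : 'I_d, (r < s < t)%N -> is_eta U (a r) (a s) (a t) (eta r s t)) ->
  chart_domain z ->
  ext_deriv (fun x => \sum_(r < d) \sum_(s < d | (r < s)%N) \sum_(t < d | (s < t)%N) eta r s t x) z =
  - 'D_('e_0) (fun x => \sum_(r < d) \sum_(s < d | (r < s)%N) \sum_(t < d | (s < t)%N)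
                  chart_form r s t x) z / z 0 1.
Proof.
move=> etaP Dz.
have dm : m 0 0 * m 1 1 - m 0 1 * m 1 0 = 1 by rewrite -det_2 /m det_inv detM invr1.
have lt_ne (i j : 'I_d) : (i < j)%N -> i != j by move=> ij; apply: contraTneq ij => ->; rewrite ltnn.
have inj t i j : chart_domain t -> i != j -> chart_pos i t != chart_pos j t.
  by move=> Dt; apply: contra => /eqP /(chart_pos_inj Dt) ->.
have eqD t : chart_domain t -> t 0 1 != 0 by move=> Dt; exact: foliations_q_neq0 Dt.1.
have je i t : chart_domain t -> jet (chart_pos i) t (chart_slope i t) 0 by move=> Dt; exact: chart_pos_jet.
have be i t : chart_domain t -> basic (chart_slope i) t by move=> Dt; exact: chart_slope_basic.
have one (r s e : 'I_d) : (r < s < e)%N ->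
  ext_deriv (eta r s e) z = - 'D_('e_0) (chart_form r s e) z / z 0 1 /\
  basic (chart_form r s e) z.
  move=> /andP[rs se]; have rse := ltn_trans rs se.
  have n12 t : chart_domain t -> chart_pos r t != chart_pos s t by move=> Dt; exact: inj Dt (lt_ne _ _ rs).
  have n13 t : chart_domain t -> chart_pos r t != chart_pos e t by move=> Dt; exact: inj Dt (lt_ne _ _ rse).
  have n23 t : chart_domain t -> chart_pos s t != chart_pos e t by move=> Dt; exact: inj Dt (lt_ne _ _ se).
  have mo i t : chart_domain t -> a i t = model_form (m 0 0) (m 1 0) (m 0 1) (m 1 1) (chart_scale i t)
    (chart_pos i t) t.
    by move=> Dt; apply: root_vec_model => //; [exact: Dt.1 | exact: Dt.2].
  have df i t : chart_domain t -> differentiable (chart_scale i) t.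
    by move=> Dt; exact: chart_coord_differentiable Dt.1.
  have nf i t : chart_domain t -> chart_scale i t != 0 by case.
  split; last first.
    exact: (@basic_interp_line K chart_domain (m 0 0) (m 1 0) (m 0 1) (m 1 1) _ _ _ _ _ _ (je r) (je s)
      (je e) (be r) (be s) (be e) n12 n13 n23 z Dz).
  apply: (@local_curvature K chart_domain (m 0 0) (m 1 0) (m 0 1) (m 1 1) chart_domain_open dm eqD _ _
    _ _ _ _ (je r) (je s) (je e) (be r) (be s) (be e)
    n12 n13 n23 _ _ _ _ _ _ (mo r) (mo s) (mo e) (df r) (df s) (df e) (nf r) (nf s) (nf e) (eta r s e)
      sym _ z Dz).
  have rse' : (r < s < e)%N by rewrite rs.
  have [h0 h1 h2 h3] := etaP r s e rse'.
  by split=> t Dt; [apply: h0 | apply: h1 | apply: h2 | apply: h3]; case: Dt.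
have de (r s e : 'I_d) : (r < s < e)%N -> differentiable (eta r s e) z.
  by move=> rse; have [h _ _ _] := etaP r s e rse; apply: h; case: Dz.
have d3 (r s : 'I_d) : (r < s)%N -> ext_deriv (fun x => \sum_(t < d | (s < t)%N) eta r s t x) z =
    \sum_(t < d | (s < t)%N) ext_deriv (eta r s t) z /\
    differentiable (fun x => \sum_(t < d | (s < t)%N) eta r s t x) z.
  by move=> rs; apply: ext_deriv_sum => t st; apply: de; rewrite rs.
have d2 (r : 'I_d) : ext_deriv (fun x => \sum_(s < d | (r < s)%N) \sum_(t < d | (s < t)%N) eta r s t x) z =
    \sum_(s < d | (r < s)%N) ext_deriv (fun x => \sum_(t < d | (s < t)%N) eta r s t x) z /\
    differentiable (fun x => \sum_(s < d | (r < s)%N) \sum_(t < d | (s < t)%N) eta r s t x) z.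
  by apply: ext_deriv_sum => s rs; case: (d3 r s rs).
have [-> _] := ext_deriv_sum (index_enum _) (fun r (_ : true) => (d2 r).2).
have [_ -> _] := jet_sum (index_enum _) (fun (r : 'I_d) (_ : true) => jet_sum (index_enum _)
  (fun (s : 'I_d) (rs : (r < s)%N) => jet_sum (index_enum _)
   (fun (e : 'I_d) (se : (s < e)%N) => basic_jet (one r s e (introT andP (conj rs se))).2))).
rewrite mulNr mulr_suml -sumrN; apply: eq_bigr => r _.
rewrite (d2 r).1 mulr_suml -sumrN; apply: eq_bigr => s rs.
rewrite (d3 r s rs).1 mulr_suml -sumrN; apply: eq_bigr => e se.
by rewrite (one r s e _).1 ?mulNr // rs.
Qed.

Lemma chart_form_sum z c : chart_domain z -> c != 0 ->
  (forall v, ev w.1 v + z 0 0 * ev w.2 v = c * \prod_i wedge (root_vec i z) v) ->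
  total_form (ev w.2) (fun i => root_vec i z) c (vec2 1 (z 0 0)) =
  (\sum_(r < d) \sum_(s < d | (r < s)%N) \sum_(t < d | (s < t)%N) chart_form r s t z) *+ 2.
Proof.
move=> Dz c0 FE; have x0 j : chart_scale j z != 0 by case: Dz.
have RE : (fun i => root_vec i z) = (fun i => (chart_scale i z *: vec2 1 (chart_pos i z)) *m M).
  by apply/funext => i; exact: root_vec_chart.
rewrite RE -[vec2 1 (z 0 0)](mulmxKV unitM).
rewrite (@total_form_chart K d w.1 w.2 M (z 0 0) c (fun i => chart_scale i z) (fun i => chart_pos i z)) //.
- by rewrite !mul_row2 !vec20 !vec21 !mul1r ![z 0 0 * _]mulrC.
- exact: ltnW.
- exact: chart_pos_inj.
- by move=> v; rewrite FE; congr (_ * _); apply: eq_bigr => i _; rewrite root_vec_chart.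
Qed.

End InChart.

End Flatness.

(** * Local branches of the n-th root *)

Section RootBranch.
Variables (K : numClosedFieldType) (n : nat).
Hypothesis n0 : (0 < n)%N.

(** The product of the distances from y to the n roots of X ^ n - s is |y ^ n - s|,
    so that not all of them can be large. *)
Lemma near_root (y s : K) : exists2 x, x ^+ n = s & `|y - x| ^+ n <= `|y ^+ n - s|.
Proof.
have [r Dp] := closed_field_poly_normal ('X^n - s%:P : {poly K}).
rewrite (monicP _) ?monicXnsubC // scale1r in Dp.
have rs x : x \in r -> x ^+ n = s.
  rewrite -root_prod_XsubC -Dp rootE !hornerE => /eqP/subr0_eq //.
have sz : size r = n by apply: succn_inj; rewrite -(size_prod_XsubC r id) -Dp size_XnsubC.
apply: contrapT => none.
have lt x : x \in r -> `|y ^+ n - s| < `|y - x| ^+ n.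
  move=> xr; rewrite real_ltNge ?normr_real ?rpredX ?normr_real //; apply/negP => le.
  by apply: none; exists x => //; exact: rs.
have yE : `|y ^+ n - s| = \prod_(x <- r) `|y - x|.
  have := congr1 (fun p : {poly K} => `|p.[y]|) Dp; rewrite /= horner_prod !hornerE normr_prod => ->.
  by apply: eq_bigr => x _; rewrite hornerXsubC.
have : `|y ^+ n - s| ^+ n < \prod_(x <- r) `|y - x| ^+ n.
  have -> : `|y ^+ n - s| ^+ n = \prod_(x <- r) `|y ^+ n - s|.
    by rewrite big_const_seq count_predT iter_mulr_1 sz.
  rewrite [X in X < _]big_seq [X in _ < X]big_seq; apply: ltr_prod.
    by case: (r) sz n0 => [<-|x r' _ _] //=; rewrite mem_head.
  by move=> x xr; rewrite normr_ge0 lt.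
by rewrite prodrXl -yE ltxx.
Qed.

Definition divided_power (z : 'rV[K]_2) := \sum_(i < n) z 0 0 ^+ (n.-1 - i) * z 0 1 ^+ i.

Lemma divided_powerE x y : x ^+ n - y ^+ n = (x - y) * divided_power (vec2 x y).
Proof. by rewrite subrXX /divided_power vec20 vec21. Qed.

Lemma divided_power_continuous : continuous divided_power.
Proof.
move=> z; apply: differentiable_continuous.
have jX k l : jet (fun t : 'rV[K]_2 => t 0 k ^+ l) z
    (('X^l : {poly K})^`().[z 0 k] * (k == 0)%:R) (('X^l : {poly K})^`().[z 0 k] * (k == 1)%:R).
  have -> : (fun t : 'rV[K]_2 => t 0 k ^+ l) = (fun t => ('X^l : {poly K}).[t 0 k]).
    by apply/funext => t; rewrite hornerXn.
  exact: (jet_horner _ (jet_coord k z)).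
by case: (jet_sum (index_enum _) (fun (i : 'I_n) (_ : true) => jetM (jX 0 (n.-1 - i)%N) (jX 1 i))).
Qed.

Lemma near_vec2 (P : 'rV[K]_2 -> Prop) (x : K) : (\forall z \near vec2 x x, P z) ->
  exists2 e, 0 < e & forall y y', `|x - y| <= e -> `|x - y'| <= e -> P (vec2 y y').
Proof.
move=> /nbhs_normP [e /= e0 H]; exists (e / 2%:R); first by rewrite divr_gt0 ?ltr0n.
move=> y y' ye y'e; apply: H => /=; apply: (@le_lt_trans _ _ (e / 2%:R)).
  apply: row_norm_le; first by rewrite divr_ge0 ?ler0n // ltW.
    by rewrite !mxE.
  by rewrite !mxE.
by rewrite ltr_pdivrMr ?ltr0n // ltr_pMr // ltr1n.
Qed.

(** The root of s nearest to a fixed root of s0, in the sense of [near_root]. Close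
    to that root the divided difference of the n-th power does not vanish, which
    gives uniqueness of the root, hence continuity, and then the derivative. *)
Lemma root_branch (s0 : K) : s0 != 0 -> exists r : K -> K, exists2 e, 0 < e &
  forall s, `|s0 - s| < e -> [/\ r s ^+ n = s, r s != 0 & derivable r s 1].
Proof.
move=> s00; have [r0 r0E _] := near_root 0 s0.
have r00 : r0 != 0 by apply: contraNneq s00 => z; rewrite -r0E z expr0n gtn_eqF.
have nzr x : x != 0 -> divided_power (vec2 x x) != 0.
  move=> x0; rewrite /divided_power vec20 vec21.
  have E (i : 'I_n) (_ : true) : x ^+ (n.-1 - i) * x ^+ i = x ^+ n.-1.
    by rewrite -exprD subnK // -ltnS prednK.
  by rewrite (eq_bigr _ E) sumr_const card_ord -mulr_natr mulf_neq0 ?expf_neq0 // pnatr_eq0 -lt0n.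
have N1 : nbhs (vec2 r0 r0) (fun z => divided_power z != 0).
  exact: (cvgr_neq0 _ (@divided_power_continuous (vec2 r0 r0)) (nzr _ r00)).
have N2 : nbhs (vec2 r0 r0) (fun z : 'rV[K]_2 => z 0 0 != 0).
  apply: (cvgr_neq0 _ (differentiable_continuous (differentiable_coord (vec2 r0 r0) 0 0))).
  by rewrite vec20.
have [e e0 eP'] := near_vec2 (filterI N1 N2).
have eP y y' : `|r0 - y| <= e -> `|r0 - y'| <= e -> divided_power (vec2 y y') != 0.
  by move=> ye y'e; case: (eP' y y' ye y'e).
(* Near r0 a number has at most one n-th root. *)
have uniq x y : `|r0 - x| <= e -> `|r0 - y| <= e -> x ^+ n = y ^+ n -> x = y.
  move=> xe ye /eqP; rewrite -subr_eq0 divided_powerE mulf_eq0 (negPf (eP _ _ xe ye)) orbF subr_eq0.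
  by move/eqP.
have en : 0 < e ^+ n by rewrite exprn_gt0.
have lt_root (x y c : K) : 0 < c -> `|x - y| ^+ n < c ^+ n -> `|x - y| < c.
  by move=> c0; rewrite ltr_pXn2r ?nnegrE ?normr_ge0 // ltW.
have ch s : exists x, x ^+ n = s /\ `|r0 - x| ^+ n <= `|s0 - s|.
  by have [x xs xr] := near_root r0 s; exists x; rewrite -r0E.
have [r rP] := choice ch.
have re s : `|s0 - s| < e ^+ n -> `|r0 - r s| < e.
  by move=> se; apply: lt_root => //; apply: le_lt_trans se; case: (rP s).
exists r, (e ^+ n) => // s se; have [rs _] := rP s; split=> //.
  have rse := ltW (re s se); by case: (eP' _ _ rse rse); rewrite vec20.
have rse := re s se.
(* Continuity at s: [near_root] gives a root of t close to r s, and by uniqueness it is r t. *)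
have e10 : 0 < e - `|r0 - r s| by rewrite subr_gt0.
have close (c t : K) : 0 < c -> c <= e - `|r0 - r s| -> `|s0 - t| < e ^+ n ->
    `|s - t| < c ^+ n -> `|r s - r t| < c.
  move=> c0 ce te st; have [x xt xr] := near_root (r s) t.
  have xc : `|r s - x| < c by apply: lt_root => //; apply: le_lt_trans xr _; rewrite rs.
  have xe : `|r0 - x| < e.
    apply: le_lt_trans (ler_distD (r s) _ _) _.
    by rewrite -ltrBrDl; apply: lt_le_trans xc ce.
  have -> : r t = x by apply: uniq; rewrite ?xt; [exact: ltW (re t te) | exact: ltW | case: (rP t)].
  exact: xc.
have se0 : 0 < e ^+ n - `|s0 - s| by rewrite subr_gt0.
have cvr : r (h *: 1 + s) @[h --> 0^'] --> r s.
  apply/cvgrPdist_lt => c c0.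
  have cle : exists2 c', 0 < c' & c' <= e - `|r0 - r s| /\ c' <= c.
    have [le|le] := real_leP (gtr0_real c0) (gtr0_real e10).
      by exists c => //; split.
    by exists (e - `|r0 - r s|) => //; split=> //; exact: ltW.
  have [c' c'0 [c'e c'c]] := cle.
  have c'n : 0 < c' ^+ n by rewrite exprn_gt0.
  near=> h; apply: lt_le_trans c'c; apply: close => //.
    apply: le_lt_trans (ler_distD s _ _) _; rewrite -ltrBrDl.
    rewrite opprD addrCA subrr addr0 normrN [h *: 1]mulr1; near: h; exact: dnbhs0_lt.
  rewrite opprD addrCA subrr addr0 normrN [h *: 1]mulr1; near: h; exact: dnbhs0_lt.
(* The difference quotient of r is the inverse of the divided power. *)
have cv2 : (fun h : K => vec2 (r (h *: 1 + s)) (r s)) h @[h --> 0^'] --> (vec2 (r s) (r s) : 'rV[K]_2).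
  apply/cvgrPdist_lt => c c0; near=> h.
  apply: (@le_lt_trans _ _ `|r s - r (h *: 1 + s)|).
    by apply: row_norm_le; rewrite ?normr_ge0 // !mxE /= ?subrr ?normr0.
  by near: h; move/cvgrPdist_lt: cvr; apply.
have cvv : divided_power (vec2 (r (h *: 1 + s)) (r s)) @[h --> 0^'] --> divided_power (vec2 (r s) (r s)).
  exact: (cvg_comp _ _ cv2 (@divided_power_continuous (vec2 (r s) (r s)))).
have rsle := ltW rse.
apply/cvg_ex; exists (divided_power (vec2 (r s) (r s)))^-1 => /=.
apply: cvg_trans (cvgV (eP _ _ rsle rsle) cvv).
apply: near_eq_cvg; near=> h.
have h0 : h != 0 by near: h; exact: nbhs_dnbhs_neq.
have te : `|s0 - (h *: 1 + s)| < e ^+ n.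
  apply: le_lt_trans (ler_distD s _ _) _; rewrite -ltrBrDl.
  rewrite opprD addrCA subrr addr0 normrN [h *: 1]mulr1; near: h; exact: dnbhs0_lt.
have D0 := eP _ _ (ltW (re _ te)) rsle.
apply: (mulfI h0); rewrite /GRing.scale /= mulrA mulfV // mul1r; apply: (mulIf D0).
rewrite mulfVK // -divided_powerE rs; case: (rP (h *: 1 + s)) => -> _.
by rewrite [h *: 1]mulr1 addrK.
Unshelve. all: by end_near. Qed.
End RootBranch.

(** * Flatness for noncyclic groups and in Fermat charts *)

Section FlatNonCyclic.
Variables (K : numClosedFieldType) (d : nat) (w : pform K).
Hypothesis sym : symmetric_derivatives K.
Hypothesis d1 : (1 < d)%N.
Hypothesis hA : w.1 \is ishomog1 d mdeg.
Hypothesis hB : w.2 \is ishomog1 d mdeg.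
Hypothesis nz : no_common_zero w.1 w.2.

(** These matrices bring finitely many zeros to finite distance while keeping
    determinant 1. *)
Definition shear (s : K) : 'M[K]_2 :=
  \matrix_(i, j) (if j == 0 then (if i == 0 then 1 else s) else (i == j)%:R).

Lemma det_shear s : \det (shear s) = 1.
Proof. by rewrite det_2 !mxE /= !mul1r mul0r subr0. Qed.

(** In a chart where all zeros are at finite distance near z, the curvature is the
    derivative of the total form at (1, p), and the total form vanishes for every p. *)
Lemma flat_noncyclic : ~ Gal_cyclic w -> flat_web d (Leg w).
Proof.
move=> ncyc U a eta LF etaP z Uz.
have P0 i : (root_vec a i z 0 1 != 0) || (root_vec a i z 0 0 != 0).
  have [j ij] := exists_neq d1 i; rewrite orbC -row2_neq0.
  have [_ _ _ aw _] := LF; have := aw i j z Uz ij; have q0 := foliations_q_neq0 d1 hA hB LF Uz.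
  apply: contraNneq => P0; apply/eqP/(mulIf (invr_neq0 q0)); rewrite mul0r.
  by rewrite -(wedge_root_vec d1 hA hB LF i j Uz) P0 /wedge !mxE !mul0r subrr.
have [s sP] := avoid_roots P0.
pose M := invmx (shear s).
have detM : \det M = 1 by rewrite /M det_inv det_shear invr1.
have Dz : chart_domain U a M z.
  split=> // i; rewrite /chart_scale /M invmxK mul_row2.
  have [-> ->] : shear s 0 0 = 1 /\ shear s 1 0 = s by rewrite !mxE.
  by rewrite mulr1 addrC; exact: sP.
rewrite (curvature_in_chart sym d1 hA hB LF detM etaP Dz).
have oD : open (chart_domain U a M) by exact: (chart_domain_open d1 hA hB LF).
rewrite (derive_eq_on_open (g := fun=> 0) _ oD Dz).
  by rewrite derive_cst oppr0 mul0r.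
move=> t Dt; have Ut := Dt.1.
have [c c0 FE] := root_vec_factor d1 hA hB LF Ut.
have := chart_form_sum d1 hA hB LF detM Dt c0 FE.
rewrite (total_form_noncyclic d1 hA hB nz c0 FE _ ncyc).
  by move/esym/eqP; rewrite mulrn_eq0 /= => /eqP.
move=> i j ij; rewrite (wedge_root_vec d1 hA hB LF i j Ut).
have [_ _ _ aw _] := LF; rewrite mulf_neq0 ?aw // invr_eq0.
exact: (foliations_q_neq0 d1 hA hB LF Ut).
Qed.

End FlatNonCyclic.

Section FermatChart.
Variables (K : numClosedFieldType) (d : nat) (w : pform K).
Hypothesis d1 : (1 < d)%N.
Hypothesis hA : w.1 \is ishomog1 d mdeg.
Hypothesis hB : w.2 \is ishomog1 d mdeg.
Variables (M : 'M[K]_2) (al0 al1 be0 be1 : K).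
Hypothesis detM : \det M = 1.
Hypothesis AE : forall x y, ev w.1 (vec2 x y *m M) = al0 * x ^+ d + al1 * y ^+ d.
Hypothesis BE : forall x y, ev w.2 (vec2 x y *m M) = be0 * x ^+ d + be1 * y ^+ d.
Let m := invmx M.
Let l0 p := al0 + p * be0.
Let l1 p := al1 + p * be1.
Let nn0 p := m 0 0 + m 1 0 * p.
Let nn1 p := m 0 1 + m 1 1 * p.

(** When A and B are combinations of x ^ d and y ^ d in a chart, the zeros of A + p
    B are the roots t of l0 + l1 t ^ d, and they all have this same logarithmic
    derivative with respect to p. *)
Definition fermat_slope (p : K) := (be0 * al1 - be1 * al0) / (d%:R * (l0 p * l1 p)).

Lemma fermat_form p x y : ev w.1 (vec2 x y *m M) + p * ev w.2 (vec2 x y *m M) =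
  l0 p * x ^+ d + l1 p * y ^+ d.
Proof. by rewrite AE BE /l0 /l1; ring. Qed.

Lemma fermat_dehomog1 : dehomog (change M w.1) = al0%:P + al1 *: 'X^d.
Proof. by apply: poly_ext => t; rewrite dehomogE ev_change AE !hornerE expr1n mulr1. Qed.
Lemma fermat_dehomog2 : dehomog (change M w.2) = be0%:P + be1 *: 'X^d.
Proof. by apply: poly_ext => t; rewrite dehomogE ev_change BE !hornerE expr1n mulr1. Qed.

Lemma fermat_velocity p t : l0 p != 0 -> l1 p != 0 -> l0 p + l1 p * t ^+ d = 0 ->
  chart_velocity (dehomog (change M w.1)) (dehomog (change M w.2)) p t = fermat_slope p * t.
Proof.
move=> h0 h1 E; rewrite /chart_velocity fermat_dehomog1 fermat_dehomog2.
have der (x y : K) : (x%:P + y *: 'X^d)^`().[t] = y * (d%:R * t ^+ d.-1).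
  by rewrite derivD derivC add0r derivZ derivXn hornerZ hornerMn hornerXn mulr_natl.
rewrite !der hornerD hornerC hornerZ hornerXn.
have t0 : t != 0.
  by apply: contraNneq h0 => t0; move: E; rewrite t0 expr0n gtn_eqF ?(ltnW d1) // mulr0 addr0 => ->.
have d0 : d%:R != 0 :> K by rewrite pnatr_eq0 -lt0n ltnW.
have tE : t ^+ d = t ^+ d.-1 * t by rewrite -exprSr prednK // ltnW.
have T0 : t ^+ d.-1 != 0 by rewrite expf_neq0.
rewrite tE in E *; set T := t ^+ d.-1 in E T0 *.
have ET : T * t = - l0 p / l1 p.
  by apply: (mulIf h1); rewrite divfK // mulrC; apply/eqP; rewrite -subr_eq0 opprK addrC E.
have -> : al1 * (d%:R * T) + p * (be1 * (d%:R * T)) = d%:R * T * l1 p by rewrite /l1; ring.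
rewrite ET /fermat_slope.
apply: (mulIf (mulf_neq0 (mulf_neq0 d0 T0) h1)); rewrite divfK ?mulf_neq0 //.
transitivity ((be0 * al1 - be1 * al0) / (l0 p * l1 p) * (T * t) * l1 p); last by field; rewrite h0 h1 d0.
rewrite ET; move: h0 h1; rewrite /l0 /l1 => h0 h1; field; by rewrite h0 h1.
Qed.

Lemma interp_linear (t1 t2 t3 k x y : K) : t1 != t2 -> t1 != t3 -> t2 != t3 ->
  interp t1 t2 t3 (k * t1) (k * t2) (k * t3) x y = k * (x * y).
Proof.
move=> h12 h13 h23; rewrite /interp /interp0 /interp1 /interp2; field.
by rewrite !subr_eq0 ![t3 == _]eq_sym ![t2 == t1]eq_sym h12 h13 h23.
Qed.

Variables (U : set 'rV[K]_2) (a : 'I_d -> form1 K).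
Hypothesis LF : local_foliations (Leg w) U a.

(** The zeros of l0 x ^ d + l1 y ^ d are distinct only if l0 and l1 are nonzero, and
    then none of them is on a coordinate axis. *)
Lemma fermat_chart_domain z : U z -> [/\ chart_domain U a M z, l0 (z 0 0) != 0 & l1 (z 0 0) != 0].
Proof.
move=> Uz; have [c c0 FE] := root_vec_factor d1 hA hB LF Uz.
have uM : M \in unitmx by rewrite unitmxE unitfE detM oner_eq0.
pose P i := root_vec a i z *m m.
have PE i : root_vec a i z = P i *m M by rewrite /P mulmxKV.
have Pw i j : i != j -> wedge (P i) (P j) != 0.
  move=> ij; have [_ _ _ aw _] := LF; have := aw i j z Uz ij.
  have q0 := foliations_q_neq0 d1 hA hB LF Uz.
  apply: contraNneq => W; apply/eqP/(mulIf (invr_neq0 q0)); rewrite mul0r.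
  by rewrite -(wedge_root_vec d1 hA hB LF i j Uz) !PE wedge_mul W mulr0.
have FE' x y : l0 (z 0 0) * x ^+ d + l1 (z 0 0) * y ^+ d = c * \prod_i wedge (P i) (vec2 x y).
  rewrite -fermat_form FE; congr (_ * _); apply: eq_bigr => i _.
  by rewrite PE wedge_mul detM mul1r.
have PF i : l0 (z 0 0) * P i 0 0 ^+ d + l1 (z 0 0) * P i 0 1 ^+ d = 0.
  by rewrite FE' (bigD1 i) //= -vec2_eta wedgexx mul0r mulr0.
have dn : (0 < d)%N := ltnW d1.
have two : exists i j : 'I_d, i != j by exists (Ordinal dn); apply: exists_neq.
have [i0 [j0 ij0]] := two.
(* Otherwise the d zeros coincide. *)
have L1 : l1 (z 0 0) != 0.
  apply/eqP => L1.
  have L0 : l0 (z 0 0) != 0.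
    apply/eqP => L0.
    have [|s sE] := @avoid_roots K d (fun i => P i 0 0) (fun i => - P i 0 1).
      move=> i; rewrite oppr_eq0 -row2_neq0; have [j ij] := exists_neq d1 i.
      by apply: contraNneq (Pw i j ij) => ->; rewrite /wedge !mxE !mul0r subrr.
    have /eqP := FE' 1 s; rewrite L0 L1 !mul0r addr0 eq_sym mulf_eq0 (negPf c0) => /prodf_eq0 [i _].
    by rewrite /wedge vec20 vec21 mulr1 (negPf (sE i)).
  have x0 i : P i 0 0 = 0.
    have /eqP := PF i; rewrite L1 mul0r addr0 mulf_eq0 (negPf L0) expf_eq0 dn => /eqP //.
  by have := Pw i0 j0 ij0; rewrite /wedge !x0 mul0r mulr0 subrr eqxx.
have L0 : l0 (z 0 0) != 0.
  apply/eqP => L0.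
  have y0 i : P i 0 1 = 0.
    have /eqP := PF i; rewrite L0 mul0r add0r mulf_eq0 (negPf L1) expf_eq0 dn => /eqP //.
  by have := Pw i0 j0 ij0; rewrite /wedge !y0 mul0r mulr0 subrr eqxx.
split=> //; split=> // i; rewrite /chart_scale -/m -/(P i); apply/eqP => x0.
have [j ij] := exists_neq d1 i.
have y0 : P i 0 1 = 0.
  have /eqP := PF i; rewrite x0 expr0n gtn_eqF // mulr0 add0r mulf_eq0 (negPf L1) expf_eq0 dn => /eqP //.
by have := Pw i j ij; rewrite /wedge x0 y0 !mul0r subrr eqxx.
Qed.

(** Velocities proportional to the roots are interpolated by a multiple of x y. *)
Lemma fermat_chart_form z (r s e : 'I_d) : U z -> (r < s)%N -> (s < e)%N ->
  chart_form w a M r s e z = fermat_slope (z 0 0) * (nn0 (z 0 0) * nn1 (z 0 0)).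
Proof.
move=> Uz rs se; have [Dz L0 L1] := fermat_chart_domain Uz.
have inj := chart_pos_inj d1 hA hB LF detM Dz.
have ne (i j : 'I_d) : (i < j)%N -> chart_pos a M i z != chart_pos a M j z.
  by move=> ij; apply/eqP => /inj E; rewrite E ltnn in ij.
have W i : chart_slope w a M i z = fermat_slope (z 0 0) * chart_pos a M i z.
  apply: fermat_velocity => //.
  have [E _] := chart_pos_equation d1 hA hB LF detM i Dz; move: E.
  rewrite fermat_dehomog1 fermat_dehomog2 !hornerE /l0 /l1 => E; rewrite -[RHS]E; ring.
by rewrite /chart_form !W interp_linear ?ne // (ltn_trans rs se).
Qed.

Definition triple_count := (\sum_(r < d) \sum_(s < d | (r < s)%N) \sum_(t < d | (s < t)%N) 1 : K).

(** All triples contribute equally, which leaves their number as a factor. *)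
Lemma fermat_curvature (eta : 'I_d -> 'I_d -> 'I_d -> form1 K) z :
  symmetric_derivatives K ->
  (forall r s t : 'I_d, (r < s < t)%N -> is_eta U (a r) (a s) (a t) (eta r s t)) -> U z ->
  ext_deriv (fun x => \sum_(r < d) \sum_(s < d | (r < s)%N) \sum_(t < d | (s < t)%N) eta r s t x) z =
  - 'D_('e_0) (fun t : 'rV[K]_2 => triple_count * (fermat_slope (t 0 0) * (nn0 (t 0 0) * nn1 (t 0 0))))
    z / z 0 1.
Proof.
move=> sym etaP Uz; have [Dz _ _] := fermat_chart_domain Uz.
rewrite (curvature_in_chart sym d1 hA hB LF detM etaP Dz); congr (- _ / _).
have [oU _ _ _ _] := LF.
apply: (derive_eq_on_open _ oU Uz) => t Ut.
rewrite /triple_count mulr_suml; apply: eq_bigr => r _; rewrite mulr_suml; apply: eq_bigr => s rs.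
rewrite mulr_suml; apply: eq_bigr => e se; rewrite mul1r; exact: fermat_chart_form.
Qed.

(** When n0 n1 is a multiple of l0 l1, the function differentiated in
    [fermat_curvature] is constant. *)
Lemma fermat_flat (eta : 'I_d -> 'I_d -> 'I_d -> form1 K) z g :
  symmetric_derivatives K ->
  (forall p, nn0 p * nn1 p = g * (l0 p * l1 p)) ->
  (forall r s t : 'I_d, (r < s < t)%N -> is_eta U (a r) (a s) (a t) (eta r s t)) -> U z ->
  ext_deriv (fun x => \sum_(r < d) \sum_(s < d | (r < s)%N) \sum_(t < d | (s < t)%N) eta r s t x) z = 0.
Proof.
move=> sym H etaP Uz; rewrite (fermat_curvature sym etaP Uz).
have [oU _ _ _ _] := LF.
rewrite (derive_eq_on_open (g := fun=> triple_count * ((be0 * al1 - be1 * al0) / d%:R * g)) _ oU Uz).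
  by rewrite derive_cst oppr0 mul0r.
move=> t Ut; have [_ L0 L1] := fermat_chart_domain Ut; congr (_ * _).
have d0 : d%:R != 0 :> K by rewrite pnatr_eq0 -lt0n ltnW.
by rewrite H /fermat_slope; field; rewrite d0 L0 L1.
Qed.

End FermatChart.

(** * Flatness in a Fermat chart determines the chart *)

Section PolyLocal.
Variable K : numClosedFieldType.

Lemma poly_zero_ball (W : {poly K}) (p0 e : K) : 0 < e ->
  (forall p, `|p0 - p| < e -> W.[p] = 0) -> W = 0.
Proof.
move=> e0 H; apply/eqP; apply: contraT => W0.
pose x i := p0 + e / (i.+2)%:R.
have xz i : root W (x i).
  rewrite rootE H // /x opprD addrA subrr add0r normrN gtr0_norm ?divr_gt0 ?ltr0n //.
  by rewrite ltr_pdivrMr ?ltr0n // ltr_pMr // ltr1n.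
have := @max_poly_roots _ W [seq x i | i <- iota 0 (size W)] W0.
rewrite size_map size_iota ltnn => H2; apply: H2.
  by apply/allP => _ /mapP [i _ ->].
rewrite map_inj_uniq ?iota_uniq // => i j /addrI /(mulfI (lt0r_neq0 e0)) /invr_inj /eqP.
by rewrite eqr_nat => /eqP [].
Qed.

(** Subtract from N the multiple of L that agrees with it at a point t where L does
    not vanish. The difference still has zero Wronskian with L, and a zero of finite
    order at t is incompatible with that. *)
Lemma wronskian_eq0 (N L : {poly K}) : L != 0 -> N^`() * L = N * L^`() -> exists g, N = g *: L.
Proof.
move=> L0 W; have [t Lt] := closed_nonrootP _ L0; rewrite rootE in Lt.
exists (N.[t] / L.[t]); apply/eqP; rewrite -subr_eq0; apply: contraT => G0.
set G := N - _ in G0.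
have Gt : root G t by rewrite rootE /G hornerD hornerN hornerZ divfK // subrr.
have WG : G^`() * L = G * L^`().
  by rewrite /G derivB derivZ mulrBl mulrBl W -!scalerAl [L * _]mulrC.
have [m [q qt GE]] := multiplicity_XsubC G t.
rewrite G0 /= in qt.
case: m GE => [|m] GE; first by rewrite GE expr0 mulr1 rootE -rootE (negPf qt) in Gt.
have := WG; rewrite GE derivM deriv_exp derivXsubC mul1r /=.
rewrite -mulr_natr exprSr.
have XS : ('X - t%:P) ^+ m != 0 :> {poly K} by rewrite expf_neq0 ?polyXsubC_eq0.
move=> E; have {}E : (q^`() * ('X - t%:P) + q * m.+1%:R) * L = q * ('X - t%:P) * L^`().
  apply: (mulIf XS); move: E; move: ('X - t%:P) (q^`()) (L^`()) m.+1%:R => B q' L' n E.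
  transitivity ((q' * (B ^+ m * B) + q * (B ^+ m * n)) * L); first by ring.
  by rewrite E; ring.
have := congr1 (fun p : {poly K} => p.[t]) E; rewrite /= !hornerM hornerD !hornerM hornerXsubC subrr.
rewrite !mulr0 mul0r add0r -polyC_natr hornerC => /eqP.
by rewrite !mulf_eq0 (negPf Lt) orbF pnatr_eq0 orbF -rootE (negPf qt).
Qed.

End PolyLocal.

Section FermatWeb.
Variables (K : numClosedFieldType) (d : nat) (w : pform K).
Hypothesis sym : symmetric_derivatives K.
Hypothesis d2 : (2 < d)%N.
Hypothesis hA : w.1 \is ishomog1 d mdeg.
Hypothesis hB : w.2 \is ishomog1 d mdeg.
Variables (M : 'M[K]_2) (al0 al1 be0 be1 : K).
Hypothesis detM : \det M = 1.
Hypothesis AE : forall x y, ev w.1 (vec2 x y *m M) = al0 * x ^+ d + al1 * y ^+ d.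
Hypothesis BE : forall x y, ev w.2 (vec2 x y *m M) = be0 * x ^+ d + be1 * y ^+ d.
Hypothesis Delta : be0 * al1 - be1 * al0 != 0.
Let m := invmx M.
Let l0 p := al0 + p * be0.
Let l1 p := al1 + p * be1.

Let d1 : (1 < d)%N := ltnW d2.
Let d0 : (0 < d)%N := ltnW d1.

Lemma exists_base_point : exists p, l0 p != 0 /\ l1 p != 0.
Proof.
have [|s sE] := @avoid_roots K 2 (fun i => if i == 0 then be0 else be1) (fun i => if i == 0 then al0
  else al1).
  apply: ord2P => /=; rewrite -negb_and; apply: contra Delta => /andP[/eqP-> /eqP->].
    by rewrite mul0r mulr0 subrr.
  by rewrite mul0r mulr0 subrr.
by exists s; rewrite /l0 /l1 ![s * _]mulrC addrC [al1 + _]addrC; split; [exact: (sE 0) | exact: (sE 1)].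
Qed.

Lemma fermat_factor (zt : K) x y r : d.-primitive_root zt ->
  y ^+ d - (r * x) ^+ d = \prod_(i < d) (y - zt ^+ i * r * x).
Proof.
move=> zp; have [rx|rx0] := eqVneq (r * x) 0.
  rewrite rx expr0n gtn_eqF // subr0 -[in LHS](card_ord d) -prodr_const; apply: eq_bigr => i _.
  by rewrite -mulrA rx mulr0 subr0.
have := congr1 (fun p : {poly K} => p.[y / (r * x)]) (factor_Xn_sub_1 zp).
rewrite /= big_mkord horner_prod !hornerE => E.
transitivity ((r * x) ^+ d * ((y / (r * x)) ^+ d - 1)).
  have n0 : (r * x) ^+ d != 0 by rewrite expf_neq0.
  by rewrite expr_div_n; move: (y ^+ d) ((r * x) ^+ d) n0 => Y X n0; field.
rewrite -E -[X in _ ^+ X * _](card_ord d) -prodr_const -big_split /=; apply: eq_bigr => i _.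
rewrite hornerXsubC; transitivity (y - zt ^+ i * (r * x)); last by ring.
by move: (zt ^+ i) (r * x) rx0 => Z X n0; field.
Qed.

Section Branch.
Variables (p0 e zt : K) (r : K -> K).
Let s p := - l0 p / l1 p.
Hypothesis zp : d.-primitive_root zt.
Hypothesis e0 : 0 < e.
Hypothesis rP : forall x, `|s p0 - x| < e -> [/\ r x ^+ d = x, r x != 0 & derivable r x 1].
Hypothesis base : l0 p0 != 0 /\ l1 p0 != 0.

Definition branch_domain : set 'rV[K]_2 :=
  [set z | [/\ l0 (z 0 0) != 0, l1 (z 0 0) != 0, z 0 1 != 0 & `|s p0 - s (z 0 0)| < e]].
(** Flatness is a statement on all local presentations of the web, so one has to be
    exhibited: the d roots of l0 + l1 t ^ d near a base point, from a local branch r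
    of the d-th root. *)
Definition branch (i : 'I_d) (z : 'rV[K]_2) := zt ^+ i * r (s (z 0 0)).

Let jl0 z : jet (fun t : 'rV[K]_2 => l0 (t 0 0)) z be0 0.
Proof. by apply: jet_eq (jetD (jet_cst al0 z) (jetM (jet_coord 0 z) (jet_cst be0 z))) _ _; rewrite /=;
  ring. Qed.
Let jl1 z : jet (fun t : 'rV[K]_2 => l1 (t 0 0)) z be1 0.
Proof. by apply: jet_eq (jetD (jet_cst al1 z) (jetM (jet_coord 0 z) (jet_cst be1 z))) _ _; rewrite /=;
  ring. Qed.
Let ds z : branch_domain z -> differentiable (fun t : 'rV[K]_2 => s (t 0 0)) z.
Proof. by case=> _ h1 _ _; case: (jetM (jetN (jl0 z)) (jetV (jl1 z) h1)). Qed.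

Lemma branch_domain_open : open branch_domain.
Proof.
rewrite openE => z Dz; have [h0 h1 h2 h3] := Dz; rewrite /interior.
have n0 : nbhs z (fun t : 'rV[K]_2 => l0 (t 0 0) != 0).
  have [df _ _] := jl0 z; exact: (cvgr_neq0 _ (differentiable_continuous df) h0).
have n1 : nbhs z (fun t : 'rV[K]_2 => l1 (t 0 0) != 0).
  have [df _ _] := jl1 z; exact: (cvgr_neq0 _ (differentiable_continuous df) h1).
have n2 : nbhs z (fun t : 'rV[K]_2 => t 0 1 != 0).
  have [df _ _] := jet_coord 1 z; exact: (cvgr_neq0 _ (differentiable_continuous df) h2).
have n3 : nbhs z (fun t : 'rV[K]_2 => `|s p0 - s (t 0 0)| < e).
  have e' : 0 < e - `|s p0 - s (z 0 0)| by rewrite subr_gt0.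
  have /cvgrPdist_lt /(_ _ e') := differentiable_continuous (ds Dz).
  apply: filterS => t st; apply: le_lt_trans (ler_distD (s (z 0 0)) _ _) _.
  by rewrite -ltrBrDl.
by apply: filterS (filterI (filterI n0 n1) (filterI n2 n3)) => t [[? ?] [? ?]].
Qed.

Lemma branch_root z i : branch_domain z -> l0 (z 0 0) + l1 (z 0 0) * branch i z ^+ d = 0.
Proof.
move=> [_ h1 _ h3]; have [E _ _] := rP h3.
rewrite /branch exprMn E -exprM mulnC exprM (prim_expr_order zp) expr1n mul1r /s.
by rewrite mulrC divfK // subrr.
Qed.

Lemma branch_neq0 z i : branch_domain z -> branch i z != 0.
Proof.
move=> [_ _ _ h3]; have [_ h _] := rP h3; rewrite mulf_neq0 // expf_neq0 //.
apply/eqP => z0; have /eqP := prim_expr_order zp.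
by rewrite z0 expr0n gtn_eqF // eq_sym oner_eq0.
Qed.

Lemma branch_differentiable z i : branch_domain z -> differentiable (branch i) z.
Proof.
move=> Dz; have [_ _ _ h3] := Dz; have [_ _ dr] := rP h3.
apply: differentiableM; first exact: differentiable_cst.
apply: (@differentiable_comp _ _ _ _ (fun t : 'rV[K]_2 => s (t 0 0)) r); first exact: ds.
exact/derivable1_diffP.
Qed.

Lemma branch_jet z i : branch_domain z -> jet (branch i) z (fermat_slope d al0 al1 be0 be1 (z 0 0) *
  branch i z) 0.
Proof.
move=> Dz; have [h0 h1 _ _] := Dz.
have E := branch_root i Dz.
rewrite -(fermat_velocity d1 AE BE h0 h1 E).
apply: (implicit_root_jet branch_domain_open Dz (branch_differentiable i Dz)).
  move=> t Dt; rewrite (fermat_dehomog1 AE) (fermat_dehomog2 BE) !hornerE.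
  have := branch_root i Dt; rewrite /l0 /l1 => <-; ring.
rewrite (fermat_dehomog1 AE) (fermat_dehomog2 BE).
have der (x y t : K) : (x%:P + y *: 'X^d)^`().[t] = y * (d%:R * t ^+ d.-1).
  by rewrite derivD derivC add0r derivZ derivXn hornerZ hornerMn hornerXn mulr_natl.
rewrite !der.
have -> : al1 * (d%:R * branch i z ^+ d.-1) + z 0 0 * (be1 * (d%:R * branch i z ^+ d.-1)) =
  l1 (z 0 0) * (d%:R * branch i z ^+ d.-1) by rewrite /l1; ring.
by rewrite !mulf_neq0 ?expf_neq0 ?branch_neq0 // pnatr_eq0 -lt0n.
Qed.

Lemma branch_slope_basic z i : branch_domain z ->
  basic (fun t : 'rV[K]_2 => fermat_slope d al0 al1 be0 be1 (t 0 0) * branch i t) z.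
Proof.
move=> Dz; have [h0 h1 _ _] := Dz.
apply: basicM; last by exists (fermat_slope d al0 al1 be0 be1 (z 0 0) * branch i z); exact: branch_jet.
apply: basicM (basic_cst _ _) _; apply: basicV.
  apply: basicM (basic_cst _ _) _; apply: basicM; first by exists be0; exact: jl0.
  by exists be1; exact: jl1.
by rewrite !mulf_neq0 // pnatr_eq0 -lt0n.
Qed.

Lemma branch_inj z i j : branch_domain z -> i != j -> branch i z != branch j z.
Proof.
move=> [_ _ _ h3]; have [_ h _] := rP h3; apply: contra => /eqP /(mulIf h) /eqP.
by rewrite (eq_prim_root_expr zp) !modn_small.
Qed.

Definition branch_form (i : 'I_d) : form1 K := fun z =>
  model_form (m 0 0) (m 1 0) (m 0 1) (m 1 1) 1 (branch i z) z.

Let dm : m 0 0 * m 1 1 - m 0 1 * m 1 0 = 1.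
Proof. by rewrite -det_2 /m det_inv detM invr1. Qed.

Lemma branch_web : local_foliations (Leg w) branch_domain branch_form.
Proof.
have W z i j : branch_domain z -> i != j -> wedge (branch_form i z) (branch_form j z) != 0.
  move=> Dz ij; rewrite /branch_form (wedge_model dm) !mul1r mulf_neq0 //; first by case: Dz.
  by rewrite subr_eq0 eq_sym; exact: branch_inj.
split.
- exact: branch_domain_open.
- move=> i z Dz.
  have jt := branch_jet i Dz.
  have jn k l : jet (fun t : 'rV[K]_2 => k + l * t 0 0) z (0 + (0 * z 0 0 + l * 1)) (0 + (0 * z 0 0 + l * 0)).
    exact: (jetD (jet_cst k z) (jetM (jet_cst l z) (jet_coord 0 z))).
  have [c0 _ _] := jetN (jetM (jet_coord 1 z) (jetB (jetM (jet_cst (m 1 0) z) jt) (jet_cst (m 1 1) z))).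
  have [c1 _ _] := jetB (jetM (jn (m 0 0) (m 1 0)) jt) (jn (m 0 1) (m 1 1)).
  have -> : branch_form i = (fun t => vec2 (- (t 0 1 * (m 1 0 * branch i t - m 1 1)))
     ((m 0 0 + m 1 0 * t 0 0) * branch i t - (m 0 1 + m 1 1 * t 0 0))).
    by apply/funext => t; rewrite /branch_form /model_form scale1r.
  exact: differentiable_vec2.
- move=> i z Dz; have [j ij] := exists_neq d1 i.
  by apply: contraNneq (W z i j Dz ij) => ->; rewrite /wedge !mxE !mul0r subrr.
- by move=> i j z; exact: W.
move=> z Dz; have [h0 h1 q0 _] := Dz.
exists (l1 (z 0 0) * (-1) ^+ d).
  by rewrite mulf_neq0 // expf_neq0 // oppr_eq0 oner_eq0.
move=> v; rewrite /Leg; set l := vec2 _ _.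
have uM : M \in unitmx by rewrite unitmxE unitfE detM oner_eq0.
pose u := l *m m.
have -> : l = vec2 (u 0 0) (u 0 1) *m M by rewrite -vec2_eta /u mulmxKV.
rewrite (fermat_form AE BE).
have [E _ _] := rP (let: And4 _ _ _ h := Dz in h).
have -> : (al0 + z 0 0 * be0) * u 0 0 ^+ d + (al1 + z 0 0 * be1) * u 0 1 ^+ d =
  l1 (z 0 0) * (u 0 1 ^+ d - (r (s (z 0 0)) * u 0 0) ^+ d).
  rewrite exprMn E /s -/(l0 _) -/(l1 _); field; exact: h1.
rewrite (fermat_factor _ _ _ zp) -!mulrA; congr (_ * _).
rewrite -[X in _ ^+ X * _](card_ord d) -prodr_const -big_split /=; apply: eq_bigr => i _.
rewrite contract2 /branch_form /model_form scale1r vec20 vec21 -/(branch i z) /u !mul_row2 /l vec20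
  vec21; ring.
Qed.

(** The forms of the web are normalised by factors 1, so theta is the whole of eta. *)
Definition branch_eta (i j k : 'I_d) : form1 K :=
  theta (m 0 0) (m 1 0) (m 0 1) (m 1 1) (branch i) (branch j) (branch k)
    (fun t => fermat_slope d al0 al1 be0 be1 (t 0 0) * branch i t)
    (fun t => fermat_slope d al0 al1 be0 be1 (t 0 0) * branch j t)
    (fun t => fermat_slope d al0 al1 be0 be1 (t 0 0) * branch k t).

Lemma branch_is_eta (i j k : 'I_d) : (i < j < k)%N ->
  is_eta branch_domain (branch_form i) (branch_form j) (branch_form k) (branch_eta i j k).
Proof.
move=> /andP[ij jk]; have ik := ltn_trans ij jk.
have ne (a b : 'I_d) : (a < b)%N -> forall z, branch_domain z -> branch a z != branch b z.
  by move=> ab z Dz; apply: branch_inj Dz _; apply: contraTneq ab => ->; rewrite ltnn.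
have q0 z : branch_domain z -> z 0 1 != 0 by case.
have bj a z : branch_domain z -> jet (branch a) z (fermat_slope d al0 al1 be0 be1 (z 0 0) * branch a z) 0.
  by move=> Dz; exact: branch_jet.
have bb a z : branch_domain z -> basic (fun t : 'rV[K]_2 => fermat_slope d al0 al1 be0 be1 (t 0 0) *
  branch a t) z.
  by move=> Dz; exact: branch_slope_basic.
have mo a z : branch_domain z -> branch_form a z = model_form (m 0 0) (m 1 0) (m 0 1) (m 1 1) 1 (branch
  a z) z by [].
have d1' z : branch_domain z -> differentiable (fun=> 1 : K) z by move=> _; exact: differentiable_cst.
have n1 (z : 'rV[K]_2) : branch_domain z -> (1 : K) != 0 by move=> _; exact: oner_neq0.
have := @eta_theta K branch_domain _ _ _ _ branch_domain_open dm q0 _ _ _ _ _ _ (bj i) (bj j) (bj k)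
  (ne _ _ ij) (ne _ _ ik) (ne _ _ jk) _ _ _ _ _ _ (mo i) (mo j) (mo k) d1' d1' d1' n1 n1 n1.
have dl v z : 'D_v (fun _ : 'rV[K]_2 => 1 * 1 * 1 : K) z = 0 := derive_cst _ _ _.
have -> : (fun z => theta (m 0 0) (m 1 0) (m 0 1) (m 1 1) (branch i) (branch j) (branch k)
    (fun t => fermat_slope d al0 al1 be0 be1 (t 0 0) * branch i t)
    (fun t => fermat_slope d al0 al1 be0 be1 (t 0 0) * branch j t)
    (fun t => fermat_slope d al0 al1 be0 be1 (t 0 0) * branch k t) z +
    (1 * 1 * 1)^-1 *: vec2 ('D_('e_0) (fun _ : 'rV[K]_2 => 1 * 1 * 1 : K) z) ('D_('e_1) (fun _ :
      'rV[K]_2 => 1 * 1 * 1 : K) z)) = branch_eta i j k.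
  apply/funext => z; rewrite !dl; apply: row2P; rewrite mxE scale_vec2 mulr0 ?vec20 ?vec21 addr0 //.
move=> [h1 h2 h3]; split=> // z Dz.
exact: (@differentiable_theta K branch_domain (m 0 0) (m 1 0) (m 0 1) (m 1 1) q0 _ _ _ _ _ _ (bj i) (bj
  j) (bj k) (bb i) (bb j) (bb k) (ne _ _ ij) (ne _ _ ik) (ne _ _ jk) z Dz).
Qed.

End Branch.

Lemma triple_count_neq0 : triple_count K d != 0.
Proof.
have -> : triple_count K d = (\sum_(r < d) \sum_(s < d | (r < s)%N) \sum_(t < d | (s < t)%N) 1)%N%:R.
  rewrite /triple_count natr_sum; apply: eq_bigr => r _; rewrite natr_sum; apply: eq_bigr => s _.
  by rewrite natr_sum.
rewrite pnatr_eq0 sum_nat_eq0; apply/forallPn; exists (Ordinal d0) => /=.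
rewrite sum_nat_eq0; apply/forallPn; exists (Ordinal d1) => /=.
rewrite sum_nat_eq0; apply/forallPn; exists (Ordinal d2) => //.
Qed.

(** Flatness of the web of branches says that the rational function n0 n1 / (l0 l1)
    of p has zero derivative near the base point, hence is constant; it is not zero,
    as neither n0 nor n1 vanishes identically. *)
Lemma fermat_flat_proportional : flat_web d (Leg w) ->
  exists2 g, g != 0 & forall p, (m 0 0 + m 1 0 * p) * (m 0 1 + m 1 1 * p) = g * (l0 p * l1 p).
Proof.
move=> flat; have [p0 [h0 h1]] := exists_base_point.
have s0 : - l0 p0 / l1 p0 != 0 by rewrite mulf_neq0 ?invr_eq0 ?oppr_eq0.
have [r [e e0 rP]] := root_branch d0 s0.
have [zt zp] := primitive_root_exists K d0.
have LF := branch_web zp rP; have etaP := branch_is_eta zp rP.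
have D0 z : branch_domain p0 e z ->
   'D_('e_0) (fun t : 'rV[K]_2 => triple_count K d * (fermat_slope d al0 al1 be0 be1 (t 0 0) *
     ((m 0 0 + m 1 0 * t 0 0) * (m 0 1 + m 1 1 * t 0 0)))) z = 0.
  move=> Dz; have [_ _ q0 _] := Dz; have := flat _ _ _ LF etaP z Dz.
  rewrite (fermat_curvature d1 hA hB detM AE BE LF sym etaP Dz) => /eqP.
  by rewrite mulf_eq0 invr_eq0 (negPf q0) orbF oppr_eq0 => /eqP.
pose N : {poly K} := ((m 0 0)%:P + m 1 0 *: 'X) * ((m 0 1)%:P + m 1 1 *: 'X).
pose L : {poly K} := (al0%:P + be0 *: 'X) * (al1%:P + be1 *: 'X).
have NE p : N.[p] = (m 0 0 + m 1 0 * p) * (m 0 1 + m 1 1 * p) by rewrite /N !hornerE.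
have LE p : L.[p] = l0 p * l1 p by rewrite /L !hornerE /l0 /l1 ![_ * p]mulrC.
have L0 : L != 0.
  by apply: contraTneq (mulf_neq0 h0 h1) => L0; rewrite -LE L0 horner0 eqxx.
have WR z : branch_domain p0 e z -> (N^`() * L - N * L^`()).[z 0 0] = 0.
  move=> Dz; have [n0 n1 _ _] := Dz; have Lz : L.[z 0 0] != 0 by rewrite LE mulf_neq0.
  have := D0 z Dz; set c := triple_count K d * ((be0 * al1 - be1 * al0) / d%:R).
  have c0 : c != 0.
    by rewrite mulf_neq0 ?triple_count_neq0 // mulf_neq0 // invr_eq0 pnatr_eq0 -lt0n.
  rewrite (derive_eq_on_open (g := fun t : 'rV[K]_2 => c * (N.[t 0 0] * (L.[t 0 0])^-1)) _
    (branch_domain_open (p0 := p0) (e := e)) Dz); last first.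
    move=> t [t0 t1 _ _]; rewrite NE LE /c /fermat_slope -/(l0 _) -/(l1 _).
    have dn : d%:R != 0 :> K by rewrite pnatr_eq0 -lt0n.
    by field; rewrite dn t0 t1.
  have jN := jet_horner N (jet_coord 0 z); have jL := jet_horner L (jet_coord 0 z).
  have [_ -> _] := jetM (jet_cst c z) (jetM jN (jetV jL Lz)).
  rewrite /= mul0r add0r !mulr1 => /eqP; rewrite mulf_eq0 (negPf c0) /= => /eqP E.
  rewrite hornerD hornerN (hornerM N^`() L) (hornerM N L^`()).
  apply: (mulIf (invr_neq0 (expf_neq0 2 Lz))); rewrite mul0r -[RHS]E.
  by field.
have W0 : N^`() * L - N * L^`() = 0.
  have Dp : branch_domain p0 e (vec2 p0 1).
    by split; rewrite ?vec20 ?vec21 ?oner_eq0 // subrr normr0.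
  have := branch_domain_open (p0 := p0) (e := e); rewrite openE => /(_ _ Dp) /nbhs_normP [c /= cp H].
  apply: (poly_zero_ball (p0 := p0) (e := c / 2%:R)); first by rewrite divr_gt0 ?ltr0n.
  move=> p pc; have : branch_domain p0 e (vec2 p 1).
    apply: H => /=; apply: (@le_lt_trans _ _ (c / 2%:R)).
      apply: row_norm_le; first by rewrite divr_ge0 ?ler0n // ltW.
        by rewrite !mxE /= ltW.
      by rewrite !mxE /= subrr normr0 divr_ge0 ?ler0n // ltW.
    by rewrite ltr_pdivrMr ?ltr0n // ltr_pMr // ltr1n.
  by move=> /WR; rewrite vec20.
have [g gE] := wronskian_eq0 L0 (subr0_eq W0).
have E p : (m 0 0 + m 1 0 * p) * (m 0 1 + m 1 1 * p) = g * (l0 p * l1 p).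
  by rewrite -NE -LE gE hornerZ.
exists g => //; apply/eqP => g0.
have [|s sE] := @avoid_roots K 2 (fun i => if i == 0 then m 1 0 else m 1 1) (fun i => if i == 0 then m
  0 0 else m 0 1).
  have dm : m 0 0 * m 1 1 - m 0 1 * m 1 0 = 1 by rewrite -det_2 /m det_inv detM invr1.
  apply: ord2P => /=; rewrite -negb_and; apply/negP => /andP[/eqP a0 /eqP b0]; move/eqP: dm.
    by rewrite a0 b0 mul0r mulr0 subrr eq_sym oner_eq0.
  by rewrite a0 b0 mul0r mulr0 subrr eq_sym oner_eq0.
have := E s; rewrite g0 mul0r => /eqP; rewrite mulf_eq0.
by rewrite addrC [m 0 1 + _]addrC (negPf (sE 0)) (negPf (sE 1)).
Qed.

End FermatWeb.

(** * Conjugacy to the two model foliations *)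

Section Conjugacy.
Variables (K : numClosedFieldType) (d : nat) (w : pform K).
Hypothesis sym : symmetric_derivatives K.
Hypothesis d2 : (2 < d)%N.
Hypothesis hA : w.1 \is ishomog1 d mdeg.
Hypothesis hB : w.2 \is ishomog1 d mdeg.
Let d1 : (1 < d)%N := ltnW d2.
Let d0 : (0 < d)%N := ltnW d1.

Lemma invmx_det1 (M : 'M[K]_2) : \det M = 1 ->
  [/\ invmx M 0 0 = M 1 1, invmx M 0 1 = - M 0 1, invmx M 1 0 = - M 1 0 & invmx M 1 1 = M 0 0].
Proof.
move=> dM; have uM : M \in unitmx by rewrite unitmxE unitfE dM oner_eq0.
pose N : 'M[K]_2 := \matrix_(i, j) (if i == 0 then (if j == 0 then M 1 1 else - M 0 1)
   else (if j == 0 then - M 1 0 else M 0 0)).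
have NM : N *m M = 1%:M.
  apply/row_matrixP => i; rewrite !rowE mulmxA mulmx1.
  have N00 : N 0 0 = M 1 1 by rewrite mxE.
  have N01 : N 0 1 = - M 0 1 by rewrite mxE.
  have N10 : N 1 0 = - M 1 0 by rewrite mxE.
  have N11 : N 1 1 = M 0 0 by rewrite mxE.
  move: i; apply: ord2P; apply: row2P; rewrite !mul_row2 N00 N01 N10 N11 !mxE /= !(mul1r, mul0r, add0r,
    addr0).
  - by rewrite -dM det_2; ring.
  - by ring.
  - by ring.
  - by rewrite -dM det_2; ring.
have -> : invmx M = N by rewrite -[LHS]mul1mx -NM mulmxK.
by split; rewrite mxE.
Qed.

Lemma ev_omega1 v : ev (omega1 K d).1 v = v 0 1 ^+ d /\ ev (omega1 K d).2 v = - v 0 0 ^+ d.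
Proof. by rewrite /ev /= mevalN !rmorphXn /= !mevalXU. Qed.
Lemma ev_omega2 v : ev (omega2 K d).1 v = v 0 0 ^+ d /\ ev (omega2 K d).2 v = - v 0 1 ^+ d.
Proof. by rewrite /ev /= mevalN !rmorphXn /= !mevalXU. Qed.

Lemma power_homog i : mpolyX K (mnm1 (i : 'I_2)) ^+ d \is ishomog1 d mdeg.
Proof.
have := @dhomogMn _ _ _ 1 (mpolyX K (mnm1 i)) d; rewrite mul1n; apply.
by rewrite dhomogX; apply/eqP; exact: mdeg1.
Qed.

Lemma ev_pullback (M : 'M[K]_2) v :
  ev (pullback M w).1 v = M 0 0 * ev w.1 (v *m M) + M 0 1 * ev w.2 (v *m M) /\
  ev (pullback M w).2 v = M 1 0 * ev w.1 (v *m M) + M 1 1 * ev w.2 (v *m M).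
Proof. by rewrite -!ev_change /ev /pullback /= !mevalD !mevalZ. Qed.

Lemma pullback_homog (M : 'M[K]_2) :
  (pullback M w).1 \is ishomog1 d mdeg /\ (pullback M w).2 \is ishomog1 d mdeg.
Proof. by split; apply: rpredD; apply: dhomogZ; exact: change_homog. Qed.

(** By homogeneity the conjugating matrix can be rescaled to determinant 1. *)
Lemma conjugate_chart (w' : pform K) : linearly_conjugate w w' ->
  exists2 M : 'M[K]_2, \det M = 1 & exists2 k, k != 0 & forall v,
   ev w.1 (v *m M) = k * (invmx M 0 0 * ev w'.1 v + invmx M 0 1 * ev w'.2 v) /\
   ev w.2 (v *m M) = k * (invmx M 1 0 * ev w'.1 v + invmx M 1 1 * ev w'.2 v).
Proof.
move=> [M0 uM0 [c c0 E]].
have D0 : \det M0 != 0 by rewrite -unitfE -unitmxE.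
pose e := sqrtC (\det M0)^-1.
have e2 : e ^+ 2 * \det M0 = 1 by rewrite sqrtCK mulVf.
have e0 : e != 0.
  by apply: contra_eqN e2 => /eqP ->; rewrite expr0n mul0r eq_sym oner_eq0.
have dM : \det (e *: M0) = 1 by rewrite detZ.
exists (e *: M0) => //; exists (e ^+ d * c * e); first by rewrite !mulf_neq0 ?expf_neq0.
move=> v; have [-> -> -> ->] := invmx_det1 dM.
rewrite -scalemxAr (ev_scale _ _ hA) (ev_scale _ _ hB) !mxE.
have [E1 E2] := ev_pullback M0 v.
have F1 : ev (pullback M0 w).1 v = c * ev w'.1 v by rewrite E /ev mevalZ.
have F2 : ev (pullback M0 w).2 v = c * ev w'.2 v by rewrite E /ev mevalZ.
rewrite E1 in F1; rewrite E2 in F2.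
have D1 : e ^+ 2 * (M0 0 0 * M0 1 1 - M0 0 1 * M0 1 0) = 1 by rewrite -det_2.
split.
- transitivity (e ^+ d * (e ^+ 2 * (M0 1 1 * (c * ev w'.1 v) - M0 0 1 * (c * ev w'.2 v)))); last by ring.
  rewrite -F1 -F2; transitivity (e ^+ d * ((e ^+ 2 * (M0 0 0 * M0 1 1 - M0 0 1 * M0 1 0)) * ev w.1 (v
    *m M0))); last by ring.
  by rewrite D1 mul1r.
- transitivity (e ^+ d * (e ^+ 2 * (- M0 1 0 * (c * ev w'.1 v) + M0 0 0 * (c * ev w'.2 v)))); last by ring.
  rewrite -F1 -F2; transitivity (e ^+ d * ((e ^+ 2 * (M0 0 0 * M0 1 1 - M0 0 1 * M0 1 0)) * ev w.2 (v
    *m M0))); last by ring.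
  by rewrite D1 mul1r.
Qed.

(** For both models, A and B are combinations of x ^ d and y ^ d in the chart of the
    conjugation, and l0 l1 is a multiple of n0 n1: the columns of the inverse of M
    give l0 and l1 up to constants, in one order or the other. *)
Lemma conjugate_flat : linearly_conjugate w (omega1 K d) \/ linearly_conjugate w (omega2 K d) ->
  flat_web d (Leg w).
Proof.
case=> /conjugate_chart [M dM [k k0 kE]] U a eta LF etaP z Uz; set m := invmx M in kE.
- have AE x y : ev w.1 (vec2 x y *m M) = (- (k * m 0 1)) * x ^+ d + (k * m 0 0) * y ^+ d.
    by rewrite (kE _).1 (ev_omega1 _).1 (ev_omega1 _).2 vec20 vec21; ring.
  have BE x y : ev w.2 (vec2 x y *m M) = (- (k * m 1 1)) * x ^+ d + (k * m 1 0) * y ^+ d.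
    by rewrite (kE _).2 (ev_omega1 _).1 (ev_omega1 _).2 vec20 vec21; ring.
  apply: (fermat_flat d1 hA hB dM AE BE LF (g := - (k ^+ 2)^-1) sym _ etaP Uz) => p.
  by rewrite -/m; field.
- have AE x y : ev w.1 (vec2 x y *m M) = (k * m 0 0) * x ^+ d + (- (k * m 0 1)) * y ^+ d.
    by rewrite (kE _).1 (ev_omega2 _).1 (ev_omega2 _).2 vec20 vec21; ring.
  have BE x y : ev w.2 (vec2 x y *m M) = (k * m 1 0) * x ^+ d + (- (k * m 1 1)) * y ^+ d.
    by rewrite (kE _).2 (ev_omega2 _).1 (ev_omega2 _).2 vec20 vec21; ring.
  apply: (fermat_flat d1 hA hB dM AE BE LF (g := - (k ^+ 2)^-1) sym _ etaP Uz) => p.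
  by rewrite -/m; field.
Qed.

(** Unique factorisation of a quadratic polynomial in p, including factors that are
    constant in p, which stand for a root at infinity. *)
Lemma linear_factors_match (u0 u1 v0 v1 : 'rV[K]_2) g : g != 0 -> u0 != 0 -> v0 != 0 -> v1 != 0 ->
  (forall p, (u0 0 0 + u0 0 1 * p) * (u1 0 0 + u1 0 1 * p) =
     g * ((v0 0 0 + p * v0 0 1) * (v1 0 0 + p * v1 0 1))) ->
  exists c, exists2 c', c * c' != 0 & v0 = c *: u0 /\ v1 = c' *: u1 \/ v0 = c *: u1 /\ v1 = c' *: u0.
Proof.
move=> g0 nu0 nv0 nv1 H.
have [H0 H1 H2] : [/\ u0 0 0 * u1 0 0 = g * (v0 0 0 * v1 0 0),
   u0 0 0 * u1 0 1 + u0 0 1 * u1 0 0 = g * (v0 0 0 * v1 0 1 + v0 0 1 * v1 0 0)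
   & u0 0 1 * u1 0 1 = g * (v0 0 1 * v1 0 1)].
  pose N : {poly K} := ((u0 0 0)%:P + u0 0 1 *: 'X) * ((u1 0 0)%:P + u1 0 1 *: 'X)
    - g *: (((v0 0 0)%:P + v0 0 1 *: 'X) * ((v1 0 0)%:P + v1 0 1 *: 'X)).
  pose N' : {poly K} := (u0 0 0 * u1 0 0 - g * (v0 0 0 * v1 0 0))%:P
     + (u0 0 0 * u1 0 1 + u0 0 1 * u1 0 0 - g * (v0 0 0 * v1 0 1 + v0 0 1 * v1 0 0)) *: 'X
     + (u0 0 1 * u1 0 1 - g * (v0 0 1 * v1 0 1)) *: 'X^2.
  have N0 : N' = 0.
    apply: poly_ext => t; rewrite horner0 /N' !(hornerD, hornerZ, hornerXn, hornerX, hornerC).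
    transitivity ((u0 0 0 + u0 0 1 * t) * (u1 0 0 + u1 0 1 * t) -
      g * ((v0 0 0 + t * v0 0 1) * (v1 0 0 + t * v1 0 1))); last by rewrite H subrr.
    by ring.
  have co i : N'`_i = 0 by rewrite N0 coef0.
  move: (co 0%N) (co 1%N) (co 2%N); rewrite /N' !coefE /= !(mulr0, mulr1, addr0, add0r).
  by move=> /subr0_eq -> /subr0_eq -> /subr0_eq ->.
(* One of the factors on the right vanishes at the zero of the first factor on the left. *)
have Z : (v0 0 0 * u0 0 1 - v0 0 1 * u0 0 0) * (v1 0 0 * u0 0 1 - v1 0 1 * u0 0 0) = 0.
  apply: (mulfI g0); rewrite mulr0.
  transitivity (g * (v0 0 0 * v1 0 0) * u0 0 1 ^+ 2
    - g * (v0 0 0 * v1 0 1 + v0 0 1 * v1 0 0) * (u0 0 0 * u0 0 1)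
    + g * (v0 0 1 * v1 0 1) * u0 0 0 ^+ 2); first by ring.
  by rewrite -H0 -H1 -H2; ring.
have key (x y : 'rV[K]_2) : y != 0 -> x != 0 -> wedge u0 x = 0 ->
   u0 0 0 * u1 0 0 = g * (x 0 0 * y 0 0) ->
   u0 0 0 * u1 0 1 + u0 0 1 * u1 0 0 = g * (x 0 0 * y 0 1 + x 0 1 * y 0 0) ->
   u0 0 1 * u1 0 1 = g * (x 0 1 * y 0 1) ->
   exists c, exists2 c', c * c' != 0 & x = c *: u0 /\ y = c' *: u1.
  move=> y0 x0 W E0 E1 E2; have [c xE] := wedge_eq0 nu0 W.
  have c0 : c != 0 by apply: contraNneq x0 => c0; rewrite xE c0 scale0r.
  exists c, (g * c)^-1; first by rewrite mulf_neq0 // invr_eq0 mulf_neq0.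
  split=> //.
  have gc : g * c != 0 by rewrite mulf_neq0.
  suff [F0 F1] : u1 0 0 = g * c * y 0 0 /\ u1 0 1 = g * c * y 0 1.
    by apply: row2P; rewrite mxE ?F0 ?F1 mulKf.
  have X0 : x 0 0 = c * u0 0 0 by rewrite xE mxE.
  have X1 : x 0 1 = c * u0 0 1 by rewrite xE mxE.
  rewrite X0 X1 in E0 E1 E2.
  have [a0|a0] := eqVneq (u0 0 0) 0.
    have b0 : u0 0 1 != 0 by move: nu0; rewrite row2_neq0 a0 eqxx.
    split; apply: (mulfI b0); last by rewrite E2; ring.
    by move: E1; rewrite a0 !mul0r add0r => ->; ring.
  have F0 : u1 0 0 = g * c * y 0 0 by apply: (mulfI a0); rewrite E0; ring.
  split=> //; apply: (mulfI a0); move: E1; rewrite F0 => E1.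
  apply: (addIr (u0 0 1 * (g * c * y 0 0))); rewrite E1; ring.
move/eqP: Z; rewrite mulf_eq0 => /orP[/eqP Z|/eqP Z].
- have W : wedge u0 v0 = 0 by rewrite /wedge -[RHS]oppr0 -Z; ring.
  have [c [c' cc E]] := key v0 v1 nv1 nv0 W H0 H1 H2.
  by exists c, c' => //; left.
- have W : wedge u0 v1 = 0 by rewrite /wedge -[RHS]oppr0 -Z; ring.
  have [|||c [c' cc [E E']]] := key v1 v0 nv0 nv1 W.
  + by rewrite H0; ring.
  + by rewrite H1; ring.
  + by rewrite H2; ring.
  by exists c', c; [rewrite mulrC | right].
Qed.

Variables (M : 'M[K]_2) (al0 al1 be0 be1 : K).
Hypothesis detM : \det M = 1.
Hypothesis AE : forall x y, ev w.1 (vec2 x y *m M) = al0 * x ^+ d + al1 * y ^+ d.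
Hypothesis BE : forall x y, ev w.2 (vec2 x y *m M) = be0 * x ^+ d + be1 * y ^+ d.
Hypothesis Delta : be0 * al1 - be1 * al0 != 0.

(** The vectors (al0, be0) and (al1, be1) are multiples of the columns of the
    inverse of M, in one of the two orders. Rescaling the second coordinate by a
    suitable root equalises the two constants up to sign, and the order decides
    between the two models. *)
Lemma proportional_conjugate (g : K) : g != 0 ->
  (forall p, (invmx M 0 0 + invmx M 1 0 * p) * (invmx M 0 1 + invmx M 1 1 * p)
     = g * ((al0 + p * be0) * (al1 + p * be1))) ->
  linearly_conjugate w (omega1 K d) \/ linearly_conjugate w (omega2 K d).
Proof.
move=> g0; have [-> -> -> ->] := invmx_det1 detM => H.
have dM : M 0 0 * M 1 1 - M 0 1 * M 1 0 = 1 by rewrite -det_2.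
pose u0 : 'rV[K]_2 := vec2 (M 1 1) (- M 1 0); pose u1 : 'rV[K]_2 := vec2 (- M 0 1) (M 0 0).
pose v0 : 'rV[K]_2 := vec2 al0 be0; pose v1 : 'rV[K]_2 := vec2 al1 be1.
have nu0 : u0 != 0.
  rewrite row2_neq0 vec20 vec21 oppr_eq0 -negb_and; apply/negP => /andP[/eqP a /eqP b].
  by move/eqP: dM; rewrite a b !mulr0 subrr eq_sym oner_eq0.
have nv0 : v0 != 0.
  rewrite row2_neq0 vec20 vec21 -negb_and; apply: contra Delta => /andP[/eqP -> /eqP ->].
  by rewrite mul0r mulr0 subrr.
have nv1 : v1 != 0.
  rewrite row2_neq0 vec20 vec21 -negb_and; apply: contra Delta => /andP[/eqP -> /eqP ->].
  by rewrite mul0r mulr0 subrr.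
have [p|c [c' cc E]] := @linear_factors_match u0 u1 v0 v1 g g0 nu0 nv0 nv1.
  by rewrite !vec20 !vec21; exact: H.
have c0 : c != 0 by apply: contraNneq cc => ->; rewrite mul0r.
have c'0 : c' != 0 by apply: contraNneq cc => ->; rewrite mulr0.
have vec2_inj (a b a' b' : K) : vec2 a b = vec2 a' b' -> a = a' /\ b = b'.
  by move=> e; rewrite -(vec20 a b) -{2}(vec21 a b) e vec20 vec21.
pose T (t : K) : 'M[K]_2 := \matrix_(i, j) (if i == 0 then M 0 j else t * M 1 j).
have TE t x y : vec2 x y *m T t = vec2 x (t * y) *m M.
  by apply: row2P; rewrite !mul_row2 !vec20 !vec21 !mxE /=; ring.
have Tu t : t != 0 -> T t \in unitmx.
  move=> t0; rewrite unitmxE unitfE det_2 !mxE /=.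
  by rewrite (_ : _ - _ = t * (M 0 0 * M 1 1 - M 0 1 * M 1 0)); [rewrite dM mulr1 | ring].
have conj (w' : pform K) t k : t != 0 -> k != 0 ->
    w'.1 \is ishomog1 d mdeg -> w'.2 \is ishomog1 d mdeg ->
    (forall x y, M 0 0 * (al0 * x ^+ d + al1 * (t * y) ^+ d) + M 0 1 * (be0 * x ^+ d + be1 * (t * y) ^+ d)
        = k * ev w'.1 (vec2 x y)) ->
    (forall x y, t * (M 1 0 * (al0 * x ^+ d + al1 * (t * y) ^+ d) + M 1 1 * (be0 * x ^+ d + be1 * (t *
      y) ^+ d))
        = k * ev w'.2 (vec2 x y)) ->
    linearly_conjugate w w'.
  move=> t0 k0 h1 h2 E1 E2; exists (T t); first exact: Tu.
  exists k => //; have [p1 p2] := pullback_homog (T t).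
  rewrite [LHS]surjective_pairing; congr pair; apply: (@homog_ext _ d) => //; try exact: dhomogZ.
    move=> v; have [-> _] := ev_pullback (T t) v; rewrite [v]vec2_eta TE AE BE /ev mevalZ -/(ev _ _) -E1.
    by rewrite !mxE.
  move=> v; have [_ ->] := ev_pullback (T t) v; rewrite [v]vec2_eta TE AE BE /ev mevalZ -/(ev _ _) -E2.
  by rewrite !mxE /=; ring.
have root_exists n (x : K) : (0 < n)%N -> x != 0 -> exists2 t, t != 0 & t ^+ n = x.
  move=> n0 x0; exists (n.-root x); last by rewrite rootCK.
  by apply: contra_eqN (rootCK n0 x) => /eqP ->; rewrite expr0n gtn_eqF // eq_sym.
case: E => -[]; rewrite /v0 /v1 /u0 /u1 !scale_vec2 => /vec2_inj [a0 b0] /vec2_inj [a1 b1].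
- right; have [||t t0 tE] := root_exists d.+1 (- c / c') => //.
    by rewrite mulf_neq0 ?oppr_eq0 ?invr_eq0.
  apply: (conj _ t c) => //; try exact: power_homog.
  + by rewrite -dhomogN opprK; exact: power_homog.
  + move=> x y; rewrite (ev_omega2 _).1 vec20 a0 b0 a1 b1.
    transitivity (c * x ^+ d * (M 0 0 * M 1 1 - M 0 1 * M 1 0)); first by ring.
    by rewrite dM mulr1.
  + move=> x y; rewrite (ev_omega2 _).2 vec21 a0 b0 a1 b1.
    transitivity (c' * (t ^+ d.+1) * y ^+ d * (M 0 0 * M 1 1 - M 0 1 * M 1 0)).
      by rewrite exprMn exprS; ring.
    by rewrite dM mulr1 tE; field.
- left; have [||t t0 tE] := root_exists d.-1 (- c / c').
  + by rewrite -subn1 subn_gt0.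
  + by rewrite mulf_neq0 ?oppr_eq0 ?invr_eq0.
  have tE' : t ^+ d = t * (- c / c') by rewrite -tE -exprS prednK.
  apply: (conj _ t (c' * t ^+ d)) => //.
  + by rewrite mulf_neq0 ?expf_neq0.
  + exact: power_homog.
  + by rewrite -dhomogN opprK; exact: power_homog.
  + move=> x y; rewrite (ev_omega1 _).1 vec21 a0 b0 a1 b1.
    transitivity (c' * t ^+ d * y ^+ d * (M 0 0 * M 1 1 - M 0 1 * M 1 0)); first by rewrite exprMn; ring.
    by rewrite dM mulr1.
  + move=> x y; rewrite (ev_omega1 _).2 vec20 a0 b0 a1 b1.
    transitivity (t * c * x ^+ d * (M 0 0 * M 1 1 - M 0 1 * M 1 0)); first by rewrite exprMn; ring.
    by rewrite dM mulr1 tE'; field.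
Qed.

End Conjugacy.

(** * From deck transformations to linear symmetries *)

Section Along.
Variable K : numClosedFieldType.

Definition along n (f : mpoly n K) (c : 'I_n -> {poly K}) : {poly K} := mmap (@polyC K) c f.

Lemma along_horner n (f : mpoly n K) c t : (along f c).[t] = ev f (\row_i (c i).[t]).
Proof.
rewrite /along /ev /mmap /meval /mmap horner_sum; apply: eq_bigr => m _.
rewrite hornerM hornerC; congr (_ * _); rewrite /mmap1 horner_prod.
by apply: eq_bigr => i _; rewrite horner_exp mxE.
Qed.

Lemma top_coef (p q : {poly K}) m n : (size p <= m.+1)%N -> (size q <= n.+1)%N ->
  (size (p * q)%R <= (m + n).+1)%N /\ (p * q)`_(m + n)%N = p`_m * q`_n.
Proof.
move=> hp hq; split.
  apply: leq_trans (size_polyMleq _ _) _.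
  by rewrite -subn1 leq_subLR (leq_trans (leq_add hp hq)) // addSn addnS.
rewrite coefM (bigD1 (inord m)) //= inordK ?ltnS ?leq_addr // addKn big1 ?addr0 // => i ni.
have im : (i : nat) != m by apply: contraNneq ni => im; apply/eqP/val_inj; rewrite /= inordK ?ltnS ?leq_addr.
case: (ltngtP i m) im => // lim _; last by rewrite [p`_i]nth_default ?mul0r // (leq_trans hp).
by rewrite [q`_ _]nth_default ?mulr0 // (leq_trans hq) // ltn_subRL ltn_add2r.
Qed.

Lemma top_coefX (p : {poly K}) m k : (size p <= m.+1)%N ->
  (size (p ^+ k)%R <= (m * k).+1)%N /\ (p ^+ k)`_(m * k)%N = p`_m ^+ k.
Proof.
move=> hp; elim: k => [|k [s c]]; first by rewrite muln0 !expr0 size_poly1 coef1.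
have [s' c'] := top_coef hp s.
by rewrite exprS mulnS; split=> //; rewrite c' c exprS.
Qed.

(** Each monomial c0 ^ (d - k) c1 ^ k contributes the product of its top
    coefficients. *)
Lemma along_top d (A : mpoly 2 K) (c : 'I_2 -> {poly K}) e : A \is ishomog1 d mdeg ->
  (forall i, (size (c i) <= e.+1)%N) -> (along A c)`_(e * d)%N = ev A (vec2 (c 0)`_e (c 1)`_e).
Proof.
move=> hA sc; have -> : along A c = \sum_(k < d.+1) (mcoeff (mono d k) A) *: (c 0 ^+ (d - k) * c 1 ^+ k).
  apply: poly_ext => t; rewrite along_horner (_ : \row_i _ = vec2 (c 0).[t] (c 1).[t]); last first.
    by apply: row2P; rewrite ?vec20 ?vec21 mxE.
  rewrite {1}(homog_mform hA) ev_mform horner_sum; apply: eq_bigr => k _.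
  by rewrite hornerZ hornerM !horner_exp.
rewrite {2}(homog_mform hA) ev_mform coef_sum; apply: eq_bigr => k _; rewrite coefZ; congr (_ * _).
have [s0 c0] := top_coefX (d - k) (sc 0); have [s1 c1] := top_coefX k (sc 1).
have [_] := top_coef s0 s1; rewrite c0 c1 -mulnDr subnK // -ltnS; exact: ltn_ord.
Qed.

End Along.

Section Deck.
Variables (K : numClosedFieldType) (d : nat) (w : pform K).
Hypothesis d1 : (1 < d)%N.
Hypothesis hA : w.1 \is ishomog1 d mdeg.
Hypothesis hB : w.2 \is ishomog1 d mdeg.
Hypothesis nz : no_common_zero w.1 w.2.
Let d0 : (0 < d)%N. Proof. exact: ltnW d1. Qed.

Let a := dehomog w.1.
Let b := dehomog w.2.

Lemma dehomog_no_common_root t : a.[t] = 0 -> b.[t] = 0 -> False.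
Proof.
rewrite /a /b !dehomogE; apply: nz; by rewrite row2_neq0 vec20 oner_eq0.
Qed.

Lemma top_neq0 : (b`_d != 0) || (a`_d != 0).
Proof.
rewrite /a /b -!ev01 // orbC -negb_and; apply/negP => /andP[/eqP h1 /eqP h2].
by apply: (nz _ h1 h2); rewrite row2_neq0 vec21 oner_eq0 orbT.
Qed.

Lemma dehomog2_neq0 : b != 0.
Proof.
apply/eqP => b0; have [|v] := @pencil_neq0 K d w d0 hA hB nz 0 1; first by rewrite oner_eq0 orbT.
by rewrite (dehomog_inj hB (rpred0 _) (etrans b0 _)) ?/dehomog ?raddf0 // /ev meval0 mul0r mulr0 addr0 eqxx.
Qed.

Lemma wronskian_neq0 : a^`() * b - a * b^`() != 0.
Proof.
rewrite subr_eq0; apply/eqP => /(wronskian_eq0 dehomog2_neq0) [g aE].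
have [|v] := @pencil_neq0 K d w d0 hA hB nz 1 (- g); first by rewrite oner_eq0.
have -> : w.1 = g *: w.2.
  apply: (dehomog_inj hA (dhomogZ _ hB)); apply: poly_ext => t;
    rewrite -/a aE hornerZ !dehomogE /ev mevalZ //.
by rewrite /ev mevalZ mul1r mulNr subrr eqxx.
Qed.

(** If a = - X b, then b has no root, as it would be a root of a; so b is constant
    and, for d at least 2, the coefficients of degree d of a and b vanish together. *)
Lemma tangent_neq0 : a + 'X * b != 0.
Proof.
apply/eqP => E; have aE : a = - ('X * b) by apply/eqP; rewrite -addr_eq0 E.
have [s1|/closed_rootP [t /eqP bt]] := eqVneq (size b) 1%N; last first.
  by apply: (@dehomog_no_common_root t); rewrite // aE hornerN hornerM bt mulr0 oppr0.
case: d d1 top_neq0 => [//|[//|n]] _; rewrite aE coefN coefXM /= !nth_default ?s1 //.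
by rewrite oppr0 eqxx.
Qed.

Section Curve.
Variable q0 : K.

(** A rational curve in the plane that meets the generic fibres of the Gauss map in
    d points: by [gauss_curve], the image of the point of parameter t depends on t
    only through [a(t) : b(t)]. *)
Definition curve (i : 'I_3) : {poly K} := [:: q0 *: b; q0 *: ('X * b); - (a + 'X * b)]`_i.
Definition curve_pt t : 'rV[K]_3 := \row_i (curve i).[t].

Lemma curve_ptE t : curve_pt t = vec3 (q0 * b.[t]) (q0 * (t * b.[t])) (- (a.[t] + t * b.[t])).
Proof.
apply/rowP => -[[|[|[|//]]] p]; rewrite !mxE /curve /= ?hornerZ ?hornerN ?hornerD ?hornerM ?hornerX //.
Qed.

Lemma vec3E (x y z : K) : (vec3 x y z 0 0 = x) * (vec3 x y z 0 1 = y) * (vec3 x y z 0 2 = z).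
Proof. by rewrite !mxE. Qed.

Lemma gauss_curve t : gaussP2 w (curve_pt t) =
  ((q0 * b.[t]) ^+ d * - (a.[t] + t * b.[t])) *: vec3 a.[t] b.[t] (q0 * b.[t]).
Proof.
rewrite curve_ptE /gaussP2 !vec3E.
have -> : vec2 (q0 * b.[t]) (q0 * (t * b.[t])) = (q0 * b.[t]) *: vec2 1 t.
  by rewrite scale_vec2; congr vec2; ring.
rewrite !(ev_scale _ _ hA) !(ev_scale _ _ hB) -!dehomogE -/a -/b.
apply/rowP => -[[|[|[|//]]] p]; rewrite !mxE /=; ring.
Qed.

End Curve.

(** A point with X, Z, B (X, Y) and X A + Y B nonzero lies on the curve for some q0
    and t = Y / X. Such a point exists in U: on the line joining a point of U to a
    point where the four factors do not vanish, both conditions fail at finitely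
    many points only. *)
Lemma open_meets_curve U : zariski_open U -> U !=set0 ->
  exists2 q0, q0 != 0 & exists2 g : {poly K}, g != 0 & forall t, g.[t] != 0 -> U (curve_pt q0 t).
Proof.
move=> [S hS ->] [m0 [m0n0 [f Sf fm0]]]; have [e he] := hS _ Sf.
have [t1] := closed_nonrootP _ (mulf_neq0 dehomog2_neq0 tangent_neq0).
rewrite rootE hornerM mulf_eq0 negb_or hornerD hornerM hornerX => /andP[bt1 at1].
pose m1 : 'rV[K]_3 := vec3 1 t1 1.
have [c cE] : exists c : 'I_3 -> {poly K}, forall i t, (c i).[t] = m0 0 i + (m1 0 i - m0 0 i) * t.
  exists (fun i => (m0 0 i)%:P + (m1 0 i - m0 0 i) *: 'X) => i t.
  by rewrite !(hornerD, hornerZ, hornerX, hornerC).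
pose c2 (i : 'I_2) : {poly K} := if i == 0 then c 0 else c 1.
pose F := along f c; pose B := along w.2 c2; pose A := along w.1 c2.
have c2E t : \row_i (c2 i).[t] = vec2 (c 0).[t] (c 1).[t] by apply: row2P; rewrite ?vec20 ?vec21 mxE.
have m1E : (m1 0 0 = 1) * (m1 0 1 = t1) * (m1 0 2 = 1) := vec3E 1 t1 1.
have c1E : ((c 0).[1] = 1) * ((c 1).[1] = t1) * ((c 2).[1] = 1).
  by rewrite !cE !m1E !mulr1 !(addrC (m0 _ _)) !subrK.
have F0 : F != 0.
  apply: contraNneq fm0 => E; have := along_horner f c 0; rewrite -/F E horner0 => ->.
  by apply/eqP; congr (ev f _); apply/rowP => i; rewrite mxE cE mulr0 addr0.
pose G := c 0 * c 2 * B * (c 0 * A + c 1 * B).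
have G0 : G != 0.
  suff : G.[1] != 0 by apply: contraNneq => ->; rewrite horner0.
  rewrite /G !(hornerM, hornerD) !along_horner !c2E !c1E !mul1r -!dehomogE.
  by rewrite mulf_neq0.
have [s] := closed_nonrootP _ (mulf_neq0 F0 G0).
rewrite rootE hornerM along_horner mulf_eq0 negb_or => /andP[Fs].
rewrite /G !(hornerM, hornerD) !along_horner !c2E; set X := (c 0).[s]; set Y := (c 1).[s]; set Z := (c 2).[s].
rewrite !mulf_eq0 !negb_or => /andP[/andP[/andP[X0 Z0] B0] XY].
have FE : \row_i (c i).[s] = vec3 X Y Z.
  by apply/rowP => -[[|[|[|//]]] pr]; rewrite !mxE /=; congr (c _).[s]; exact/val_inj.
rewrite FE in Fs; pose t := Y / X.
have YE : Y = X * t by rewrite /t mulrC divfK.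
have vE : vec2 X Y = X *: vec2 1 t by rewrite scale_vec2 mulr1 -YE.
rewrite vE (ev_scale _ _ hA) (ev_scale _ _ hB) -!dehomogE -/a -/b in B0 XY.
have {}B0 : b.[t] != 0 by apply: contraNneq B0 => ->; rewrite mulr0.
have {}XY : a.[t] + t * b.[t] != 0.
  by apply: contraNneq XY => E; rewrite YE; apply/eqP; rewrite -(mulr0 (X ^+ d * X)) -E; ring.
(* ratio of the homogeneous coordinates of the point on the curve to (X, Y, Z) *)
pose l := - (a.[t] + t * b.[t]) / Z.
have l0 : l != 0 by rewrite mulf_neq0 ?oppr_eq0 ?invr_eq0.
pose q0 := l * X / b.[t].
have q00 : q0 != 0 by rewrite /q0 mulf_neq0 ?invr_eq0 // mulf_neq0.
exists q0 => //; exists (along f (curve q0) * b).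
  rewrite mulf_neq0 ?dehomog2_neq0 //; apply/eqP => E.
  have := along_horner f (curve q0) t; rewrite E horner0 -/(curve_pt q0 t) curve_ptE.
  have -> : vec3 (q0 * b.[t]) (q0 * (t * b.[t])) (- (a.[t] + t * b.[t])) = l *: vec3 X Y Z.
    apply/rowP => -[[|[|[|//]]] pr]; rewrite !mxE /=.
    + by rewrite /q0 divfK.
    + by rewrite YE mulrCA mulrA [t * _]mulrC /q0; field.
    + by rewrite /l divfK.
  rewrite (ev_scale _ _ he) => /esym/eqP.
  by rewrite mulf_eq0 (negPf Fs) orbF expf_eq0 (negPf l0) andbF.
move=> r; rewrite hornerM along_horner mulf_eq0 negb_or -/(curve_pt q0 r) => /andP[fr br]; split;
  last by exists f.
apply: contraNneq br => E; have : curve_pt q0 r 0 0 = 0 by rewrite E mxE.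
by rewrite curve_ptE vec3E => /eqP; rewrite mulf_eq0 (negPf q00).
Qed.

(** It suffices that p avoids the finitely many values - a / b at the zeros of g and
    of the Wronskian of a and b, whose zeros are where multiple roots can occur, and
    the value for which the degree of a + p b drops. *)
Lemma generic_fibre (g : {poly K}) : g != 0 ->
  exists p, exists2 t : 'I_d -> K, injective t &
    forall i, a.[t i] + p * b.[t i] = 0 /\ g.[t i] != 0.
Proof.
move=> g0; set W := a^`() * b - a * b^`(); have gW : g * W != 0 by rewrite mulf_neq0 ?wronskian_neq0.
have [rs rsE] := closed_field_poly_normal (g * W).
have root_rs z : (g * W).[z] = 0 -> z \in rs.
  move=> /eqP; rewrite -rootE rsE rootZ ?lead_coef_eq0 // root_prod_XsubC //.
pose u (i : 'I_(size rs).+1) := nth b`_d [seq b.[z] | z <- rs] i.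
pose v (i : 'I_(size rs).+1) := nth a`_d [seq a.[z] | z <- rs] i.
have [i|p pE] := @avoid_roots K _ u v.
  rewrite /u /v; have [lt|ge] := ltnP i (size rs); last first.
    rewrite [nth b`_d _ _]nth_default ?size_map // [nth a`_d _ _]nth_default ?size_map //; exact: top_neq0.
  rewrite !(nth_map 0) // -negb_and; apply/negP => /andP[/eqP b0 /eqP a0].
  exact: (dehomog_no_common_root a0 b0).
have top : a`_d + p * b`_d != 0.
  by have := pE ord_max; rewrite /u /v [nth b`_d _ _]nth_default ?size_map // [nth a`_d _ _]nth_default
    ?size_map // addrC mulrC.
have good z : (g * W).[z] = 0 -> a.[z] + p * b.[z] != 0.
  move=> /root_rs zr; have lt : (index z rs < (size rs).+1)%N by rewrite ltnS index_size.
  have := pE (Ordinal lt); rewrite /u /v /= !(nth_map 0) ?index_mem // nth_index //.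
  by rewrite addrC mulrC.
exists p; pose P := a + p *: b.
have PE z : P.[z] = a.[z] + p * b.[z] by rewrite hornerD hornerZ.
have sP : size P = d.+1.
  apply/eqP; rewrite eqn_leq; apply/andP; split.
    rewrite (leq_trans (size_polyD _ _)) // geq_max size_dehomog //.
    by rewrite (leq_trans (size_scale_leq _ _)) // size_dehomog.
  rewrite ltnNge; apply: contraNN top => /leq_sizeP/(_ d (leqnn d)).
  by rewrite coefD coefZ => ->.
have P0 : P != 0 by rewrite -size_poly_eq0 sP.
have [s sE] := closed_field_poly_normal P.
have lP : lead_coef P != 0 by rewrite lead_coef_eq0.
have ss : size s = d.
  by have := sP; rewrite sE size_scale // size_prod_XsubC => -[].
have inP z : z \in s -> P.[z] = 0.
  by move=> zs; apply/eqP; rewrite -rootE sE rootZ // root_prod_XsubC.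
have us : uniq s.
  rewrite -(separable_prod_XsubC s) -(eqp_separable (eqp_scale _ lP)) -sE separable_poly.unlock.
  apply: Pdiv.ClosedField.root_coprimep => z rz.
  apply/negP => /eqP dz; move: rz; rewrite rootE => /eqP; rewrite PE => Pz.
  have := good z; rewrite Pz eqxx => F; suff : false by []; apply: F.
  rewrite hornerM (_ : W.[z] = 0) ?mulr0 //.
  move: dz; rewrite /P derivD derivZ hornerD hornerZ => dz.
  rewrite /W !(hornerD, hornerN, hornerM).
  have aE : a.[z] = - (p * b.[z]) by apply/eqP; rewrite -addr_eq0 Pz.
  have a'E : a^`().[z] = - (p * b^`().[z]) by apply/eqP; rewrite -addr_eq0 dz.
  by rewrite aE a'E; ring.
exists (fun i => nth 0 s i).
  move=> i j /eqP; rewrite nth_uniq ?ss // => /eqP; exact: val_inj.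
move=> i; have si : nth 0 s i \in s by rewrite mem_nth // ss.
split; first by rewrite -PE inP.
apply/eqP => gi; have := good (nth 0 s i); rewrite hornerM gi mul0r -PE inP // eqxx.
by move/(_ erefl).
Qed.

(** A vector killed by h would be a common zero of A and B. *)
Lemma preserves_unit h : preserves w h -> h \in unitmx.
Proof.
move=> [k k0 kE]; apply: contraT; rewrite -row_free_unit -kermx_eq0 => /rowV0Pn [v /sub_kermxP vh v0].
have z C : C \is ishomog1 d mdeg -> ev C (0 : 'rV[K]_2) = 0.
  by move=> hC; rewrite -(scale0r (0 : 'rV[K]_2)) (ev_scale _ _ hC) expr0n gtn_eqF // mul0r.
exfalso; apply: (nz v0); apply: (mulfI k0); rewrite mulr0.
- by rewrite -(kE v).1 vh z.
- by rewrite -(kE v).2 vh z.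
Qed.

(** By [proportional_pair], A (n0, n1) and B (n0, n1) are constant multiples of a
    and b. If e is the maximal degree of n0 and n1, one of the two has degree e d by
    [along_top], so e is at most 1 and (n0, n1) depends linearly on t. *)
Lemma polynomial_symmetry (n : 'I_2 -> {poly K}) : coprimep (n 0) (n 1) ->
  along w.1 n * b = along w.2 n * a ->
  exists2 h, preserves w h & forall t, vec2 1 t *m h = vec2 (n 0).[t] (n 1).[t].
Proof.
move=> cop E.
have nE t : \row_i (n i).[t] = vec2 (n 0).[t] (n 1).[t] by apply: row2P; rewrite ?vec20 ?vec21 mxE.
have [t E1 E2|k k0 [kA kB]] := @proportional_pair K w nz (along w.1 n) (along w.2 n) E.
  rewrite !along_horner nE in E1 E2; apply: (nz _ E1 E2); rewrite row2_neq0 vec20 vec21 -negb_and.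
  apply/negP => /andP[r0 r1]; have := coprimep_root cop r0; by rewrite (eqP r1) eqxx.
pose e := maxn (size (n 0)).-1 (size (n 1)).-1.
have se : forall i, (size (n i) <= e.+1)%N.
  by apply: ord2P; apply: leq_trans (leqSpred _) _; rewrite ltnS /e ?leq_maxl ?leq_maxr.
(* Otherwise e d > d and A, B have a common zero at the vector of top coefficients. *)
have e1 : (e <= 1)%N.
  rewrite leqNgt; apply/negP => e2.
  have top i : (1 < size (n i))%N -> e = (size (n i)).-1 -> False.
    move=> si eE; have ni : (n i)`_e != 0.
      by rewrite eE -lead_coefE lead_coef_eq0 -size_poly_gt0 ltnW.
    have de : (d.+1 <= e * d)%N.
      by rewrite -addn1 (leq_trans _ (leq_mul e2 (leqnn d))) // mul2n -addnn leq_add2l ltnW.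
    have := along_top hA se; rewrite kA coefZ nth_default ?mulr0; last exact: leq_trans (size_dehomog hA) de.
    have := along_top hB se; rewrite kB coefZ nth_default ?mulr0; last exact: leq_trans (size_dehomog hB) de.
    move=> /esym F2 /esym F1; apply: (nz _ F1 F2); rewrite row2_neq0 vec20 vec21.
    by move: i ni {si eE}; apply: ord2P => ->; rewrite ?orbT.
  have [le|/ltnW le] := leqP (size (n 0)).-1 (size (n 1)).-1.
    have eE : e = (size (n 1)).-1 by apply/maxn_idPr.
    by apply: (top 1) => //; move: e2; rewrite eE; case: (size _) => [|[|]].
  have eE : e = (size (n 0)).-1 by apply/maxn_idPl.
  by apply: (top 0) => //; move: e2; rewrite eE; case: (size _) => [|[|]].
have sn i t : (n i).[t] = (n i)`_0 + (n i)`_1 * t.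
  rewrite (@horner_coef_wide _ 2); first by rewrite !big_ord_recl big_ord0 /= expr0 expr1 mulr1 addr0.
  exact: leq_trans (se i) _.
pose h : 'M[K]_2 := \matrix_(i, j) (n j)`_i.
have hE t : vec2 1 t *m h = vec2 (n 0).[t] (n 1).[t].
  by apply: row2P; rewrite mul_row2 ?vec20 ?vec21 !mxE sn mul1r mulrC.
exists h => //; exists k => // v.
have F C : C \is ishomog1 d mdeg -> along C n = k *: dehomog C -> ev C (v *m h) = k * ev C v.
  move=> hC CE; rewrite -ev_change -[RHS]mevalZ; congr (ev _ v).
  apply: (dehomog_inj (change_homog h hC) (dhomogZ _ hC)); apply: poly_ext => t.
  by rewrite dehomogE ev_change hE -nE -along_horner CE hornerZ !dehomogE /ev mevalZ.
by split; apply: F.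
Qed.

(** On the curve, the first two coordinates of T define a rational function of t
    under which the ratio a / b is invariant. Removing the common factor of the
    coordinates brings [polynomial_symmetry] into play. *)
Lemma deck_symmetry U q0 g t1 t2 T : q0 != 0 -> g != 0 ->
  (forall t, g.[t] != 0 -> [/\ U (curve_pt q0 t), b.[t] != 0 & a.[t] + t * b.[t] != 0]) ->
  (forall m, U m -> gaussP2 w m != 0) ->
  deck_transformation w U T -> g.[t1] != 0 -> g.[t2] != 0 ->
  proj_eq (apply3 T (curve_pt q0 t1)) (curve_pt q0 t2) ->
  exists2 h, preserves w h & exists c, vec2 1 t1 *m h = c *: vec2 1 t2.
Proof.
move=> q00 g0 good reg [[[_ TU] _] TG] g1 g2 [c c0 TE].
pose tau (i : 'I_2) := along (T (if i == 0 then 0 else 1)) (curve q0).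
have tauE t : vec2 (tau 0).[t] (tau 1).[t] =
    vec2 (apply3 T (curve_pt q0 t) 0 0) (apply3 T (curve_pt q0 t) 0 1).
  by rewrite /tau /= !along_horner ![in RHS]mxE.
have tau1 : vec2 (tau 0).[t1] (tau 1).[t1] = (c * q0 * b.[t2]) *: vec2 1 t2.
  rewrite tauE TE curve_ptE !mxE /= scale_vec2; congr vec2; ring.
have [_ b2 _] := good _ g2.
have tau_neq0 : (tau 0 != 0) || (tau 1 != 0).
  rewrite -negb_and; apply/negP => /andP[/eqP z0 /eqP z1].
  have /(congr1 (fun v : 'rV[K]_2 => v 0 0)) := tau1; rewrite z0 horner0 vec20 mxE vec20 mulr1 => /eqP.
  by rewrite eq_sym !mulf_eq0 (negPf c0) (negPf q00) (negPf b2).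
have key t : g.[t] != 0 -> (along w.1 tau).[t] * b.[t] = (along w.2 tau).[t] * a.[t].
  move=> gt; have [Ut bt Zt] := good t gt; have [e e0] := TG _ Ut.
  rewrite gauss_curve {1}/gaussP2 (along_horner w.1 tau) (along_horner w.2 tau).
  rewrite (_ : \row_i _ = vec2 (tau 0).[t] (tau 1).[t]); last first.
    by apply: row2P; rewrite ?vec20 ?vec21 mxE.
  rewrite tauE; set X := apply3 _ _ 0 0; set Y := apply3 _ _ 0 1; set Z := apply3 _ _ 0 2.
  set l := (_ * - _); have l0 : l != 0 by rewrite mulf_neq0 ?oppr_eq0 // expf_neq0 // mulf_neq0.
  move: l l0 => l l0 /rowP E; have := E 0; have := E 1; rewrite !mxE /= => E1 E0.
  have Z0 : Z != 0.
    apply/negP => /eqP Z0; move: E1 => /esym/eqP.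
    by rewrite Z0 mul0r !mulf_eq0 (negPf e0) (negPf l0) (negPf bt).
  apply: (mulfI Z0); rewrite !mulrA E0 E1; ring.
have {}key : along w.1 tau * b = along w.2 tau * a.
  apply: (mulfI g0); apply: poly_ext => t; rewrite !hornerM.
  have [->|gt] := eqVneq g.[t] 0; first by rewrite !mul0r.
  by rewrite key.
pose D := gcdp (tau 0) (tau 1); pose n (i : 'I_2) := tau i %/ D.
have D0 : D != 0 by rewrite gcdp_eq0 negb_and.
have tauD : forall i, tau i = n i * D.
  by apply: ord2P; rewrite divpK // ?dvdp_gcdl ?dvdp_gcdr.
have cop : coprimep (n 0) (n 1).
  have := tau_neq0; rewrite /n /D; exact: coprimep_div_gcd.
have alongD C : C \is ishomog1 d mdeg -> along C tau = D ^+ d * along C n.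
  move=> hC; apply: poly_ext => t; rewrite hornerM horner_exp !along_horner -(ev_scale _ _ hC).
  by congr (ev C _); apply/rowP => i; rewrite !mxE tauD hornerM mulrC.
have E : along w.1 n * b = along w.2 n * a.
  apply: (mulfI (expf_neq0 d D0)).
  by rewrite !mulrA -!alongD.
have [h ph hE] := polynomial_symmetry cop E.
exists h => //; have Dt : D.[t1] != 0.
  apply/negP => /eqP D1; have := tau1; rewrite !tauD !hornerM D1 !mulr0.
  move=> /(congr1 (fun v : 'rV[K]_2 => v 0 0)); rewrite vec20 mxE vec20 mulr1 => /eqP.
  by rewrite eq_sym !mulf_eq0 (negPf c0) (negPf q00) (negPf b2).
exists (D.[t1]^-1 * (c * q0 * b.[t2])); rewrite -scalerA -tau1 hE scale_vec2 !tauD !hornerM.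
by rewrite !(mulrC _ D.[t1]) !mulKf.
Qed.

(** The points of the curve with parameters in a generic fibre of a / b are in U and
    have the same image under the Gauss map, so deck transformations carry any one
    of them to any other. *)
Lemma galois_generic_fibre : galois_foliation w ->
  exists2 t : 'I_d -> K, injective t & forall i j,
    exists2 h, preserves w h & exists c, vec2 1 (t i) *m h = c *: vec2 1 (t j).
Proof.
move=> [U [[zU U0] reg _ tr]]; have [q0 q00 [g g0 gU]] := open_meets_curve zU U0.
pose g' := g * (b * (a + 'X * b)).
have g'0 : g' != 0 by rewrite !mulf_neq0 ?dehomog2_neq0 ?tangent_neq0.
have good t : g'.[t] != 0 -> [/\ U (curve_pt q0 t), b.[t] != 0 & a.[t] + t * b.[t] != 0].
  rewrite !hornerM hornerD hornerM hornerX !mulf_eq0 !negb_or => /andP[gt /andP[bt Zt]].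
  by split=> //; exact: gU.
have [p [t tinj tE]] := generic_fibre g'0.
exists t => // i j.
have [Ei gi] := tE i; have [Ej gj] := tE j.
have [Ui bi Zi] := good _ gi; have [Uj bj Zj] := good _ gj.
have [|T dT TE] := tr _ _ Ui Uj; last exact: (deck_symmetry q00 g'0 good reg dT gi gj TE).
have aE s : a.[s] + p * b.[s] = 0 -> vec3 a.[s] b.[s] (q0 * b.[s]) = b.[s] *: vec3 (- p) 1 q0.
  move=> /eqP; rewrite addr_eq0 => /eqP E.
  by apply/rowP => -[[|[|[|//]]] pr]; rewrite !mxE /= ?E; ring.
rewrite !gauss_curve !aE // !scalerA; set x := (X in X *: _); set y := (X in proj_eq _ (X *: _)).
have x0 : x != 0 by rewrite !mulf_neq0 ?expf_neq0 ?oppr_eq0 ?mulf_neq0.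
have y0 : y != 0 by rewrite !mulf_neq0 ?expf_neq0 ?oppr_eq0 ?mulf_neq0.
exists (x / y); first by rewrite mulf_neq0 ?invr_eq0.
by rewrite scalerA divfK.
Qed.

End Deck.

(** * Foliations with cyclic Galois group *)

Section Eigenbasis.
Variable K : numClosedFieldType.

(** If the second eigenvalue differs from the first there is a second eigenvector;
    otherwise the matrix is a Jordan block, which finite order makes scalar. *)
Lemma finite_order_eigenbasis (M : 'M[K]_2) : M \in unitmx ->
  (forall u : 'rV[K]_2, u != 0 -> exists2 j, (0 < j)%N & exists c, u *m M ^+ j = c *: u) ->
  exists e1, exists2 e2, wedge e1 e2 = 1 &
  exists x, exists2 y, x * y != 0 & e1 *m M = x *: e1 /\ e2 *m M = y *: e2.
Proof.
move=> Mu fin.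
have [x /eigenvalueP [e1 E1 e10]] := eigenvalue_closed M (ltn0Sn 1).
have eigen_neq0 (e : 'rV[K]_2) z : e != 0 -> e *m M = z *: e -> z != 0.
  by move=> e0 E; apply: contraNneq (mulmx_neq0 Mu e0) => z0; rewrite E z0 scale0r.
have x0 := eigen_neq0 _ _ e10 E1.
suff [e2 nz [y E2]] : exists2 e2, wedge e1 e2 != 0 & exists y, e2 *m M = y *: e2.
  exists e1, ((wedge e1 e2)^-1 *: e2); first by rewrite wedgeZr mulVf.
  exists x, y; last by split=> //; rewrite -scalemxAl E2 !scalerA mulrC.
  rewrite mulf_neq0 // (eigen_neq0 e2) //.
  by apply: contraNneq nz => ->; rewrite /wedge !mxE !mulr0 subrr.
have [v nz] := exists_independent e10.
have [k [y Ev]] : exists k y, v *m M = k *: e1 + y *: v.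
  by do 2!eexists; exact: basis_decomp nz.
have [yx|yx] := eqVneq y x.
  exists v => //; exists y; rewrite yx in Ev *.
  have v0 : v != 0 by apply: contraNneq nz => ->; rewrite /wedge !mxE !mulr0 subrr.
  have [j j0 [c Ec]] := fin v v0.
  by rewrite Ev (jordan_block_infinite_order nz x0 E1 Ev j0 Ec) scale0r add0r.
exists (v + (k / (y - x)) *: e1).
  have -> : wedge e1 (v + (k / (y - x)) *: e1) = wedge e1 v by rewrite /wedge !mxE; ring.
  by [].
exists y; have yx0 : y - x != 0 by rewrite subr_eq0.
rewrite mulmxDl -scalemxAl Ev E1 scalerA scalerDr scalerA addrAC -scalerDl addrC; congr (_ + _ *: _).
by field.
Qed.

Lemma exprz_mod (g : 'M[K]_2) k s (n : int) : g \is a GRing.unit -> (0 < k)%N -> s != 0 ->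
  g ^+ k = s *: 1 -> exists2 r, (r < k)%N & exists2 c, c != 0 & g ^ n = c *: g ^+ r.
Proof.
move=> gu k0 s0 gk.
have gq q : g ^+ (k * q) = s ^+ q *: 1 by rewrite exprM gk exprZn expr1n.
have nat n' : exists2 r, (r < k)%N & exists2 c, c != 0 & g ^+ n' = c *: g ^+ r.
  exists (n' %% k)%N; first by rewrite ltn_mod.
  exists (s ^+ (n' %/ k)); first by rewrite expf_neq0.
  by rewrite {1}(divn_eq n' k) exprD mulnC gq -scalerAl mul1r.
case: n => n; first exact: nat.
have [r rk [c c0 E]] := nat (n.+1 * k.-1)%N.
exists r => //; exists (s ^- n.+1 * c); first by rewrite mulf_neq0 ?invr_eq0 ?expf_neq0.
have gn : g ^+ n.+1 \is a GRing.unit by rewrite unitrX.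
change (g ^ Negz n) with (g ^- n.+1); apply: (mulrI gn).
rewrite divrr // -scalerA -E -scalerAr -exprD -mulnS prednK // mulnC gq scalerA mulVf ?scale1r //.
by rewrite expf_neq0.
Qed.

End Eigenbasis.

Section CyclicGalois.
Variables (K : numClosedFieldType) (d : nat) (w : pform K).
Hypothesis d1 : (1 < d)%N.
Hypothesis hA : w.1 \is ishomog1 d mdeg.
Hypothesis hB : w.2 \is ishomog1 d mdeg.
Hypothesis nz : no_common_zero w.1 w.2.
Let d0 : (0 < d)%N. Proof. exact: ltnW d1. Qed.

Lemma preserves_Gal h : preserves w h -> Gal w (conj_swap h).
Proof.
move=> ph; have hu := preserves_unit d1 hA hB nz ph; have [k k0 kE] := ph.
have conjE (u : 'rV[K]_2) : u *m conj_swap h *m swap K = u *m swap K *m h by rewrite -{1}[u]mul_swapK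
  mul_conj_swap mul_swapK.
apply: (@Gal_intro _ _ _ k) => //.
- by rewrite /conj_swap !unitmx_mul swap_unit hu.
- by move=> u; rewrite conjE (kE _).1.
- by move=> u; rewrite conjE (kE _).2.
Qed.

Lemma Gal_preserves g : Gal w g -> preserves w (conj_swap g).
Proof.
move=> Gg; have [k k0 kE] := Gal_semi_invariant hA hB nz Gg.
by exists k => // v; rewrite -[v]mul_swapK mul_conj_swap; exact: kE.
Qed.

(** The matrices moving the first root to the d roots are powers of g up to scalars,
    and g has at most k of these. *)
Lemma generator_order g (t : 'I_d -> K) x y f1 f2 k : Gal w g -> injective t ->
  (forall h, Gal w h -> exists n : int, exists2 c : K, c != 0 & h = c *: g ^ n) ->
  (forall i j, exists2 h, preserves w h & exists c, vec2 1 (t i) *m h = c *: vec2 1 (t j)) ->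
  wedge f1 f2 != 0 -> x != 0 -> f1 *m g = x *: f1 -> f2 *m g = y *: f2 ->
  (0 < k)%N -> y ^+ k = x ^+ k -> (d <= k)%N.
Proof.
move=> Gg tinj gen tr nzf x0 E1 E2 k0 yx.
have gk : g ^+ k = x ^+ k *: 1.
  apply: (row_basis_eq nzf); first by rewrite (eigen_exp _ E1) -scalemxAr mulmx1.
  by rewrite (eigen_exp _ E2) yx -scalemxAr mulmx1.
pose i0 := Ordinal d0.
(* exponent, modulo k, of the power of g that carries the first root to the i-th *)
have H i : exists r : 'I_k, exists c, vec2 1 (t i0) *m swap K *m g ^+ r = c *: (vec2 1 (t i) *m swap K).
  have [h ph [c hE]] := tr i0 i; have [n [c' c'0 nE]] := gen _ (preserves_Gal ph).
  have [r rk [c'' c''0 rE]] := @exprz_mod K g k (x ^+ k) n (proj1 Gg) k0 (expf_neq0 k x0) gk.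
  exists (Ordinal rk), ((c' * c'')^-1 * c).
  rewrite -scalerA [in RHS]scalemxAl -hE -mul_conj_swap nE rE -!scalemxAr !scalerA mulVf ?scale1r //.
  by rewrite mulf_neq0.
pose r i := xget (Ordinal k0) [set r : 'I_k | exists c,
  vec2 1 (t i0) *m swap K *m g ^+ r = c *: (vec2 1 (t i) *m swap K)].
have rP i : exists c, vec2 1 (t i0) *m swap K *m g ^+ r i = c *: (vec2 1 (t i) *m swap K).
  by rewrite /r; case: xgetP => // none; have [s] := H i; have := none s.
have rinj : injective r.
  move=> i j rij; apply: tinj; have [c Ei] := rP i; have [c' Ej] := rP j.
  rewrite rij Ej in Ei.
  have c'0 : c' != 0.
    have gr : g ^+ r j \in unitmx by case: (GalX hA hB nz (r j) Gg).
    have e0 : vec2 1 (t i0) != 0 by rewrite row2_neq0 vec20 oner_eq0.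
    have := mulmx_neq0 gr (mulmx_neq0 (swap_unit K) e0); apply: contraNneq => c'0.
    by rewrite Ej c'0 scale0r.
  move/(congr1 (fun u => u *m swap K)): Ei;
    rewrite -!scalemxAl !mul_swapK !scale_vec2 => /(congr1 (fun u : 'rV[K]_2 => (u 0 0, u 0 1))).
  rewrite !vec20 !vec21 !mulr1 => -[<- /(mulfI c'0) ->] //.
by have := leq_card r rinj; rewrite !card_ord.
Qed.

(** In an eigenbasis of a generator the monomials are eigenvectors, and those
    occurring in A or B share as eigenvalue the factor by which the generator
    multiplies A and B. As A and B do not both vanish at the first eigenvector, the
    power of the first coordinate is among them; by [generator_order] the power of
    the second one is the only other that can be. *)
Lemma cyclic_fermat (t : 'I_d -> K) : Gal_cyclic w -> injective t ->
  (forall i j, exists2 h, preserves w h & exists c, vec2 1 (t i) *m h = c *: vec2 1 (t j)) ->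
  exists2 M : 'M[K]_2, \det M = 1 &
  exists al0 al1 be0 be1, [/\ forall x y, ev w.1 (vec2 x y *m M) = al0 * x ^+ d + al1 * y ^+ d,
    forall x y, ev w.2 (vec2 x y *m M) = be0 * x ^+ d + be1 * y ^+ d &
    be0 * al1 - be1 * al0 != 0].
Proof.
move=> [g Gg gen] tinj tr.
have gu : g \in unitmx by case: Gg.
have [u u0|f1 [f2 f12 [x [y xy [E1 E2]]]]] := finite_order_eigenbasis gu.
  by have [j [j0 _ jE]] := Gal_finite d0 hA hB nz Gg u0; exists j.
move: xy; rewrite mulf_eq0 negb_or => /andP[x0 y0].
have order k : (0 < k)%N -> y ^+ k = x ^+ k -> (d <= k)%N.
  by apply: (generator_order Gg tinj gen tr _ x0 E1 E2); rewrite f12 oner_eq0.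
(* The swap has determinant -1, hence the sign of the first row. *)
pose M : 'M[K]_2 := \matrix_(i, j) (if i == 0 then - (f1 *m swap K) 0 j else (f2 *m swap K) 0 j).
have ME a b : vec2 a b *m M = (- a) *: (f1 *m swap K) + b *: (f2 *m swap K).
  by apply: row2P; rewrite mul_row2 !vec20 !vec21 !mxE /=; ring.
have detM : \det M = 1.
  have Me i j : M i j = if i == 0 then - (f1 *m swap K) 0 j else (f2 *m swap K) 0 j by rewrite mxE.
  rewrite det_2 !Me /= !mul_swap !vec20 !vec21 -f12 /wedge; ring.
have Mu : M \in unitmx by rewrite unitmxE detM unitr1.
have [k k0 kE] := Gal_preserves Gg.
have Mg a b : vec2 a b *m M *m conj_swap g = vec2 (x * a) (y * b) *m M.
  rewrite !ME mulmxDl -!scalemxAl !mul_conj_swap E1 E2 -!scalemxAl !scalerA; congr (_ *: _ + _ *: _); ring.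
have coef C : C \is ishomog1 d mdeg -> (forall v, ev C (v *m conj_swap g) = k * ev C v) ->
    exists2 c : nat -> K, (forall a b, ev C (vec2 a b *m M) = \sum_(j < d.+1) c j * (a ^+ (d - j) * b ^+ j)) &
      forall j, (j <= d)%N -> c j != 0 -> x ^+ (d - j) * y ^+ j = k.
  move=> hC inv; pose c j := mcoeff (mono d j) (change M C).
  have cE a b : ev C (vec2 a b *m M) = \sum_(j < d.+1) c j * (a ^+ (d - j) * b ^+ j).
    by rewrite -ev_change (homog_mform (change_homog M hC)) ev_mform.
  exists c => // j jd cj; apply: (mulIf cj).
  have : \poly_(j < d.+1) (x ^+ (d - j) * y ^+ j * c j) = \poly_(j < d.+1) (k * c j).
    apply: poly_ext => s; rewrite !horner_poly.
    transitivity (ev C (vec2 1 s *m M *m conj_swap g)).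
      rewrite Mg cE mulr1; apply: eq_bigr => i _; rewrite exprMn; ring.
    rewrite inv cE mulr_sumr; apply: eq_bigr => i _; rewrite expr1n; ring.
  by move=> /(congr1 (fun p : {poly K} => p`_j)); rewrite !coef_poly ltnS jd.
have [c cE cP] := coef _ hA (fun v => (kE v).1).
have [c' c'E c'P] := coef _ hB (fun v => (kE v).2).
have ends (b : nat -> K) a0 b0 : (forall j, (0 < j < d)%N -> b j = 0) ->
   \sum_(j < d.+1) b j * (a0 ^+ (d - j) * b0 ^+ j) = b 0%N * a0 ^+ d + b d * b0 ^+ d.
  move=> bz; rewrite (bigD1 ord0) //= (bigD1 ord_max) /=; last first.
    by apply/eqP => /(congr1 val) /=; apply/eqP; rewrite gtn_eqF.
  rewrite subn0 subnn !expr0 mulr1 mul1r big1 ?addr0 // => j /andP[j0 jd].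
  rewrite bz ?mul0r // lt0n; apply/andP; split.
    by apply: contraNneq j0 => j0; apply/eqP/val_inj.
  rewrite ltn_neqAle -ltnS ltn_ord andbT.
  by apply: contraNneq jd => jd; apply/eqP/val_inj.
have first a0 b0 (b : nat -> K) : b0 = 0 -> \sum_(j < d.+1) b j * (a0 ^+ (d - j) * b0 ^+ j) = b 0%N * a0 ^+ d.
  move=> ->; rewrite (bigD1 ord0) //= subn0 expr0 mulr1 big1 ?addr0 // => j j0.
  rewrite expr0n (_ : (j == 0 :> nat) = false) ?mulr0 //; apply: contraNF j0 => /eqP j0.
  by apply/eqP/val_inj.
have e1n : vec2 1 0 *m M != 0.
  by apply: (mulmx_neq0 Mu); rewrite row2_neq0 vec20 oner_eq0.
have c0 : (c 0%N != 0) || (c' 0%N != 0).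
  rewrite -negb_and; apply/negP => /andP[/eqP z1 /eqP z2].
  by apply: (nz e1n); rewrite ?cE ?c'E first // ?z1 ?z2 mul0r.
have kx : k = x ^+ d.
  by case/orP: c0 => [/(cP 0%N (leq0n d))|/(c'P 0%N (leq0n d))] <-; rewrite subn0 expr0 mulr1.
have middle j : (0 < j < d)%N -> x ^+ (d - j) * y ^+ j <> k.
  move=> /andP[j0 jd] E; have : (d <= j)%N; last by rewrite leqNgt jd.
  apply: order j0 _; apply: (mulfI (expf_neq0 (d - j) x0)).
  by rewrite E kx -exprD subnK // ltnW.
have cz j : (0 < j < d)%N -> c j = 0.
  move=> jd; apply/eqP; apply: contraT => cj.
  by case: (middle j jd); apply: cP => //; case/andP: jd => _ /ltnW.
have c'z j : (0 < j < d)%N -> c' j = 0.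
  move=> jd; apply/eqP; apply: contraT => cj.
  by case: (middle j jd); apply: c'P => //; case/andP: jd => _ /ltnW.
have AE a b : ev w.1 (vec2 a b *m M) = c 0%N * a ^+ d + c d * b ^+ d by rewrite cE ends.
have BE a b : ev w.2 (vec2 a b *m M) = c' 0%N * a ^+ d + c' d * b ^+ d by rewrite c'E ends.
exists M => //; exists (c 0%N), (c d), (c' 0%N), (c' d); split=> //; apply/eqP => D.
have [|v] := @pencil_neq0 K d w d0 hA hB nz (c' 0%N) (- c 0%N); first by rewrite oppr_eq0 orbC.
apply/negP; rewrite negbK; apply/eqP.
rewrite -(mulmxKV Mu v) [v *m _]vec2_eta AE BE.
transitivity ((c' 0%N * c d - c' d * c 0%N) * (v *m invmx M) 0 1 ^+ d); first by ring.
by rewrite D mul0r.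
Qed.

End CyclicGalois.

(** * The dichotomy *)

Theorem theorem4p4 (R : realType) (d : nat) (w : pform (Cplx R)) :
  (3 <= d)%N ->
  homogeneous_foliation d w ->
  galois_foliation w ->
  (Gal_cyclic w ->
     (flat_web d (Leg w) <->
      linearly_conjugate w (omega1 (Cplx R) d) \/
      linearly_conjugate w (omega2 (Cplx R) d))) /\
  (~ Gal_cyclic w -> flat_web d (Leg w)).
Proof.
move=> d2 [hA hB cop] gal.
have d1 : (1 < d)%N := ltnW d2.
have nz := coprime_no_common_zero (ltnW d1) hA hB cop.
have sym : symmetric_derivatives (Cplx R) := @young R.
split; last exact: flat_noncyclic sym d1 hA hB nz.
move=> cyc; split; last exact: conjugate_flat sym d2 hA hB.
move=> flat.
have [t tinj tr] := galois_generic_fibre d1 hA hB nz gal.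
have [M detM [al0 [al1 [be0 [be1 [AE BE Delta]]]]]] := cyclic_fermat d1 hA hB nz cyc tinj tr.
have [g g0 gE] := fermat_flat_proportional sym d2 hA hB detM AE BE Delta flat.
exact (@proportional_conjugate (Cplx R) d w d2 hA hB M al0 al1 be0 be1 detM AE BE Delta g g0 gE).
Qed.
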